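(* Let $G$ be either $\mathbb{Z}$ or $\mathbb{Z}_2$. Let $M$ be a connected, locally compact ANR, let $\varphi:M\times\mathbb{R}\to M$ be a flow, let $K\subset M$ be a connected isolated non-saddle set of $\varphi$, and let $i:K\hookrightarrow M$ be the inclusion map, inducing $i^*:\check{H}^*(M;G)\to\check{H}^*(K;G)$. Suppose that the complexity of the region of influence $\mathcal{I}(K)$ is $\mathfrak{c}$. Then there exist independent non-torsion elements $$\alpha_1,\ldots,\alpha_{\mathfrak{c}}\in \check{H}^1(M;G)$$ such that $i^*(\alpha_j)=0$ for every $j=1,\ldots,\mathfrak{c}$. Moreover, if $M$ is a closed, connected and $G$-orientable $n$-manifold, then there exist independent non-torsion elements $$\beta_1,\ldots,\beta_{\mathfrak{c}}\in \check{H}^{n-1}(M;G)$$ and independent non-torsion elements $$\gamma_1,\ldots,\gamma_{\mathfrak{c}}\in \check{H}^{n-1}(K;G)$$ such that $i^*(\beta_j)=\gamma_j$ for each $j=1,\ldots,\mathfrak{c}$.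
   Context: $\check{H}^*$ denotes Čech cohomology. ''Independent non-torsion elements'' is meant over the coefficient ring $G$: the elements are $G$-linearly independent (for $G=\mathbb{Z}$ they generate a free abelian subgroup of rank $\mathfrak{c}$; for $G=\mathbb{Z}_2$ they are linearly independent vectors). ANR means metric absolute neighborhood retract. For a flow $\varphi$ on $M$ write $xt=\varphi(x,t)$, and $\omega(x)=\bigcap_{t>0}\overline{x[t,\infty)}$, $\omega^*(x)=\bigcap_{t>0}\overline{x(-\infty,-t]}$. A compact invariant set $K$ is isolated if it has a compact neighborhood $N$ (isolating neighborhood) such that $K$ is the maximal invariant set in $N$; isolated invariant sets are assumed to be non-empty proper subsets of $M$. For such $N$ put $N^+=\{x\in N: x[0,\infty)\subset N\}$, $N^-=\{x\in N: x(-\infty,0]\subset N\}$. An isolating block is an isolating neighborhood $N$ for which there are compact sets $N^i,N^o\subset\partial N$ with: (1) $\partial N=N^i\cup N^o$; (2) for every $x\in N^i$ there is $\varepsilon>0$ with $x[-\varepsilon,0)\subset M\setminus N$, and for every $x\in N^o$ there is $\delta>0$ with $x(0,\delta]\subset M\setminus N$; (3) for every $x\in\partial N\setminus N^i$ there is $\varepsilon>0$ with $x[-\varepsilon,0)\subset\mathring N$, and for every $x\in\partial N\setminus N^o$ there is $\delta>0$ with $x(0,\delta]\subset\mathring N$. An invariant compactum $K$ is saddle if there is a neighborhood $U$ of $K$ such that every neighborhood $V$ of $K$ contains a point $x$ with $x[0,\infty)\not\subset U$ and $x(-\infty,0]\not\subset U$; otherwise $K$ is non-saddle. Isolated non-saddle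 sets admit isolating blocks of the form $N=N^+\cup N^-$. Let $W^s(K)=\{x\in M:\emptyset\neq\omega(x)\subset K\}$ and $W^u(K)=\{x\in M:\emptyset\neq\omega^*(x)\subset K\}$. The region of influence of $K$ is $\mathcal{I}(K)=W^s(K)\cup W^u(K)$, an open set. $K$-ends and complexity: if $N,N'$ are isolating blocks of $K$ of the form $N=N^+\cup N^-$, $N'=N'^+\cup N'^-$, a component $N_1$ of $N\setminus K$ and a component $N_1'$ of $N'\setminus K$ are related if there is $T\in\mathbb{R}$ with $N_1T\subset N_1'$; this is an equivalence relation on the components of the sets $N\setminus K$, with $N$ ranging over all such blocks, and its classes are called the $K$-ends of $\mathcal{I}(K)\setminus K$. For a fixed block $N=N^+\cup N^-$, every $K$-end is represented by exactly one component of $N\setminus K$, there are finitely many $K$-ends, and all representatives of a $K$-end lie in the same component of $\mathcal{I}(K)\setminus K$. The complexity of $\mathcal{I}(K)$ is $\mathfrak{c}=k-m$, where $k$ is the number of $K$-ends and $m$ the number of components of $\mathcal{I}(K)\setminus K$. *)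

(* Defs.v *)
From HB Require Import structures.
From mathcomp Require Import all_boot all_order all_algebra.
From mathcomp Require Import generic_quotient ring_quotient.
From mathcomp Require Import all_classical all_reals all_analysis.

Set Implicit Arguments.
Unset Strict Implicit.
Unset Printing Implicit Defensive.

Import Order.TTheory GRing.Theory Num.Theory.
Import numFieldNormedType.Exports.

Local Open Scope classical_set_scope.
Local Open Scope ring_scope.
Local Open Scope quotient_scope.

Section QuotientModule.
Variables (G : nzRingType) (V : lmodType G) (B : submodClosed V).

(* over a ring a submodClosed predicate is closed under opposites, but this is
   not inferred from the semimodule structure *)
Definition zmod_of_submod : {pred V} := B.
Fact zmod_of_submod_closed : zmod_closed zmod_of_submod.
Proof.
have memE z : (z \in zmod_of_submod) = (z \in B) by [].
split=> [|x y]; rewrite !memE ?rpred0// => xB yB.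
by rewrite -scaleN1r rpredD// rpredZ.
Qed.
HB.instance Definition _ :=
  GRing.isZmodClosed.Build V zmod_of_submod zmod_of_submod_closed.

Definition lquot : Type := Quotient.quot zmod_of_submod.
HB.instance Definition _ := GRing.Zmodule.on lquot.
HB.instance Definition _ := EqQuotient.on lquot.

Definition lquot_scale (a : G) : lquot -> lquot :=
  fun x => \pi_lquot (a *: repr x).

Lemma lquot_eqP (x y : V) :
  reflect (\pi_lquot x = \pi_lquot y) (x - y \in B).
Proof.
have -> : (x - y \in B) = (x - y \in zmod_of_submod) by [].
by rewrite Quotient.idealrBE; exact: eqP.
Qed.

Lemma lquot_piD (x y : V) : \pi_lquot (x + y) = \pi_lquot x + \pi_lquot y.
Proof. exact: Quotient.pi_add. Qed.

Lemma lquot_piZ a (x : V) : lquot_scale a (\pi_lquot x) = \pi_lquot (a *: x).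
Proof.
apply/lquot_eqP; rewrite -scalerBr rpredZ//; apply/lquot_eqP.
by rewrite reprK.
Qed.

Fact lquot_scaleA a b (v : lquot) :
  lquot_scale a (lquot_scale b v) = lquot_scale (a * b) v.
Proof. by rewrite -[v](@reprK _ lquot) !lquot_piZ scalerA. Qed.

Fact lquot_scale1 : left_id 1 lquot_scale.
Proof. by move=> v; rewrite -[v](@reprK _ lquot) lquot_piZ scale1r. Qed.

Fact lquot_scaleDr : right_distributive lquot_scale +%R.
Proof.
move=> a u v; rewrite -[u](@reprK _ lquot) -[v](@reprK _ lquot).
by rewrite -lquot_piD !lquot_piZ scalerDr lquot_piD.
Qed.

Fact lquot_scaleDl (v : lquot) : {morph lquot_scale^~ v : a b / a + b}.
Proof.
by move=> a b; rewrite -[v](@reprK _ lquot) !lquot_piZ scalerDl lquot_piD.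
Qed.

HB.instance Definition _ := GRing.Zmodule_isLmodule.Build G lquot
  lquot_scaleA lquot_scale1 lquot_scaleDr lquot_scaleDl.

End QuotientModule.

Section Subquotient.
Variables (G : nzRingType) (V : lmodType G) (Z B : submodClosed V).

Definition submod : Type := {z : V | z \in Z}.
HB.instance Definition _ := SubChoice.on submod.
HB.instance Definition _ := [SubChoice_isSubLmodule of submod by <:].

Definition sub_restr : {pred submod} := fun z => val z \in B.

Fact sub_restr_submod : submod_closed sub_restr.
Proof.
have memE z : (z \in sub_restr) = (val z \in B) by [].
split=> [|a x y]; rewrite !memE ?raddf0 ?rpred0// => xB yB.
by rewrite linearP rpredD// rpredZ.
Qed.
HB.instance Definition _ :=
  GRing.isSubmodClosed.Build G submod sub_restr sub_restr_submod.

(* Z / (Z :&: B) *)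
Definition subquot : Type := lquot sub_restr.
HB.instance Definition _ := GRing.Lmodule.on subquot.

Definition subquot_class (z : V) (zZ : z \in Z) : subquot :=
  \pi_(lquot sub_restr) (Sub z zZ : submod).

Definition subquot_repr (x : subquot) : V := val (repr (x : lquot sub_restr)).

Lemma subquot_reprP (x : subquot) : subquot_repr x \in Z.
Proof. exact: (valP (repr (x : lquot sub_restr))). Qed.

Lemma subquot_classP z z' (zZ : z \in Z) (z'Z : z' \in Z) :
  reflect (subquot_class zZ = subquot_class z'Z) (z - z' \in B).
Proof.
have -> : (z - z' \in B) =
    ((Sub z zZ : submod) - (Sub z' z'Z : submod) \in sub_restr).
  by rewrite [RHS]unfold_in raddfB.
exact: lquot_eqP.
Qed.

Lemma subquot_classK (x : subquot) : subquot_class (subquot_reprP x) = x.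
Proof.
rewrite -[RHS](@reprK _ (lquot sub_restr) x).
by congr (\pi _); exact: val_inj.
Qed.

Lemma subquot_class_linear a z z' (zZ : z \in Z) (z'Z : z' \in Z)
  (zz'Z : a *: z + z' \in Z) :
  subquot_class zz'Z = a *: subquot_class zZ + subquot_class z'Z.
Proof.
have -> : subquot_class zz'Z =
    \pi_(lquot sub_restr) (a *: (Sub z zZ : submod) + (Sub z' z'Z : submod)).
  by congr (\pi _); exact: val_inj.
by rewrite lquot_piD -lquot_piZ.
Qed.

End Subquotient.

Section SubquotientMap.
Variables (G : nzRingType) (V W : lmodType G).
Variables (Z B : submodClosed V) (Z' B' : submodClosed W) (h : {linear V -> W}).
Hypothesis hZ : forall z, z \in Z -> h z \in Z'.

Definition subquot_map (x : subquot Z B) : subquot Z' B' :=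
  subquot_class B' (hZ (subquot_reprP x)).

Lemma subquot_map_class (hB : forall z, z \in B -> h z \in B')
  z (zZ : z \in Z) :
  subquot_map (subquot_class B zZ) = subquot_class B' (hZ zZ).
Proof.
apply/subquot_classP; rewrite -linearB; apply/hB.
apply/(subquot_classP _ (subquot_reprP _) zZ).
exact: subquot_classK.
Qed.

End SubquotientMap.

(* Over G = int, linearly independent elements are in particular non-torsion. *)
Definition lin_indep (G : nzRingType) (V : lmodType G) (c : nat)
    (v : 'I_c -> V) : Prop :=
  forall a : 'I_c -> G, \sum_(j < c) a j *: v j = 0 -> forall j, a j = 0.

Section Cech.
Variables (X : topologicalType) (G : comNzRingType).

(* Open covers are indexed by the points of X, with x in U x. Every open cover
   is refined by one of this form, and V refines U along the identity of the
   index set when V x `<=` U x for all x, so these covers compute the direct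
   limit of the cohomology of the nerves over all open covers (Godement). *)
Definition pointed_cover (U : X -> set X) : Prop :=
  forall x, open (U x) /\ U x x.

(* the ordered q-simplices of the nerve of U *)
Definition nerve (U : X -> set X) (q : nat) (s : 'I_q.+1 -> X) : Prop :=
  \bigcap_(i in [set: 'I_q.+1]) U (s i) !=set0.

(* A total function stands for its restrictions to the nerves of all covers;
   only its germ along refinement matters below. *)
Definition cochain (q : nat) : Type := ('I_q.+1 -> X) -> G^o.
HB.instance Definition _ q := GRing.Lmodule.on (cochain q).

Lemma cochain_linE q a (f g : cochain q) s : (a *: f + g) s = a * f s + g s.
Proof. by []. Qed.

Definition cobound (q : nat) (f : cochain q) : cochain q.+1 :=
  fun s => \sum_(i < q.+2) (-1) ^+ i * f (s \o lift i).

Definition cech_cocycle (q : nat) : {pred cochain q} := fun f =>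
  `[< exists2 U, pointed_cover U & forall s, nerve U s -> cobound f s = 0 >].

Definition cech_coboundary (q : nat) : {pred cochain q} :=
  match q with
  | 0 => fun f =>
      `[< exists2 U, pointed_cover U & forall s, nerve U s -> f s = 0 >]
  | q'.+1 => fun f =>
      `[< exists2 U, pointed_cover U & exists g : cochain q',
          forall s, nerve U s -> f s = cobound g s >]
  end.

Lemma pointed_coverT : pointed_cover (fun=> setT).
Proof. by move=> x; split=> //; exact: openT. Qed.

Lemma pointed_coverI U V : pointed_cover U -> pointed_cover V ->
  pointed_cover (fun x => U x `&` V x).
Proof.
move=> pU pV x; have [[? ?] [? ?]] := (pU x, pV x).
by split; [exact: openI | split].
Qed.

Lemma nerveI U V q (s : 'I_q.+1 -> X) :
  nerve (fun x => U x `&` V x) s -> nerve U s /\ nerve V s.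
Proof. by move=> [y yUV]; split; exists y => i /yUV[]. Qed.

Fact cobound_is_linear q : linear (@cobound q).
Proof.
move=> a f g; apply/funext => s.
transitivity (a * cobound f s + cobound g s) => //.
rewrite /cobound mulr_sumr -big_split/=; apply: eq_bigr => i _.
by rewrite mulrCA -mulrDr.
Qed.
HB.instance Definition _ q := GRing.isLinear.Build G (cochain q) (cochain q.+1)
  _ (@cobound q) (@cobound_is_linear q).

Fact cech_cocycle_submod q : submod_closed (@cech_cocycle q).
Proof.
split=> [|a f g]; rewrite !unfold_in.
  apply/asboolP; exists (fun=> setT); first exact: pointed_coverT.
  by move=> s _; rewrite raddf0.
move=> /asboolP[U pU fU] /asboolP[V pV gV]; apply/asboolP.
exists (fun x => U x `&` V x); first exact: pointed_coverI.
move=> s /nerveI[/fU f0 /gV g0]; by rewrite cobound_is_linear cochain_linE f0 g0 mulr0 addr0.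
Qed.
HB.instance Definition _ q := GRing.isSubmodClosed.Build G (cochain q)
  (@cech_cocycle q) (@cech_cocycle_submod q).

Fact cech_coboundary_submod q : submod_closed (@cech_coboundary q).
Proof.
case: q => [|q]; (split=> [|a f g]; rewrite !unfold_in /=).
- by apply/asboolP; exists (fun=> setT); first exact: pointed_coverT.
- move=> /asboolP[U pU fU] /asboolP[V pV gV]; apply/asboolP.
  exists (fun x => U x `&` V x); first exact: pointed_coverI.
  move=> s /nerveI[/fU f0 /gV g0].
  by rewrite cochain_linE f0 g0 mulr0 addr0.
- apply/asboolP; exists (fun=> setT); first exact: pointed_coverT.
  by exists 0 => s _; rewrite raddf0.
- move=> /asboolP[U pU [f' fU]] /asboolP[V pV [g' gV]]; apply/asboolP.
  exists (fun x => U x `&` V x); first exact: pointed_coverI.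
  exists (a *: f' + g') => s /nerveI[/fU f0 /gV g0].
  by rewrite cobound_is_linear !cochain_linE f0 g0.
Qed.
HB.instance Definition _ q := GRing.isSubmodClosed.Build G (cochain q)
  (@cech_coboundary q) (@cech_coboundary_submod q).

Definition cech (q : nat) : Type :=
  subquot (@cech_cocycle q) (@cech_coboundary q).
HB.instance Definition _ q := GRing.Lmodule.on (cech q).

End Cech.

Section CechMap.
Variables (X Y : topologicalType) (G : comNzRingType) (f : X -> Y).
Hypothesis cf : continuous f.

Definition cochain_pull (q : nat) (c : cochain Y G q) : cochain X G q :=
  fun s => c (f \o s).

Fact cochain_pull_is_linear q : linear (@cochain_pull q).
Proof. by []. Qed.
HB.instance Definition _ q := GRing.isLinear.Build G (cochain Y G q)
  (cochain X G q) _ (@cochain_pull q) (@cochain_pull_is_linear q).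

Lemma pointed_cover_pull (U : Y -> set Y) :
  pointed_cover U -> pointed_cover (fun x => f @^-1` U (f x)).
Proof.
move=> pU x; have [oU Ux] := pU (f x); split=> //.
by apply: open_comp => // y _; exact: cf.
Qed.

Lemma nerve_pull U q (s : 'I_q.+1 -> X) :
  nerve (fun x => f @^-1` U (f x)) s -> nerve U (f \o s).
Proof. by move=> [x Ux]; exists (f x) => i /Ux. Qed.

Fact cochain_pull_cocycle q (c : cochain Y G q) :
  c \in @cech_cocycle Y G q -> cochain_pull c \in @cech_cocycle X G q.
Proof.
rewrite !unfold_in => /asboolP[U pU cU]; apply/asboolP.
exists (fun x => f @^-1` U (f x)); first exact: pointed_cover_pull.
by move=> s /nerve_pull/cU.
Qed.

Fact cochain_pull_coboundary q (c : cochain Y G q) :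
  c \in @cech_coboundary Y G q -> cochain_pull c \in @cech_coboundary X G q.
Proof.
case: q c => [|q] c; rewrite !unfold_in /=.
  move=> /asboolP[U pU cU]; apply/asboolP.
  exists (fun x => f @^-1` U (f x)); first exact: pointed_cover_pull.
  by move=> s /nerve_pull/cU.
move=> /asboolP[U pU [g gU]]; apply/asboolP.
exists (fun x => f @^-1` U (f x)); first exact: pointed_cover_pull.
by exists (cochain_pull g) => s /nerve_pull/gU.
Qed.

Definition cech_map (q : nat) : cech Y G q -> cech X G q :=
  subquot_map (h := @cochain_pull q) _ (@cochain_pull_cocycle q).

End CechMap.

Definition stdsimplex (R : realType) (n : nat) : set 'rV[R]_n.+1 :=
  [set t | (forall i, 0 <= t 0 i) /\ \sum_(i < n.+1) t 0 i = 1].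
Arguments stdsimplex : clear implicits.

Section Simplex.
Variable R : realType.

(* the face opposite to the i-th vertex *)
Definition face_pt (n : nat) (i : 'I_n.+2) (t : 'rV[R]_n.+1) : 'rV[R]_n.+2 :=
  \row_(j < n.+2) if unlift i j is Some k then t 0 k else 0.

Fact face_ptP n i t : t \in stdsimplex R n -> face_pt i t \in stdsimplex R n.+1.
Proof.
rewrite !inE => -[t0 t1]; split=> [j|].
  by rewrite mxE; case: unliftP.
rewrite (bigD1_ord i)//= mxE unlift_none add0r -[RHS]t1.
by apply: eq_bigr => j _; rewrite mxE liftK.
Qed.

Definition face (n : nat) (i : 'I_n.+2) (t : stdsimplex R n) :
    stdsimplex R n.+1 :=
  exist _ (face_pt i (val t)) (face_ptP i (valP t)).

End Simplex.

Section SingularHomology.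
Variables (R : realType) (X : topologicalType) (G : comNzRingType).

(* Formal G-combinations of arbitrary functions on the standard simplex; the
   singular chains of a subspace A are those in sing_chains A. *)
Definition schain (n : nat) : Type := (stdsimplex R n -> X) -> G^o.
HB.instance Definition _ n := GRing.Lmodule.on (schain n).

Definition sing_chains (A : set X) (n : nat) : {pred schain n} := fun c =>
  `[< finite_set [set s | c s != 0] /\
      forall s, c s != 0 -> continuous s /\ range s `<=` A >].

Definition sboundary (n : nat) (c : schain n.+1) : schain n := fun t =>
  \sum_(i < n.+2) (-1) ^+ i *
    \sum_(s \in [set s : stdsimplex R n.+1 -> X | s \o face i = t]) c s.

Definition rel_cycle (A : set X) (n : nat) : {pred schain n} :=
  match n with
  | 0 => fun c => c \in @sing_chains setT 0
  | n'.+1 => fun c => (c \in @sing_chains setT n'.+1) &&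
                      (sboundary c \in @sing_chains A n')
  end.

Definition rel_bound (A : set X) (n : nat) : {pred schain n} := fun c =>
  `[< exists2 d, d \in @sing_chains setT n.+1 &
      c - sboundary d \in @sing_chains A n >].

Lemma schain_linE n a (f g : schain n) s : (a *: f + g) s = a * f s + g s.
Proof. by []. Qed.

Fact sing_chains_submod A n : submod_closed (@sing_chains A n).
Proof.
split=> [|a f g]; rewrite !unfold_in.
  apply/asboolP; split=> [|s]; last by rewrite eqxx.
  rewrite (_ : [set _ | _] = set0)//; apply/seteqP; split=> s //=.
  by rewrite eqxx.
move=> /asboolP[ff fA] /asboolP[gf gA]; apply/asboolP.
have fg s : (a *: f + g) s != 0 -> f s != 0 \/ g s != 0.
  rewrite schain_linE; have [->|] := eqVneq (f s) 0; last by left.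
  by rewrite mulr0 add0r; right.
split=> [|s /fg[/fA//|/gA//]].
apply: (@sub_finite_set _ _ ([set s | f s != 0] `|` [set s | g s != 0])).
  by move=> s /fg.
by rewrite finite_setU.
Qed.
HB.instance Definition _ A n := GRing.isSubmodClosed.Build G (schain n)
  (@sing_chains A n) (@sing_chains_submod A n).

Lemma sboundary_linear n a (f g : schain n.+1) :
  f \in @sing_chains setT n.+1 -> g \in @sing_chains setT n.+1 ->
  sboundary (a *: f + g) = a *: sboundary f + sboundary g.
Proof.
rewrite !unfold_in => /asboolP[ff _] /asboolP[gf _].
pose D := [set s | f s != 0] `|` [set s | g s != 0].
have fD : finite_set D by rewrite finite_setU.
have wid (h : schain n.+1) A : (forall s, ~ D s -> h s = 0) ->
    \sum_(s \in A) h s = \sum_(s \in A `&` D) h s.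
  move=> hD; apply/esym/fsbig_widen => [s []//|s [As nDs]].
  by apply: hD => Ds; apply: nDs.
have f0 s : ~ D s -> f s = 0.
  by move=> nDs; apply/eqP/negPn/negP => fs; apply: nDs; left.
have g0 s : ~ D s -> g s = 0.
  by move=> nDs; apply/eqP/negPn/negP => gs; apply: nDs; right.
have fg0 s : ~ D s -> (a *: f + g) s = 0.
  by move=> nDs; rewrite schain_linE f0// g0// mulr0 addr0.
apply/funext => t; rewrite schain_linE /sboundary mulr_sumr -big_split/=.
apply: eq_bigr => i _; rewrite (wid f _ f0) (wid g _ g0) (wid _ _ fg0).
have fAD : finite_set
    ([set s : stdsimplex R n.+1 -> X | s \o face i = t] `&` D).
  exact: finite_setIr.
rewrite (eq_fsbigr (fun s => a * f s + g s)); last by [].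
by rewrite fsbig_split// -fsbig_distrr//= mulrDr mulrCA.
Qed.

Lemma sing_chains_lin A n a (f g : schain n) :
  f \in @sing_chains A n -> g \in @sing_chains A n ->
  a *: f + g \in @sing_chains A n.
Proof. by move=> fA gA; rewrite rpredD// rpredZ. Qed.

Fact sboundary0 n : sboundary (0 : schain n.+1) = 0.
Proof.
have := @sboundary_linear n (-1) 0 0 (rpred0 _) (rpred0 _).
by rewrite scaler0 addr0 scaleN1r addNr.
Qed.

Fact rel_cycle_submod A n : submod_closed (@rel_cycle A n).
Proof.
case: n => [|n]; first exact: sing_chains_submod.
have memE (c : schain n.+1) : (c \in @rel_cycle A n.+1) =
  (c \in @sing_chains setT n.+1) && (sboundary c \in @sing_chains A n) by [].
split=> [|a f g]; rewrite !memE ?sboundary0 ?rpred0//.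
move=> /andP[fT fA] /andP[gT gA].
by rewrite sboundary_linear// !sing_chains_lin.
Qed.
HB.instance Definition _ A n := GRing.isSubmodClosed.Build G (schain n)
  (@rel_cycle A n) (@rel_cycle_submod A n).

Fact rel_bound_submod A n : submod_closed (@rel_bound A n).
Proof.
split=> [|a f g]; rewrite !unfold_in.
  by apply/asboolP; exists 0; rewrite ?sboundary0 ?subr0 rpred0.
move=> /asboolP[d dT fd] /asboolP[e eT ge]; apply/asboolP.
exists (a *: d + e); first exact: sing_chains_lin.
by rewrite sboundary_linear// opprD addrACA -scalerBr sing_chains_lin.
Qed.
HB.instance Definition _ A n := GRing.isSubmodClosed.Build G (schain n)
  (@rel_bound A n) (@rel_bound_submod A n).

Definition sing_homology (A : set X) (n : nat) : Type :=
  subquot (@rel_cycle A n) (@rel_bound A n).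
HB.instance Definition _ A n := GRing.Lmodule.on (sing_homology A n).

Lemma sing_chains_sub A B n (c : schain n) : A `<=` B ->
  c \in @sing_chains A n -> c \in @sing_chains B n.
Proof.
move=> AB; rewrite !unfold_in => /asboolP[fc cA]; apply/asboolP; split=> // s.
by move=> /cA[cs sA]; split=> //; exact: subset_trans AB.
Qed.

Fact rel_cycle_sub A B n : A `<=` B ->
  forall c, c \in @rel_cycle A n -> idfun c \in @rel_cycle B n.
Proof.
case: n => [//|n] AB c /andP[cT cA]; apply/andP; split=> //.
exact: sing_chains_sub cA.
Qed.

Definition rel_map (A B : set X) (n : nat) (AB : A `<=` B) :
    sing_homology A n -> sing_homology B n :=
  subquot_map (h := idfun) _ (rel_cycle_sub AB).

(* A G-orientation is a choice of generators of the local homology modules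
   H_n(X, X \ x; G) which locally come from a class of H_n(X, X \ U; G) *)
Definition local_generator (n : nat) (x : X)
    (mu : sing_homology (~` [set x]) n) : Prop :=
  forall z : sing_homology (~` [set x]) n, exists r : G, z = r *: mu.

Lemma setC_point (U : set X) y : U y -> ~` U `<=` ~` [set y].
Proof. by move=> Uy z nUz zy; apply: nUz; rewrite zy. Qed.

Definition orientation (n : nat)
    (mu : forall x : X, sing_homology (~` [set x]) n) : Prop :=
  (forall x, local_generator (mu x)) /\
  (forall x : X, exists2 U : set X, nbhs x U &
     exists muU : sing_homology (~` U) n,
       forall y (Uy : U y), rel_map (setC_point Uy) muU = mu y).

Definition orientable (n : nat) : Prop :=
  exists mu : forall x : X, sing_homology (~` [set x]) n, orientation mu.

Definition locally_euclidean (n : nat) : Prop :=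
  forall x : X, exists (U : set X) (V : set 'rV[R]_n)
      (f : X -> 'rV[R]_n) (g : 'rV[R]_n -> X),
    [/\ open U /\ U x, open V,
        {within U, continuous f} /\ {within V, continuous g},
        (forall y, U y -> V (f y) /\ g (f y) = y) &
        (forall v, V v -> U (g v) /\ f (g v) = v)].

End SingularHomology.

(* Hausdorff and second countable hold for every compact metric space. *)
Definition closed_manifold (R : realType) (M : metricType R) (n : nat) : Prop :=
  compact [set: M] /\ locally_euclidean R M n.

Definition neighborhood_retract (X : topologicalType) (A : set X) : Prop :=
  exists (U : set X) (r : X -> X),
    [/\ set_nbhs A U, {within U, continuous r},
        (forall x, U x -> A (r x)) & (forall a, A a -> r a = a)].

Definition closed_embedding (X Y : topologicalType) (h : X -> Y) : Prop :=
  [/\ continuous h, injective h,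
      (forall U, open U -> exists2 V, open V & U = h @^-1` V) &
      closed (range h)].

(* Borsuk's definition: a neighborhood retract of every metric space in which it
   is embedded as a closed subset. *)
Definition metric_ANR (R : realType) (M : metricType R) : Prop :=
  forall (X : metricType R) (h : M -> X),
    closed_embedding h -> neighborhood_retract (range h).

Section Flow.
Variables (R : realType) (M : topologicalType) (phi : M * R -> M).

Definition is_flow : Prop :=
  [/\ continuous phi,
      (forall x, phi (x, 0) = x) &
      (forall x s t, phi (phi (x, s), t) = phi (x, s + t))].

(* written x I and A t, for a point x, an interval I and a time t *)
Definition orbit_arc (x : M) (I : set R) : set M := [set phi (x, t) | t in I].
Definition translate (A : set M) (t : R) : set M := [set phi (x, t) | x in A].

Definition omega_lim (x : M) : set M :=
  \bigcap_(t in [set t : R | 0 < t]) closure (orbit_arc x `[t, +oo[).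
Definition alpha_lim (x : M) : set M :=
  \bigcap_(t in [set t : R | 0 < t]) closure (orbit_arc x `]-oo, - t]).

Definition invariant_set (A : set M) : Prop :=
  forall x t, A x -> A (phi (x, t)).

Definition isolating_nbhd (K N : set M) : Prop :=
  [/\ compact N, set_nbhs K N, invariant_set K &
      forall A, invariant_set A -> A `<=` N -> A `<=` K].

Definition isolated_invariant (K : set M) : Prop :=
  [/\ compact K, invariant_set K, K !=set0, K != setT &
      exists N, isolating_nbhd K N].

Definition Nplus (N : set M) : set M :=
  [set x | N x /\ orbit_arc x `[0, +oo[ `<=` N].
Definition Nminus (N : set M) : set M :=
  [set x | N x /\ orbit_arc x `]-oo, 0] `<=` N].

Definition frontier (N : set M) : set M := closure N `\` interior N.

Definition isolating_block (K N : set M) : Prop :=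
  isolating_nbhd K N /\
  exists Ni No : set M,
    [/\ [/\ compact Ni, compact No & frontier N = Ni `|` No],
        (forall x, Ni x -> exists2 e : R, 0 < e &
           orbit_arc x `[- e, 0[ `<=` ~` N),
        (forall x, No x -> exists2 d : R, 0 < d &
           orbit_arc x `]0, d] `<=` ~` N),
        (forall x, (frontier N `\` Ni) x -> exists2 e : R, 0 < e &
           orbit_arc x `[- e, 0[ `<=` interior N) &
        (forall x, (frontier N `\` No) x -> exists2 d : R, 0 < d &
           orbit_arc x `]0, d] `<=` interior N)].

Definition saddle (K : set M) : Prop :=
  exists2 U, set_nbhs K U & forall V, set_nbhs K V ->
    exists2 x, V x & ~ (orbit_arc x `[0, +oo[ `<=` U) /\
                     ~ (orbit_arc x `]-oo, 0] `<=` U).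

Definition stable_set (K : set M) : set M :=
  [set x | omega_lim x !=set0 /\ omega_lim x `<=` K].
Definition unstable_set (K : set M) : set M :=
  [set x | alpha_lim x !=set0 /\ alpha_lim x `<=` K].
Definition influence (K : set M) : set M := stable_set K `|` unstable_set K.

Definition components (A : set M) : set (set M) :=
  [set connected_component A x | x in A].

Definition nonsaddle_block (K N : set M) : Prop :=
  isolating_block K N /\ N = Nplus N `|` Nminus N.

Definition end_reps (K : set M) : set (set M) :=
  \bigcup_(N in nonsaddle_block K) components (N `\` K).

Definition end_related (C D : set M) : Prop := exists t, translate C t `<=` D.

(* end_related is an equivalence relation on end_reps when K is isolated and
   non-saddle. *)
Definition end_class (K C : set M) : set (set M) :=
  [set D | end_reps K D /\ end_related C D].

Definition K_ends (K : set M) : set (set (set M)) :=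
  [set end_class K C | C in end_reps K].

(* c = k - m, written additively to avoid truncated subtraction *)
Definition complexity_is (K : set M) (c : nat) : Prop :=
  exists k m : nat,
    [/\ (K_ends K #= `I_k)%card,
        (components (influence K `\` K) #= `I_m)%card &
        k = (m + c)%N].

End Flow.

Section Inclusion.
Variables (M : topologicalType) (K : set M).

Fact incl_continuous : continuous (set_val : K -> M).
Proof. exact: initial_continuous. Qed.

Definition cech_restrict (G : comNzRingType) (q : nat) :
    cech M G q -> cech K G q :=
  @cech_map _ _ G _ incl_continuous q.

End Inclusion.

(* Main.v *)
From HB Require Import structures.
Require Import Defs.
From mathcomp Require Import all_boot all_order all_algebra all_fingroup.
From mathcomp Require Import all_classical all_reals all_analysis.
From mathcomp Require Import ring lra zify.

Set Implicit Arguments.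
Unset Strict Implicit.
Unset Printing Implicit Defensive.

Import Order.TTheory GRing.Theory Num.Theory.
Import numFieldNormedType.Exports.

Local Open Scope classical_set_scope.
Local Open Scope ring_scope.

(* For a block N = N+ u N-, flowing backwards or forwards shows that the K-ends are
   the components of N \ K; so these are finitely many, each is open and closed in
   N \ K, accumulates on K and lies in a component of I(K) \ K. Choosing a base end
   in every component of I(K) \ K leaves c ends A_1, ..., A_c, each connected to
   its base end outside K.

   Degree 1: alpha_i is the Mayer-Vietoris coboundary, for M = int N u (M \ K), of
   the indicator function of A_i. If a combination is the coboundary of phi, then
   phi is constant on K, it jumps by a_i from K to A_i and by 0 from K to the base
   end, and it takes equal values on these two ends; so a_i = 0.

   Degree n - 1: let tau_x denote a cocycle concentrated near x that represents the
   dual of the local orientation at x. Let x be close to K in A_i and b close to K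
   in the base end. For some scalar k, tau_x - k tau_b is a coboundary d eta_1
   supported off K (along I(K) \ K) and a coboundary d eta_2 supported in N (along
   K), and beta_i = eta_1 - eta_2. If a combination is a coboundary on K,
   then correcting the corresponding combination of the -eta_2 near K and cutting
   it down to A_i produces a primitive of - a_i tau_x, and evaluation on the
   fundamental class gives a_i = 0.

   Cohomology classes are represented by functions on finite lists of points, of
   which only the values on fine lists matter (Alexander-Spanier cochains), and
   homology classes by chains of fine lists (Vietoris chains). *)

(** * Chains of lists *)

(** The orientation is given in singular homology and the classes live in Cech cohomology, so Cech
    cochains have to be evaluated on singular cycles. Chains of fine lists serve as the bridge: a
    singular simplex is replaced by the image of a fine list chain of the standard simplex, natural
    in the faces. The global input is that [a * tau_x] is a coboundary on [M] only for [a = 0]. It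
    is tested on list cycles whose values on the [tau_y] are the local degrees of the orientation.
    These cycles are built for each fineness separately, with no compatibility among them: a given
    primitive is tested at its own fineness, so no inverse limit is formed. The same fact makes the
    scalars found along [K] and along [I(K) \ K] agree, so that [eta_1 - eta_2] is a cocycle.
    Building the cycles and moving [tau_x] rest on two facts about Euclidean space: a generator for
    top cohomology with compact supports, and the triviality of relative cycles with zero local
    degrees. Both become finite after rounding to a grid, because a label cocycle around the
    midpoint of a cube reads off the coefficient of a single simplex. *)

Section Chains.
Variable G : comNzRingType.

(* Formal combinations of finite lists of points. Only their values ev F z on
   all functions F of lists matter; lists may be empty, so that the complex is
   augmented. *)
Definition chain (T : eqType) : Type := seq (G * seq T).

Section One.
Variable T : eqType.
Implicit Types (F : seq T -> G) (z : chain T) (s : seq T).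

Definition ev F (z : seq (G * seq T)) : G := \sum_(p <- z) p.1 * F p.2.

Lemma ev_nil F : ev F [::] = 0. Proof. by rewrite /ev big_nil. Qed.
Lemma ev_cons F p z : ev F (p :: z) = p.1 * F p.2 + ev F z.
Proof. by rewrite /ev big_cons. Qed.
Lemma ev_cat F z w : ev F (z ++ w) = ev F z + ev F w.
Proof. by rewrite /ev big_cat. Qed.
Lemma ev1 F s : ev F [:: (1, s)] = F s.
Proof. by rewrite ev_cons ev_nil addr0 mul1r. Qed.

Lemma eq_ev_in F F' z : (forall p, p \in z -> F p.2 = F' p.2) -> ev F z = ev F' z.
Proof. by move=> FF; apply: eq_big_seq => p /FF ->. Qed.
Lemma eq_ev F F' z : F =1 F' -> ev F z = ev F' z.
Proof. by move=> FF; apply: eq_ev_in => p _. Qed.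
Lemma ev_0 F z : (forall p, p \in z -> F p.2 = 0) -> ev F z = 0.
Proof. by move=> F0; rewrite /ev big_seq big1// => p /F0 ->; rewrite mulr0. Qed.
Lemma ev_addf F F' z : ev (fun s => F s + F' s) z = ev F z + ev F' z.
Proof. by rewrite /ev -big_split; apply: eq_bigr => p _; rewrite mulrDr. Qed.
Lemma ev_scalef a F z : ev (fun s => a * F s) z = a * ev F z.
Proof. by rewrite /ev mulr_sumr; apply: eq_bigr => p _; rewrite mulrCA. Qed.
Lemma ev_oppf F z : ev (fun s => - F s) z = - ev F z.
Proof. by rewrite /ev -sumrN; apply: eq_bigr => p _; rewrite mulrN. Qed.
Lemma ev_subf F F' z : ev (fun s => F s - F' s) z = ev F z - ev F' z.
Proof. by rewrite ev_addf ev_oppf. Qed.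
Lemma ev_sumf I (r : seq I) (P : pred I) (F : I -> seq T -> G) z :
  ev (fun s => \sum_(i <- r | P i) F i s) z = \sum_(i <- r | P i) ev (F i) z.
Proof.
by rewrite /ev exchange_big/=; apply: eq_bigr => p _; rewrite mulr_sumr.
Qed.

Definition scalec a z : chain T := [seq (a * p.1, p.2) | p <- z].
Lemma ev_scale F a z : ev F (scalec a z) = a * ev F z.
Proof. by rewrite /ev big_map mulr_sumr; apply: eq_bigr => p _; rewrite mulrA. Qed.
Definition oppc z : chain T := scalec (-1) z.
Lemma ev_opp F z : ev F (oppc z) = - ev F z.
Proof. by rewrite ev_scale mulN1r. Qed.

Lemma mem_scalec a z p : p \in scalec a z -> exists2 q, q \in z & p.2 = q.2.
Proof. by move=> /mapP[q qz ->]; exists q. Qed.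

Lemma ev_filter F (P : pred (seq T)) z :
  ev F [seq p <- z | P p.2] = ev (fun s => if P s then F s else 0) z.
Proof.
rewrite /ev big_filter big_mkcond; apply: eq_bigr => p _.
by case: ifP; rewrite ?mulr0.
Qed.

Lemma ev_filter_coeff (P : pred (seq T)) z F :
  (forall t, ~~ P t -> ev (fun s => (s == t)%:R) z = 0) ->
  ev F [seq p <- z | P p.2] = ev F z.
Proof.
move=> z0; pose S := undup [seq p.2 | p <- z].
have evS H : ev H z = \sum_(t <- S) H t * ev (fun s => (s == t)%:R) z.
  transitivity (ev (fun s => \sum_(t <- S) H t * (s == t)%:R) z).
    apply: eq_ev_in => p pz; rewrite (bigD1_seq p.2) ?undup_uniq//=; last first.
      by rewrite mem_undup; apply/mapP; exists p.
    rewrite eqxx mulr1 big1 ?addr0// => t /negPf tp.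
    by rewrite eq_sym tp mulr0.
  by rewrite ev_sumf; apply: eq_bigr => t _; rewrite ev_scalef.
rewrite ev_filter !evS; apply: eq_bigr => t _.
by case: (boolP (P t)) => // /z0 ->; rewrite !mulr0.
Qed.

(** The alternating sum of deletions in the form d(xt) = t - x(dt), which turns identities into
    inductions on the list. The boundary of a single point is the empty list, the augmentation. *)
Fixpoint bd1 (s : seq T) : chain T :=
  if s is x :: t then (1, t) :: [seq (- p.1, x :: p.2) | p <- bd1 t] else [::].

Definition dc F s : G := ev F (bd1 s).

Lemma dc_nil F : dc F [::] = 0. Proof. exact: ev_nil. Qed.
Lemma dc_cons F x t : dc F (x :: t) = F t - dc (fun u => F (x :: u)) t.
Proof.
rewrite /dc ev_cons mul1r; congr (_ + _).
by rewrite /ev big_map -sumrN; apply: eq_bigr => p _; rewrite mulNr.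
Qed.

Lemma bd1_sub s p : p \in bd1 s -> subseq p.2 s /\ size p.2 = (size s).-1.
Proof.
elim: s p => [//|x t IH] p; rewrite inE => /orP[/eqP->|/mapP[q qb ->]].
  by split=> //; exact: subseq_cons.
have [qt sq] := IH _ qb; split=> /=; first by rewrite eqxx.
by rewrite sq; case: t qb {IH qt sq}.
Qed.

Lemma bd1_mem s p x : p \in bd1 s -> x \in p.2 -> x \in s.
Proof. by move=> /bd1_sub[/mem_subseq h _]; exact: h. Qed.
Lemma bd1_size s p : p \in bd1 s -> size s = (size p.2).+1.
Proof. by case: s => // x s /bd1_sub[_ ->]. Qed.

Lemma eq_dc F F' s : F =1 F' -> dc F s = dc F' s.
Proof. exact: eq_ev. Qed.
Lemma eq_dc_in F F' s :
  (forall t, subseq t s -> size s = (size t).+1 -> F t = F' t) -> dc F s = dc F' s.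
Proof.
by move=> FF; apply: eq_ev_in => p pz; apply: FF;
  [have [] := bd1_sub pz | exact: bd1_size].
Qed.

Lemma dcB F F' s : dc (fun u => F u - F' u) s = dc F s - dc F' s.
Proof. exact: ev_subf. Qed.
Lemma dcD F F' s : dc (fun u => F u + F' u) s = dc F s + dc F' s.
Proof. exact: ev_addf. Qed.
Lemma dcZ a F s : dc (fun u => a * F u) s = a * dc F s.
Proof. exact: ev_scalef. Qed.
Lemma dc_sum I (r : seq I) (P : pred I) (F : I -> seq T -> G) s :
  dc (fun u => \sum_(i <- r | P i) F i u) s = \sum_(i <- r | P i) dc (F i) s.
Proof. exact: ev_sumf. Qed.

Lemma dcK F s : dc (dc F) s = 0.
Proof.
elim: s F => [|x t IH] F; first by rewrite dc_nil.
rewrite dc_cons [X in _ - X](eq_dc (F' := fun u => F u - dc (fun w => F (x :: w)) u)).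
  by rewrite dcB IH subr0 subrr.
by move=> u; rewrite dc_cons.
Qed.

Lemma dcE F s : dc F s = \sum_(i < size s) (-1) ^+ i * F (take i s ++ drop i.+1 s).
Proof.
elim: s F => [|x t IH] F; first by rewrite dc_nil big_ord0.
rewrite dc_cons IH big_ord_recl/= expr0 mul1r drop0; congr (_ + _).
rewrite -sumrN; apply: eq_bigr => i _.
by rewrite /bump/= exprS mulN1r mulNr.
Qed.

Definition bindc (S : eqType) (f : seq T -> seq (G * seq S)) z : chain S :=
  flatten [seq [seq (p.1 * q.1, q.2) | q <- f p.2] | p <- z].

Definition bd z : chain T := bindc bd1 z.

Definition consc a z : chain T := [seq (p.1, a :: p.2) | p <- z].
Lemma ev_consc a F z : ev F (consc a z) = ev (fun s => F (a :: s)) z.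
Proof. by rewrite /ev big_map. Qed.

End One.

Section Two.
Variables S T : eqType.

Lemma ev_bind (f : seq T -> seq (G * seq S)) (F : seq S -> G) (z : chain T) :
  ev F (bindc f z) = ev (fun s => ev F (f s)) z.
Proof.
rewrite /ev /bindc big_flatten/= big_map; apply: eq_bigr => p _.
by rewrite big_map mulr_sumr; apply: eq_bigr => q _; rewrite mulrA.
Qed.

Lemma mem_bind (f : seq T -> seq (G * seq S)) (z : chain T) p :
  p \in bindc f z -> exists2 q, q \in z & exists2 r, r \in f q.2 & p.2 = r.2.
Proof.
move=> /flattenP[l /mapP[q qz ->]] /mapP[r rf ->].
by exists q => //; exists r.
Qed.

Definition mapc (f : T -> S) (z : chain T) : chain S :=
  [seq (p.1, map f p.2) | p <- z].
Lemma ev_mapc f F z : ev F (mapc f z) = ev (fun s => F (map f s)) z.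
Proof. by rewrite /ev big_map. Qed.
Lemma mem_mapc f z p : p \in mapc f z -> exists2 q, q \in z & p.2 = map f q.2.
Proof. by move=> /mapP[q qz ->]; exists q. Qed.

Lemma dc_map (f : T -> S) (F : seq S -> G) s :
  dc F (map f s) = dc (fun t => F (map f t)) s.
Proof. by elim: s F => [|x t IH] F; rewrite ?dc_nil//= !dc_cons IH. Qed.

(** The prism operator from [map f] to [map g]: a pivot appears under both maps, the points before
    it under [f], those after it under [g]. *)
Fixpoint prism1 (f g : T -> S) (s : seq T) : chain S :=
  if s is x :: t then (1, f x :: g x :: map g t) ::
     [seq (- p.1, f x :: p.2) | p <- prism1 f g t]
  else [::].

Lemma ev_prism_cons f g F x t : ev F (prism1 f g (x :: t)) =
  F (f x :: g x :: map g t) - ev (fun u => F (f x :: u)) (prism1 f g t).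
Proof.
rewrite /= ev_cons mul1r; congr (_ + _).
by rewrite /ev big_map -sumrN; apply: eq_bigr => p _; rewrite mulNr.
Qed.

Lemma prism_homotopy f g (F : seq S -> G) (s : seq T) :
  F (map g s) - F (map f s) =
  dc (fun t => ev F (prism1 f g t)) s + ev (dc F) (prism1 f g s).
Proof.
elim: s F => [|x t IH] F; first by rewrite dc_nil ev_nil subrr addr0.
rewrite dc_cons [X in _ - X + _](eq_dc (F' := fun u => F (f x :: g x :: map g u) -
   ev (fun w => F (f x :: w)) (prism1 f g u))); last first.
  by move=> u; rewrite ev_prism_cons.
rewrite ev_prism_cons [in X in _ + (_ - X)](eq_ev (F' := fun u => F u - dc (fun w => F (f x :: w)) u)); last first.
  by move=> u; rewrite dc_cons.
rewrite ev_subf.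
have := IH (fun w => F (f x :: w)).
set A := dc _ t; set B := ev _ (prism1 f g t) => e.
have -> : B = F (f x :: map g t) - F (f x :: map f t) - A by rewrite e; ring.
rewrite dcB -/A !dc_cons dc_map; ring.
Qed.

Lemma prism1_size f g s p : p \in prism1 f g s -> size p.2 = (size s).+1.
Proof.
elim: s p => [//|x t IH] p; rewrite inE => /orP[/eqP->|/mapP[q /IH sq ->]] /=.
  by rewrite size_map.
by rewrite sq.
Qed.

Lemma prism1_split f g s p : p \in prism1 f g s ->
  exists s1 x s2, s = s1 ++ x :: s2 /\ p.2 = map f s1 ++ f x :: g x :: map g s2.
Proof.
elim: s p => [//|x t IH] p; rewrite inE => /orP[/eqP->|/mapP[q /IH h ->]] /=.
  by exists [::], x, t.
have [s1 [y [s2 [-> ->]]]] := h.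
by exists (x :: s1), y, s2.
Qed.

Lemma prism1_mem f g s p y : p \in prism1 f g s -> y \in p.2 ->
  exists2 x, x \in s & y = f x \/ y = g x.
Proof.
move=> /prism1_split[s1 [x [s2 [-> ->]]]].
rewrite mem_cat => /orP[/mapP[w ws ->]|].
  by exists w; [rewrite mem_cat ws | left].
rewrite !inE => /or3P[/eqP->|/eqP->|/mapP[w ws ->]].
- by exists x; [rewrite mem_cat mem_head orbT | left].
- by exists x; [rewrite mem_cat mem_head orbT | right].
- by exists w; [rewrite mem_cat inE ws !orbT | right].
Qed.

End Two.

Lemma ev_bd (T : eqType) (F : seq T -> G) z : ev F (bd z) = ev (dc F) z.
Proof. exact: ev_bind. Qed.

Lemma bd_mem (T : eqType) (z : chain T) p : p \in bd z ->
  exists2 q, q \in z & subseq p.2 q.2 /\ size q.2 = (size p.2).+1.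
Proof.
move=> /mem_bind[q qz [r rq ->]]; exists q => //; split; last exact: bd1_size.
by have [] := bd1_sub rq.
Qed.

Section Sort.
Variables (disp : Order.disp_t) (T : orderType disp).
Implicit Types (F : seq T -> G) (u t : seq T).

Definition minl (u : seq T) (x : T) : T := foldr Order.min x u.

Lemma minl_le u x y : y \in x :: u -> (minl u x <= y)%O.
Proof.
elim: u y => [|z u IH] y; first by rewrite inE => /eqP->.
rewrite /= ge_min !inE => /or3P[/eqP->|/eqP->|yu].
- by rewrite IH ?orbT ?mem_head.
- by rewrite lexx.
- by rewrite IH ?orbT// inE yu orbT.
Qed.

Lemma minl_mem u x : minl u x \in x :: u.
Proof.
elim: u => [|z u IH]; first exact: mem_head.
rewrite /=; case: leP => _; first by rewrite !inE eqxx orbT.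
by move: IH; rewrite !inE => /orP[->//|->]; rewrite !orbT.
Qed.

(** The cone with apex [a], used for sorted [t] bounded below by [a]. If [t] already starts with
    [a], the cone is degenerate and is taken to be zero. *)
Definition consmin (a : T) (t : seq T) : chain T :=
  if t is b :: _ then (if (a < b)%O then [:: (1, a :: t)] else [::])
  else [:: (1, [:: a])].

Lemma consmin_d F a t : sorted <%O t -> (forall b, b \in t -> (a <= b)%O) ->
  ev (dc F) (consmin a t) = F t - dc (fun w => ev F (consmin a w)) t.
Proof.
have cm w : (forall b, b \in w -> (a < b)%O) -> ev F (consmin a w) = F (a :: w).
  case: w => [_|b w h]; first by rewrite /= ev1.
  by rewrite /= h ?mem_head// ev1.
case: t => [_ _|b t st ab].
  by rewrite /= ev1 dc_cons !dc_nil.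
have abt c : c \in t -> (a < c)%O.
  move=> ct; apply: le_lt_trans (ab b (mem_head _ _)) _.
  by move: st => /= /(order_path_min lt_trans)/allP; exact.
have [aeb|] := eqVneq a b; last first.
  move=> ne; have altb : (a < b)%O by rewrite lt_neqAle ne ab ?mem_head.
  rewrite /= altb ev1 [in LHS]dc_cons; congr (_ - _).
  apply: eq_dc_in => w wb _; rewrite cm// => c cw.
  have := mem_subseq wb cw; rewrite inE => /orP[/eqP->//|]; exact: abt.
(* Here [t] starts with [a]: its cone is zero, and so are the cones over all its faces except the
   one that omits [a], whose cone is [t] itself. *)
rewrite /= aeb ltxx ev_nil -aeb [in RHS]dc_cons cm//.
suff -> : dc (fun u => ev F (consmin a (a :: u))) t = 0 by rewrite subr0 subrr.
rewrite /dc ev_0// => p _; by rewrite /= ltxx ev_nil.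
Qed.

(* Sorting as a chain map: a list u is sent to the cone, from its minimum, over
   the sorted boundary of u; degenerate cones are dropped. *)
Fixpoint sortc (k : nat) (u : seq T) : chain T :=
  if k is k'.+1 then
    if u is x :: u' then
      bindc (consmin (minl u' x)) (bindc (sortc k') (bd1 u))
    else [::]
  else [:: (1, [::])].

Lemma sortc_mem k u p : size u = k -> p \in sortc k u ->
  [/\ sorted <%O p.2, {subset p.2 <= u} & size p.2 = k].
Proof.
elim: k u p => [|k IH] [|x u] //.
  by move=> p _; rewrite /= inE => /eqP->; split.
move=> p [sk] /=; rewrite -[_ :: map _ _]/(bd1 (x :: u)) => /mem_bind[q /mem_bind[r rb [q' q's qq']] [p' p'c ->]].
have sr : size r.2 = k by have := bd1_size rb; rewrite /= sk => -[].
have [so sb si] := IH _ _ sr q's.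
have sb' : {subset q.2 <= x :: u}.
  by move=> y; rewrite qq' => /sb/(bd1_mem rb).
move: p'c sb'; rewrite qq' /consmin; case: q'.2 so sb si => [|b t] so sb si.
  rewrite inE => /eqP-> _; split=> //= [y|]; last by rewrite -si.
  by rewrite inE => /eqP->; exact: minl_mem.
case: ifP => // ab; rewrite inE => /eqP-> sb'; split=> /=.
- by rewrite ab.
- by move=> y; rewrite inE => /orP[/eqP->|/sb'//]; exact: minl_mem.
- by rewrite -si.
Qed.

Lemma sortc_d k u F : size u = k.+1 ->
  ev (dc F) (sortc k.+1 u) = dc (fun w => ev F (sortc k w)) u.
Proof.
elim: k u F => [|k IH] [|x u] // F [sk].
  by rewrite /= ev_bind; case: u sk => //= _; rewrite ev_bind !ev1 /= ?ev1 !dc_cons !dc_nil ?ev1.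
rewrite [sortc _ _]/= -[_ :: map _ _]/(bd1 (x :: u)) ev_bind.
pose a := minl u x; set Z := bindc _ _.
have Zmem p : p \in Z -> sorted <%O p.2 /\ forall b, b \in p.2 -> (a <= b)%O.
  move=> /mem_bind[r rb [q qs ->]].
  have sr : size r.2 = k.+1 by have := bd1_size rb; rewrite /= sk => -[].
  have [so sb _] := sortc_mem sr qs.
  by split=> // b /sb/(bd1_mem rb)/minl_le.
rewrite (eq_ev_in (F' := fun t => F t - dc (fun w => ev F (consmin a w)) t)); last first.
  by move=> p /Zmem[so ab]; exact: consmin_d.
rewrite ev_subf !ev_bind.
(* The cone formula leaves the cone over the boundary of the sorted boundary; by induction this
   comes from a double boundary. *)
suff -> : ev (fun s => ev (dc (fun w => ev F (consmin a w))) (sortc k.+1 s)) (bd1 (x :: u)) = 0.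
  by rewrite subr0.
rewrite -[RHS](@dcK _ (fun w => ev (fun w => ev F (consmin a w)) (sortc k w)) (x :: u)).
apply: eq_ev_in => p pb; apply: IH.
by have := bd1_size pb; rewrite /= sk => -[].
Qed.

(** A list and its sorted form are carried by the same finite set of points, which is acyclic by
    coning: the homotopy is the cone from the first entry over [u - sort u - h(du)]. *)
Fixpoint sorth (k : nat) (u : seq T) : chain T :=
  if k is k'.+1 then
    if u is x :: u' then
      consc x ((1, u) :: oppc (sortc k u) ++ oppc (bindc (sorth k') (bd1 u)))
    else [::]
  else [::].

Lemma sorth_homotopy k u F : size u = k ->
  F u - ev F (sortc k u) = ev (dc F) (sorth k u) +
    dc (fun w => ev F (sorth k.-1 w)) u.
Proof.
elim: k u F => [|k IH] [|x u] // F => [_|[sk]].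
  by rewrite /= ev1 ev_nil dc_nil subrr addr0.
pose Y := (1, x :: u) :: oppc (sortc k.+1 (x :: u)) ++ oppc (bindc (sorth k) (bd1 (x :: u))).
have evY H : ev H Y = H (x :: u) - ev H (sortc k.+1 (x :: u)) - dc (fun w => ev H (sorth k w)) (x :: u).
  by rewrite ev_cons mul1r ev_cat !ev_opp ev_bind addrA.
rewrite -[sorth _ _]/(consc x Y) ev_consc.
rewrite [X in _ = X + _](eq_ev (F' := fun s => F s - dc (fun u => F (x :: u)) s)); last by move=> s; rewrite dc_cons.
rewrite ev_subf.
suff -> : ev (dc (fun u => F (x :: u))) Y = 0 by rewrite subr0 evY; ring.
rewrite evY sortc_d; last by rewrite /= sk.
set X := fun u0 => _.
have -> : dc (fun w => ev (dc X) (sorth k w)) (x :: u) = dc X (x :: u)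
   - dc (fun w => ev X (sortc k w)) (x :: u).
  rewrite -[RHS]subr0 -(@dcK _ (fun w => ev X (sorth k.-1 w)) (x :: u)).
  rewrite /dc -!ev_subf; apply: eq_ev_in => p pb.
  rewrite IH; last by have := bd1_size pb; rewrite /= sk => -[].
  by rewrite addrK.
ring.
Qed.

Lemma sorth_mem k u p : size u = k -> p \in sorth k u ->
  {subset p.2 <= u} /\ size p.2 = k.+1.
Proof.
elim: k u p => [|k IH] [|x u]// p [sk].
move=> /mapP[q qY ->] /=.
suff [sb ->] : {subset q.2 <= x :: u} /\ size q.2 = k.+1.
  by split=> // y; rewrite inE => /orP[/eqP->|/sb//]; exact: mem_head.
move: qY; rewrite inE => /orP[/eqP->|]; first by rewrite /= sk; split.
rewrite mem_cat => /orP[] /mem_scalec[r rs ->].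
  have sk' : size (x :: u) = k.+1 by rewrite /= sk.
  by have [_ sb ->] := sortc_mem sk' rs.
have [w wb [v vs ->]] := mem_bind rs.
have sw : size w.2 = k by have := bd1_size wb; rewrite /= sk => -[].
by have [sb ->] := IH _ _ sw vs; split=> // y /sb/(bd1_mem wb).
Qed.

End Sort.

End Chains.

(** * Local cocycles of points of Euclidean space *)

Section Labels.
Variables (G : comNzRingType) (n : nat).

(** The sign of the permutation spelled by [l] when every label occurs exactly once, and zero
    otherwise; the determinant yields both cases and the cocycle identity at once. *)
Definition psi (l : seq 'I_n.+1) : G :=
  if size l == n.+1 then
    \det (\matrix_(a < n.+1, b < n.+1) (nth ord0 l a == b)%:R)
  else 0.

Lemma nth_del (T : Type) (x0 : T) (l : seq T) i a :
  nth x0 (take i l ++ drop i.+1 l) a = nth x0 l (bump i a).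
Proof.
rewrite nth_cat size_take /bump; have [il|li] := ltnP i (size l).
  have [ai|ia] := ltnP a i; first by rewrite nth_take.
  by rewrite nth_drop add1n addSn subnKC.
rewrite [drop _ _]drop_oversize ?(leq_trans li)// nth_nil take_oversize//.
case: ltnP => al; first by rewrite leqNgt (leq_trans al li).
by rewrite nth_default// (leq_trans al)// leq_addl.
Qed.

Lemma psi_dc l : dc psi l = 0.
Proof.
have [sl|sl] := eqVneq (size l) n.+2; last first.
  rewrite /dc ev_0// => p pb; rewrite /psi ifF//; apply/negbTE.
  by apply: contra sl => /eqP sp; apply/eqP; rewrite (bd1_size pb) sp.
(* Adjoin to the indicator columns of the labels a column of ones, which is their sum. The terms of
   the coboundary are its cofactors, so their sum is a sum of expansions by alien cofactors, each of
   them zero. *)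
pose N : 'M[G]_n.+2 := \matrix_(a, b)
  if unlift ord0 b is Some b' then (nth ord0 l a == b')%:R else 1.
rewrite dcE sl.
have cofE (i : 'I_n.+2) :
    (-1) ^+ i * psi (take i l ++ drop i.+1 l) = cofactor N i ord0.
  rewrite /cofactor addn0; congr (_ * _); rewrite /psi.
  rewrite size_cat size_take size_drop sl ltn_ord subSS subnKC ?eqxx; last first.
    by rewrite -ltnS ltn_ord.
  congr (\det _); apply/matrixP => a b; rewrite !mxE liftK nth_del.
  by [].
under eq_bigr do rewrite cofE.
transitivity (\sum_(b < n.+1) \sum_i N i (lift ord0 b) * cofactor N i ord0).
  rewrite exchange_big/=; apply: eq_bigr => i _.
  rewrite -mulr_suml -[LHS]mul1r; congr (_ * _).
  have li : (nth ord0 l i) \in 'I_n.+1 by [].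
  rewrite (bigD1 (nth ord0 l i))//= mxE liftK eqxx big1 ?addr0// => b bi.
  by rewrite mxE liftK eq_sym (negPf bi).
rewrite big1// => b _; have := mul_adj_mx N => /matrixP/(_ ord0 (lift ord0 b)).
rewrite !mxE (negPf (neq_lift _ _)) mulr0n => adj0; rewrite -[RHS]adj0.
by apply: eq_bigr => i _; rewrite [in RHS]mxE mulrC.
Qed.

Lemma psi_missing l b : b \notin l -> psi l = 0.
Proof.
move=> bl; rewrite /psi; case: eqP => // sl.
rewrite (expand_det_col _ b) big1// => i _; rewrite mxE.
case: eqP => [e|_]; last by rewrite mul0r.
by case/negP: bl; rewrite -e mem_nth// sl.
Qed.

Lemma psi_enum : psi (enum 'I_n.+1) = 1.
Proof.
rewrite /psi size_enum_ord eqxx -[RHS](det1 _ n.+1); congr (\det _).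
by apply/matrixP => a b; rewrite !mxE nth_ord_enum.
Qed.

Lemma psi_perm (s : 'S_n.+1) l : psi (map s l) = (-1) ^+ s * psi l.
Proof.
rewrite /psi size_map; case: eqP => sl; last by rewrite mulr0.
set A := \matrix_(a, b) (nth ord0 l a == b)%:R.
rewrite -(det_perm _ s) mulrC -det_mulmx -[X in perm_mx X]invgK -col_permE.
congr (\det _); apply/matrixP => a b; rewrite !mxE (nth_map ord0) ?sl//.
by rewrite (canF_eq (permK s)).
Qed.

Lemma psi_homotopy (T : eqType) (f g : T -> 'I_n.+1) s :
  psi (map g s) - psi (map f s) = dc (fun t => ev psi (prism1 G f g t)) s.
Proof.
by rewrite prism_homotopy [X in _ + X]ev_0 ?addr0// => p _; exact: psi_dc.
Qed.

End Labels.

Section RealLabels.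
Variables (R : realType) (G : comNzRingType) (n : nat).
Local Notation lab := 'I_n.+1.
Implicit Types (x y : 'rV[R]_n) (s : {perm 'I_n}).

(** A Sperner condition: a label [k] certifies that coordinate [k] of the point is below that of
    [y], the last label that no coordinate is. A list showing all labels thus surrounds [y]. *)
Definition adapted y (L : 'rV[R]_n -> lab) : Prop := forall x,
  (forall k : 'I_n, L x = lift ord_max k -> x 0 k < y 0 k) /\
  (L x = ord_max -> forall k, y 0 k <= x 0 k).

(** The position, in the order [s], of the first coordinate of [x] below that of [y]; [find] returns
    [n], the last label, if there is none. The various orders [s] distinguish the simplices of one
    cube. *)
Definition ellp s y x : lab :=
  inord (find (fun k => x 0 (s k) < y 0 (s k)) (enum 'I_n)).

Lemma val_ellp s y x :
  ellp s y x = find (fun k => x 0 (s k) < y 0 (s k)) (enum 'I_n) :> nat.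
Proof.
rewrite inordK// ltnS -[X in (_ <= X)%N](size_enum_ord n); exact: find_size.
Qed.

Lemma ellp_before s y x (k : 'I_n) : (k < ellp s y x)%N -> y 0 (s k) <= x 0 (s k).
Proof.
rewrite val_ellp => /(before_find k).
by rewrite nth_ord_enum => /negbT; rewrite -leNgt.
Qed.

Lemma ellp_at s y x (k : 'I_n) : ellp s y x = k :> nat -> x 0 (s k) < y 0 (s k).
Proof.
rewrite val_ellp => e; have hk : has (fun k => x 0 (s k) < y 0 (s k)) (enum 'I_n).
  by rewrite has_find e size_enum_ord ltn_ord.
by have := nth_find k hk; rewrite e nth_ord_enum.
Qed.

Lemma ellpP s y x (k : nat) : (k <= n)%N ->
  (forall j : 'I_n, (j < k)%N -> y 0 (s j) <= x 0 (s j)) ->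
  (forall j : 'I_n, j = k :> nat -> x 0 (s j) < y 0 (s j)) ->
  ellp s y x = k :> nat.
Proof.
move=> kn hlt hk; apply/eqP; rewrite eqn_leq; apply/andP; split; rewrite leqNgt; apply/negP => h.
- have kn' : (k < n)%N by apply: leq_trans h _; rewrite -ltnS ltn_ord.
  have := @ellp_before s y x (Ordinal kn') h.
  by rewrite leNgt hk.
- have ln : (ellp s y x < n)%N by exact: leq_trans h kn.
  have := @ellp_at s y x (Ordinal ln) erefl.
  by rewrite ltNge hlt.
Qed.

Lemma ellp_mono s y x x' : (forall k, x 0 k <= x' 0 k) ->
  (ellp s y x <= ellp s y x')%N.
Proof.
move=> xx'; rewrite leqNgt; apply/negP => h.
have ln : (ellp s y x' < n)%N by apply: leq_trans h _; rewrite -ltnS ltn_ord.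
have := @ellp_at s y x' (Ordinal ln) erefl.
by rewrite ltNge (le_trans (ellp_before (k := Ordinal ln) h)).
Qed.

(** [ellp s] records positions in the order [s]; applying [s], extended by fixing the last label,
    turns positions into coordinates. *)
Lemma adapted_ellp s y :
  adapted y (lift_perm ord_max ord_max s \o ellp s y).
Proof.
move=> x /=; split=> [k|e k].
  have [j ej|->] := unliftP ord_max (ellp s y x); last first.
    by move=> /eqP; rewrite lift_perm_id (negPf (neq_lift _ _)).
  rewrite ej lift_perm_lift => /lift_inj <-.
  by apply: ellp_at; rewrite ej /= /bump leqNgt ltn_ord.
have el : ellp s y x = ord_max.
  by apply: (@perm_inj _ (lift_perm ord_max ord_max s)); rewrite e lift_perm_id.
rewrite -(permKV s k); apply: ellp_before.
by rewrite el /= ltn_ord.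
Qed.

Definition lbl y : 'rV[R]_n -> lab := ellp 1%g y.

Lemma adapted_lbl y : adapted y (lbl y).
Proof.
have := adapted_ellp 1%g y; congr adapted; apply/funext => x /=.
suff -> : lift_perm ord_max ord_max 1%g = 1%g :> {perm 'I_n.+1} by rewrite perm1.
by rewrite lift_perm1.
Qed.

(* Label each point by its first coordinate smaller than that of y. As in Sperner's
   lemma, the signed count of lists on which the labels form a permutation is a
   cocycle, dual to the local orientation at y. *)
Definition theta y (l : seq 'rV[R]_n) : G := psi G (map (lbl y) l).

Lemma theta_dc y l : dc (theta y) l = 0.
Proof. by rewrite /theta -(dc_map (lbl y)) psi_dc. Qed.

Lemma theta_size y l : size l != n.+1 -> theta y l = 0.
Proof. by move=> sl; rewrite /theta /psi size_map (negPf sl). Qed.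

Lemma adapted_psi_neq0 y L l : adapted y L -> psi G (map L l) != 0 ->
  (exists2 x, x \in l & forall k, y 0 k <= x 0 k) /\
  forall k, exists2 x, x \in l & x 0 k < y 0 k.
Proof.
move=> aL p0.
have all b : b \in map L l.
  by apply/negPn/negP => /(psi_missing G) e; rewrite e eqxx in p0.
split=> [|k].
  have /mapP[x xl e] := all ord_max; exists x => //.
  by have [_] := aL x; apply.
have /mapP[x xl e] := all (lift ord_max k); exists x => //.
by have [h _] := aL x; apply: h.
Qed.

Lemma adapted_prism_neq0 y y' L L' l p : adapted y L -> adapted y' L' ->
  p \in prism1 G L L' l -> psi G p.2 != 0 ->
  (exists2 x, x \in l & forall k, Num.min (y 0 k) (y' 0 k) <= x 0 k) /\
  forall k, exists2 x, x \in l & x 0 k < Num.max (y 0 k) (y' 0 k).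
Proof.
move=> aL aL' pp p0.
have all b : b \in p.2.
  by apply/negPn/negP => /(psi_missing G) e; rewrite e eqxx in p0.
split=> [|k].
  have [x xl e] := prism1_mem pp (all ord_max); exists x => // k.
  rewrite ge_min; case: e => e.
    by have [_ /(_ (esym e) k) ->] := aL x.
  by have [_ /(_ (esym e) k) ->] := aL' x; rewrite orbT.
have [x xl e] := prism1_mem pp (all (lift ord_max k)); exists x => //.
rewrite lt_max; case: e => e.
  by have [/(_ _ (esym e)) ->] := aL x.
by have [/(_ _ (esym e)) ->] := aL' x; rewrite orbT.
Qed.

End RealLabels.

(** * The Freudenthal triangulation *)

Section Kuhn.
Variables (R : realType) (G : comNzRingType) (n : nat).

(** The lexicographic order is total, as sorting requires, and on adjacent vertices it agrees with
    the coordinatewise order. *)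
Definition grid : Type := n.-tuplelexi int.
HB.instance Definition _ := Order.Total.on grid.

Definition cd (v : grid) (i : 'I_n) : int := tnth v i.
Definition mkgrid (f : 'I_n -> int) : grid := [tuple f i | i < n].
Lemma cd_mk f i : cd (mkgrid f) i = f i.
Proof. exact: tnth_mktuple. Qed.
Lemma cd_inj (u v : grid) : cd u =1 cd v -> u = v.
Proof. by move=> e; apply: eq_from_tnth => i; exact: e. Qed.
Lemma grid_ltP (u v : grid) : (u < v)%O -> exists i, cd u i < cd v i.
Proof. by move=> /ltxi_tuplePlt[i _ h]; exists i. Qed.

Implicit Types (u v w : grid) (s : {perm 'I_n}) (l : seq grid).

(** Adjacency in the Freudenthal triangulation: up to sign, the difference of the two vertices is a
    0-1 vector. Pairwise adjacent vertices span a simplex. *)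
Definition cube_le u w : Prop := forall i, cd u i <= cd w i <= cd u i + 1.
Definition cube_adj u w : Prop := cube_le u w \/ cube_le w u.
Definition padj l : Prop := forall u w, u \in l -> w \in l -> cube_adj u w.

Lemma cube_adj_lt u w : cube_adj u w -> (u < w)%O -> cube_le u w.
Proof.
move=> [//|wu] /grid_ltP[k uk].
by have /andP[wk _] := wu k; rewrite ltNge wk in uk.
Qed.

Lemma padj_norm l u w i : padj l -> u \in l -> w \in l ->
  `|(cd u i)%:~R - (cd w i)%:~R| <= 1 :> R.
Proof.
move=> al ul wl; rewrite -intrB -intr_norm -[X in _ <= X]/(1%:~R) ler_int.
by case: (al _ _ ul wl) => /(_ i); clear; lia.
Qed.

(** The monotone path from [v] to the opposite corner of its cube that raises the coordinates [s 0],
    [s 1], ... in this order. *)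
Definition kuhn_vertex v s (k : nat) : grid :=
  mkgrid (fun i => cd v i + ((s^-1%g i < k)%N : nat)%:Z).
Definition kuhn v s : seq grid := [seq kuhn_vertex v s k | k <- iota 0 n.+1].

Lemma size_kuhn v s : size (kuhn v s) = n.+1.
Proof. by rewrite size_map size_iota. Qed.

(** Each of the [n] steps of the list raises some coordinate, and the total increment is a 0-1
    vector, so distinct steps raise distinct coordinates. The order in which they are raised is the
    permutation. *)
Lemma sorted_padj_kuhn l : sorted <%O l -> padj l -> size l = n.+1 ->
  exists v s, l = kuhn v s.
Proof.
move=> sl al zl; have [x0 [l' el]] : exists x l', l = x :: l' by case: l zl {sl al} => // x l' _; exists x, l'.
pose a k := nth x0 l k.
have alt k k' : (k < k' < n.+1)%N -> (a k < a k')%O.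
  move=> /andP[kk' k'n].
  have /= h := @sorted_ltn_nth _ <%O lt_trans x0 l sl k k'.
  by apply: h; rewrite ?inE ?zl// (ltn_trans kk').
have amem k : (k < n.+1)%N -> a k \in l by move=> kn; rewrite mem_nth ?zl.
have acl k k' : (k <= k' < n.+1)%N -> cube_le (a k) (a k').
  rewrite leq_eqVlt => /andP[/orP[/eqP->|kk'] k'n].
    by move=> i; rewrite lexx lerDl.
  apply: cube_adj_lt; last by rewrite alt ?kk'.
  by apply: al; apply: amem => //; exact: ltn_trans k'n.
have stp (k : 'I_n) : exists i, cd (a k) i < cd (a k.+1) i.
  have ak : (a k < a k.+1)%O by rewrite alt// ltnSn ltnS ltn_ord.
  exact: grid_ltP ak.
have [f fP] := choice stp.
have fle (k : 'I_n) k' : (k < k' < n.+1)%N -> cd (a 0%N) (f k) + 1 <= cd (a k') (f k).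
  move=> kk'; have /(_ (f k))/andP[h1 _] := @acl k.+1 k' kk'.
  have /(_ (f k))/andP[h2 _] := @acl 0%N k (leq_trans (ltn_ord k) (leqnSn _)).
  have := fP k; lia.
have fge (k : 'I_n) k' : (k' <= k)%N -> cd (a k') (f k) <= cd (a 0%N) (f k).
  move=> kk'; have kn : (k' <= k < n.+1)%N by rewrite kk' (leq_trans (ltn_ord k)).
  have /(_ (f k))/andP[h1 _] := acl _ _ kn.
  have /(_ (f k))/andP[_ h2] := @acl 0%N k.+1 (ltn_ord k).
  have := fP k; lia.
have finj : injective f.
  move=> k k' e; apply/eqP/negPn/negP => ne.
  wlog lt : k k' e ne / (k < k')%N.
    move=> wl; have : (k != k' :> nat) by [].
    by rewrite neq_ltn => /orP[|] lt; [apply: (wl k k') | apply: (wl k' k); rewrite // eq_sym].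
  have h1 := @fle k k'; rewrite lt (leq_trans (ltn_ord _) (leqnSn _)) in h1.
  have := @fge k' k' (leqnn _); have := h1 isT; rewrite e; lia.
exists (a 0%N), (perm finj); apply: (@eq_from_nth _ x0); first by rewrite size_kuhn.
rewrite zl => k kn; rewrite (nth_map 0%N) ?size_iota// nth_iota// add0n.
apply: cd_inj => i; rewrite cd_mk -/(a k).
pose j := ((perm finj)^-1)%g i.
have ij : i = f j by rewrite /j -(permE finj) permKV.
rewrite -/j; case: ltnP => jk.
  have := @fle j k; rewrite jk kn -ij => /(_ isT).
  have /(_ i)/andP[_] := @acl 0%N k kn; lia.
have := @fge j k jk; rewrite -ij.
have /(_ i)/andP[] := @acl 0%N k kn; lia.
Qed.

Variables (c : 'rV[R]_n) (h : R).

Definition gridpt v : 'rV[R]_n := \row_i (c 0 i + h * (cd v i)%:~R).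
Definition cubemid v : 'rV[R]_n := \row_i (c 0 i + h * ((cd v i)%:~R + 2^-1)).

Hypothesis h0 : 0 < h.

Lemma cubemid_le v u i : (cubemid v 0 i <= gridpt u 0 i) = (cd v i < cd u i).
Proof.
rewrite !mxE lerD2l ler_pM2l//.
have [vu|uv] := ltP (cd v i) (cd u i).
  have : (cd v i + 1)%:~R <= (cd u i)%:~R :> R by rewrite ler_int; lia.
  rewrite intrD => vu'; lra.
have : (cd u i)%:~R <= (cd v i)%:~R :> R by rewrite ler_int.
move=> uv'; apply/negbTE; rewrite -ltNge; lra.
Qed.

Lemma map_lab_kuhn v s :
  map (ellp s (cubemid v)) (map gridpt (kuhn v s)) = enum 'I_n.+1.
Proof.
apply: (inj_map val_inj); rewrite val_enum_ord -!map_comp -[RHS]map_id.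
apply/eq_in_map => k; rewrite mem_iota add0n => /andP[_ kn].
apply: ellpP => // j jk /=.
  by rewrite cubemid_le cd_mk permK jk; lia.
by rewrite ltNge cubemid_le cd_mk permK jk ltnn; lia.
Qed.

(** On sorted simplices this label cocycle is a coordinate functional: it reads off the coefficient
    of [kuhn v s] in any combination of them. *)
Lemma psi_kuhn v s l : sorted <%O l -> padj l ->
  psi G (map (ellp s (cubemid v)) (map gridpt l)) = (l == kuhn v s)%:R.
Proof.
move=> sl al; have [->|ne] := eqVneq l (kuhn v s).
  by rewrite map_lab_kuhn psi_enum.
apply/eqP/negPn/negP => p0; case/eqP: ne.
set L := map _ (map _ l) in p0.
have sz : size L = n.+1.
  by apply/eqP/negPn/negP => ne; move: p0; rewrite /psi (negPf ne) eqxx.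
have szl : size l = n.+1 by rewrite -sz !size_map.
have all b : b \in L by apply/negPn/negP => /(psi_missing G) e; rewrite e eqxx in p0.
have uL : uniq L.
  apply: (@leq_size_uniq _ (enum 'I_n.+1)); first exact: enum_uniq.
    by move=> b _; exact: all.
  by rewrite sz size_enum_ord.
have cl u w : u \in l -> w \in l -> (u < w)%O -> cube_le u w.
  by move=> ul wl; apply: cube_adj_lt; exact: al.
have gm u w : u \in l -> w \in l -> (u < w)%O ->
    (ellp s (cubemid v) (gridpt u) <= ellp s (cubemid v) (gridpt w))%N.
  move=> ul wl uw; apply: ellp_mono => i.
  rewrite !mxE lerD2l ler_pM2l// ler_int.
  by have /andP[] := cl _ _ ul wl uw i.
(* [ellp] is monotone along the sorted list and all labels occur, so the labels are 0, ..., n in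
   order. *)
have LE : map val L = iota 0 n.+1.
  apply: (sorted_eq leq_trans anti_leq); last 2 first.
  - exact: iota_sorted.
  - rewrite -val_enum_ord; apply: perm_map; apply: uniq_perm => //.
      exact: enum_uniq.
    by move=> b; rewrite all mem_enum.
  rewrite /L -!map_comp; move: sl; case: l {al L p0 sz szl all uL cl} gm => //= x l gm.
  elim: l x gm => //= y l IH x gm /andP[xy yl]; apply/andP; split.
    by apply: gm => //; rewrite ?inE ?eqxx ?orbT.
  by apply: IH => // u w ul wl; apply: gm; rewrite inE ?ul ?wl orbT.
have [x0 el] : exists x, x \in l by case: l szl {sl al L p0 sz all uL cl gm LE} => // x l _; exists x; exact: mem_head.
have labE k : (k < n.+1)%N -> ellp s (cubemid v) (gridpt (nth x0 l k)) = k :> nat.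
  move=> kn; have := congr1 (fun z => nth 0%N z k) LE.
  rewrite nth_iota// add0n (nth_map ord0) ?sz// /L (nth_map (gridpt x0)) ?size_map ?szl//.
  by rewrite (nth_map x0) ?szl.
have acl k k' : (k <= k' < n.+1)%N -> cube_le (nth x0 l k) (nth x0 l k').
  rewrite leq_eqVlt => /andP[/orP[/eqP->|kk'] k'n].
    by move=> i; rewrite lexx lerDl.
  have kn := ltn_trans kk' k'n.
  apply: cl; rewrite ?mem_nth ?szl//.
  by apply: (sorted_ltn_nth lt_trans x0 sl); rewrite ?inE ?szl.
apply: (@eq_from_nth _ x0); first by rewrite size_kuhn.
rewrite szl => k kn; rewrite (nth_map 0%N) ?size_iota// nth_iota// add0n.
apply: cd_inj => i; rewrite cd_mk.
(* Vertex [j] has label [j] and vertex [j.+1] has label [j.+1], so coordinate [s j] crosses the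
   middle of the cube exactly between them. *)
pose j := (s^-1)%g i; have ij : i = s j by rewrite /j permKV.
have hj : cd (nth x0 l j) i <= cd v i.
  have := @ellp_at _ _ s (cubemid v) (gridpt (nth x0 l j)) j (labE _ (leq_trans (ltn_ord j) (leqnSn _))).
  by rewrite -ij ltNge cubemid_le -leNgt.
have hj1 : cd v i < cd (nth x0 l j.+1) i.
  have := @ellp_before _ _ s (cubemid v) (gridpt (nth x0 l j.+1)) j.
  by rewrite (labE j.+1 (ltn_ord j)) -ij cubemid_le; apply.
have /(_ i)/andP[_ h1] := @acl 0%N n (ltnSn n).
have /(_ i)/andP[h2 _] := @acl 0%N j (leq_trans (ltn_ord j) (leqnSn _)).
have /(_ i)/andP[h3 _] : cube_le (nth x0 l j.+1) (nth x0 l n).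
  by apply: acl; rewrite ltn_ord ltnSn.
rewrite -/j; case: ltnP => jk.
  have /(_ i)/andP[h4 _] := @acl j.+1 k (introT andP (conj jk kn)).
  have /(_ i)/andP[h5 _] : cube_le (nth x0 l k) (nth x0 l n).
    by apply: acl; rewrite -ltnS kn ltnSn.
  lia.
have /(_ i)/andP[h4 _] : cube_le (nth x0 l k) (nth x0 l j).
  by apply: acl; rewrite jk (leq_trans (ltn_ord j) (leqnSn _)).
have /(_ i)/andP[h5 _] := @acl 0%N k kn.
lia.
Qed.

(* The Freudenthal triangulation has a vertex near x whose open star contains x
   with barycentric coordinate at least 1 / (n + 1): by the pigeonhole principle
   one of n + 1 equal subintervals of [0, 1[ contains no fractional part of the
   coordinates, and rounding at its right end gives such a vertex. *)
Lemma round_exists (x : 'I_n -> R) : exists v : grid, forall i j,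
  x i - (cd v i)%:~R - (x j - (cd v j)%:~R) <= 1 - n.+1%:R^-1 /\
  `|x i - (cd v i)%:~R| <= 1 - n.+1%:R^-1.
Proof.
pose q : R := n.+1%:R^-1; have q0 : 0 < q by rewrite invr_gt0 ltr0n.
have nq : n.+1%:R * q = 1 by rewrite /q divff// pnatr_eq0.
pose fr i := x i - (Num.floor (x i))%:~R.
have fr0 i : 0 <= fr i by rewrite subr_ge0 floor_le_tmp.
have fr1 i : fr i < 1 by rewrite ltrBlDr addrC -{2}[1]/(1%:~R) -intrD floorD1_gt.
have [m mP] : exists m : nat, (m <= n)%N /\ forall i, fr i < m%:R * q \/ m.+1%:R * q <= fr i.
  pose f i : 'I_n.+1 := inord (Num.truncn (n.+1%:R * fr i)).
  have : exists m : 'I_n.+1, m \notin codom f.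
    apply/existsP; rewrite -negb_forall; apply/negP => /forallP al.
    have /subset_leq_card : 'I_n.+1 \subset codom f by apply/fintype.subsetP => b _; exact: al.
    rewrite card_ord => h'; have := leq_trans h' (card_size (codom f)).
    by rewrite size_codom card_ord ltnn.
  move=> [m mf]; exists m; split; first by rewrite -ltnS.
  move=> i; have [|ge] := ltP (fr i) (m%:R * q); [by left | right].
  rewrite leNgt; apply/negP => lt; case/negP: mf; apply/codomP; exists i.
  apply/val_inj; rewrite /f /= inordK.
    apply/esym/truncn_def; have n0 : 0 < n.+1%:R :> R by rewrite ltr0n.
    apply/andP; split.
      have := ler_wpM2l (ltW n0) ge; rewrite mulrCA nq; lra.
    have := ltr_pM2l n0 (fr i) (m.+1%:R * q); rewrite lt mulrCA nq mulr1 => ->//.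
  have n0 : 0 < n.+1%:R :> R by rewrite ltr0n.
  rewrite -(@ltr_nat R); apply: (@le_lt_trans _ _ (n.+1%:R * fr i)).
    by rewrite truncn_le mulr_ge0// ltW.
  by rewrite gtr_pMr.
have [mn mf] := mP.
exists (mkgrid (fun i => Num.floor (x i) + (nat_of_bool (m.+1%:R * q <= fr i)%R)%:Z)) => i j.
rewrite !cd_mk !intrD -/q.
have mq : m.+1%:R * q = m%:R * q + q by rewrite -natr1 mulrDl mul1r.
have mq1 : m%:R * q <= 1 - q.
  have mn' : m%:R <= n%:R :> R by rewrite ler_nat.
  have := ler_wpM2r (ltW q0) mn'; move: nq; rewrite -natr1 mulrDl mul1r; lra.
have mq0 : 0 <= m%:R * q by rewrite mulr_ge0// ltW.
have aux k : let a := x k - ((Num.floor (x k))%:~R + ((nat_of_bool (m.+1%:R * q <= fr k)%R)%:Z)%:~R) in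
    m%:R * q + q - 1 <= a <= m%:R * q.
  move=> a; have -> : a = fr k - (nat_of_bool (m.+1%:R * q <= fr k)%R)%:R.
    by rewrite /a /fr opprD addrA.
  have [f0 f1] := (fr0 k, fr1 k).
  have [] := boolP (m.+1%:R * q <= fr k) => /=; first by move=> h1; apply/andP; split; lra.
  by rewrite -ltNge => h1; case: (mf k) => h2; apply/andP; split; lra.
have /andP[i1 i2] := aux i; have /andP[j1 j2] := aux j.
by split; [lra | rewrite ler_norml; apply/andP; split; lra].
Qed.

(** Rounding is not continuous, but the slack [1 / n.+1] in its bounds makes it send close points to
    adjacent vertices. *)
Lemma round_map_exists : exists Phi : 'rV[R]_n -> grid,
  (forall (x : 'rV[R]_n) i, `|x 0 i - gridpt (Phi x) 0 i| < h) /\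
  (forall x x' : 'rV[R]_n, (forall i, `|x 0 i - x' 0 i| < h / n.+1%:R / 2) ->
    cube_adj (Phi x) (Phi x')).
Proof.
pose q : R := n.+1%:R^-1; have q0 : 0 < q by rewrite invr_gt0 ltr0n.
have [Phi PhiP] := choice (fun x : 'rV[R]_n => round_exists (fun i => (x 0 i - c 0 i) / h)).
have hh : h != 0 by rewrite gt_eqF.
exists Phi; split=> [x i|x x' xx'].
  have [_] := PhiP x i i; rewrite -/q => h1.
  have -> : x 0 i - gridpt (Phi x) 0 i = h * ((x 0 i - c 0 i) / h - (cd (Phi x) i)%:~R).
    by rewrite mxE; field.
  rewrite normrM gtr0_norm// gtr_pMr//; lra.
pose d i : int := cd (Phi x') i - cd (Phi x) i.
have e i : `|(x' 0 i - c 0 i) / h - (x 0 i - c 0 i) / h| < q / 2.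
  have -> : (x' 0 i - c 0 i) / h - (x 0 i - c 0 i) / h = (x' 0 i - x 0 i) / h by field.
  rewrite normrM distrC normfV (gtr0_norm h0) ltr_pdivrMr// mulrC.
  by have := xx' i; rewrite -/q mulrA.
have dE i : (d i)%:~R = ((x' 0 i - c 0 i) / h - (x 0 i - c 0 i) / h) +
   ((x 0 i - c 0 i) / h - (cd (Phi x) i)%:~R) - ((x' 0 i - c 0 i) / h - (cd (Phi x') i)%:~R) :> R.
  by rewrite /d intrB; ring.
have d2 i : -1 <= d i <= 1.
  have : -2 < d i < 2.
    rewrite -!(ltr_int R) dE.
    have := e i; have [_] := PhiP x i i; have [_] := PhiP x' i i.
    rewrite -/q !ler_norml ltr_norml => /andP[? ?] /andP[? ?] /andP[? ?].
    rewrite -[(-2)%:~R]/(-2) -[2%:~R]/2; apply/andP; split; lra.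
  lia.
(* Opposite moves of two coordinates would change their difference by 2, while each of the two
   roundings contributes at most [1 - q] and each of the two displacements less than [q / 2]. *)
have dd i j : ~ (d i = 1 /\ d j = -1).
  move=> [di dj].
  have : (d i)%:~R - (d j)%:~R = 2 :> R by rewrite di dj /=; ring.
  rewrite !dE; have [h1 _] := PhiP x i j; have [h2 _] := PhiP x' j i.
  have := e i; have := e j; rewrite -/q in h1 h2 *; rewrite !ltr_norml => /andP[? ?] /andP[? ?]; lra.
have [[i di]|nd] := pselect (exists i, d i = 1).
  left=> j; have := d2 j; have := dd i j; rewrite /d in di *; lia.
right=> j; have := d2 j; have : d j <> 1 by move=> dj; apply: nd; exists j.
rewrite /d; lia.
Qed.

End Kuhn.

(** * Fine lists in a metric space *)

Section Fine.
Variables (R : realType) (X : pseudoMetricType R).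

Definition finel (e : R) (s : seq X) : Prop :=
  forall x y, x \in s -> y \in s -> ball x e y.

Lemma finel_sub e s t : {subset t <= s} -> finel e s -> finel e t.
Proof. by move=> ts fs x y /ts xs /ts ys; exact: fs. Qed.

Lemma finel_le e e' s : e <= e' -> finel e s -> finel e' s.
Proof. by move=> ee fs x y xs ys; apply: le_ball (fs _ _ xs ys). Qed.

Lemma finel_bd1 (G : comNzRingType) e s p : p \in bd1 G s -> finel e s -> finel e p.2.
Proof. by move=> pb; apply: finel_sub => x; exact: bd1_mem. Qed.

(* The boundary of z is carried by the complement of A, stated dually. *)
Definition bd_off (G : comNzRingType) (e : R) (A : set X) (z : chain G X) : Prop :=
  forall F : seq X -> G,
    (forall s, finel e s -> (forall x, x \in s -> ~ A x) -> F s = 0) ->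
  ev (dc F) z = 0.

End Fine.

(** * Simplicial approximation in Euclidean space *)

Section ApproxRn.
Variables (R : realType) (G : comNzRingType) (n : nat).
Local Notation V := 'rV[R]_n.
Implicit Types (x y : V) (s : seq V).

Lemma rV_ballE x (e : R) y : ball x e y -> 0 < e /\ forall i, `|x 0 i - y 0 i| < e.
Proof. by move=> [e0 h]; split=> // i; have := h 0 i. Qed.

Lemma rV_ballI x (e : R) y : 0 < e -> (forall i, `|x 0 i - y 0 i| < e) -> ball x e y.
Proof. by move=> e0 h; split=> // i j; rewrite (ord1 i); exact: h. Qed.

Lemma adapted_prism_near y y' L L' e s p : adapted y L -> adapted y' L' ->
  finel e s -> p \in prism1 G L L' s -> psi G p.2 != 0 ->
  forall x, x \in s -> forall i,
    Num.min (y 0 i) (y' 0 i) - e < x 0 i < Num.max (y 0 i) (y' 0 i) + e.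
Proof.
move=> aL aL' fs pp p0 x xs i.
have [[a as_ ha] hb] := adapted_prism_neq0 aL aL' pp p0.
have [b bs hb'] := hb i; have := ha i => {}ha.
have [_ /(_ i)] := rV_ballE (fs _ _ xs as_); have [_ /(_ i)] := rV_ballE (fs _ _ xs bs).
rewrite !ltr_norml => /andP[? ?] /andP[? ?].
by move: ha hb'; set A := Num.min _ _; set B := Num.max _ _ => ? ?; apply/andP; split; lra.
Qed.

Lemma adapted_near y L e s : adapted y L -> finel e s -> psi G (map L s) != 0 ->
  forall x, x \in s -> ball y e x.
Proof.
move=> aL fs p0 x xs; have [e0 _] := rV_ballE (fs _ _ xs xs).
apply: rV_ballI => // i.
have [[a as_ ha] hb] := adapted_psi_neq0 aL p0.
have [b bs hb'] := hb i; have := ha i => {}ha.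
have [_ /(_ i)] := rV_ballE (fs _ _ xs as_); have [_ /(_ i)] := rV_ballE (fs _ _ xs bs).
by rewrite !ltr_norml => /andP[? ?] /andP[? ?]; apply/andP; split; lra.
Qed.

Lemma psi_ellp (t : {perm 'I_n}) y s : psi G (map (ellp t y) s) =
  (-1) ^+ (lift_perm ord_max ord_max t : {perm 'I_n.+1}) *
  psi G (map (lift_perm ord_max ord_max t \o ellp t y) s).
Proof. by rewrite map_comp psi_perm mulrA -signr_addb addbb mul1r. Qed.

Lemma ellp_near t y e s : finel e s -> psi G (map (ellp t y) s) != 0 ->
  forall x, x \in s -> ball y e x.
Proof.
move=> fs p0; apply: (adapted_near (adapted_ellp t y) fs).
by apply: contraNneq p0 => p0; rewrite psi_ellp p0 mulr0.
Qed.

Lemma theta_near y e s : finel e s -> theta G y s != 0 ->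
  forall x, x \in s -> ball y e x.
Proof. exact: (adapted_near (adapted_lbl y)). Qed.

Lemma ellp_dc t y s : dc (fun s => psi G (map (ellp t y) s)) s = 0.
Proof. by rewrite -(dc_map (ellp t y)) psi_dc. Qed.

Section Approx.
Variables (c : V) (h : R) (Phi : V -> grid n).
Hypothesis h0 : 0 < h.
Hypothesis Phi_near : forall x i, `|x 0 i - gridpt c h (Phi x) 0 i| < h.
Hypothesis Phi_adj : forall x x',
  (forall i, `|x 0 i - x' 0 i| < h / n.+1%:R / 2) -> cube_adj (Phi x) (Phi x').
Let e1 := h / n.+1%:R / 2.
Local Notation gam := (gridpt c h).

(** Simplicial approximation of a list: round its points to the grid, sort the result into ordered
    simplices, and map these back to space. The homotopy [approxh] to the identity adds a prism for
    the rounding and the homotopy of the sorting. *)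
Definition approx s : chain G V := mapc gam (sortc G (size s) (map Phi s)).
Definition approxh s : chain G V :=
  prism1 G (gam \o Phi) id s ++ mapc gam (sorth G (size s) (map Phi s)).

Lemma approx_homotopy (F : seq V -> G) s :
  F s - ev F (approx s) = ev (dc F) (approxh s) + dc (fun t => ev F (approxh t)) s.
Proof.
have P := prism_homotopy (gam \o Phi) id F s; rewrite map_id in P.
have Q := @sorth_homotopy G _ _ (size s) (map Phi s) (fun u => F (map gam u)) (size_map _ _).
rewrite /approx /approxh ev_mapc ev_cat ev_mapc.
transitivity (F s - F (map (gam \o Phi) s) + (F (map gam (map Phi s)) -
  ev (fun u => F (map gam u)) (sortc G (size s) (map Phi s)))).
  by rewrite map_comp addrA subrK.
rewrite P Q dc_map.
rewrite (eq_ev (F := dc (fun u => F (map gam u))) (F' := fun u => dc F (map gam u))); last first.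
  by move=> u; rewrite dc_map.
rewrite (eq_dc_in (F := fun t => ev _ (sorth _ (size s).-1 _))
  (F' := fun t => ev F (mapc gam (sorth G (size t) (map Phi t))))); last first.
  by move=> t _ ->; rewrite /= ev_mapc.
rewrite [X in _ = _ + X](eq_dc (F' := fun t => ev F (prism1 G (gam \o Phi) id t) +
  ev F (mapc gam (sorth G (size t) (map Phi t))))); last by move=> t; rewrite ev_cat.
rewrite dcD; ring.
Qed.

Lemma padj_map s : finel e1 s -> padj (map Phi s).
Proof.
move=> fs u w /mapP[x xs ->] /mapP[y ys ->]; apply: Phi_adj.
by have [] := rV_ballE (fs _ _ xs ys).
Qed.

Lemma approx_mem s p : finel e1 s -> p \in approx s -> exists2 l,
  [/\ sorted <%O l, padj l & size l = size s] & p.2 = map gam l /\ {subset l <= map Phi s}.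
Proof.
move=> fs /mem_mapc[q qs ->]; exists q.2 => //.
  have [so sb sz] := sortc_mem (size_map _ _) qs; split=> //.
  by move=> u w /sb us /sb ws; exact: (padj_map fs).
by have [_ sb _] := sortc_mem (size_map _ _) qs.
Qed.

Lemma approx_near s p x : p \in approx s -> x \in p.2 ->
  exists2 y, y \in s & ball y h x.
Proof.
move=> /mem_mapc[q qs ->] /mapP[u uq ->].
have [_ sb _] := sortc_mem (size_map _ _) qs.
have /mapP[y ys ->] := sb _ uq; exists y => //.
by apply: rV_ballI => // i; exact: Phi_near.
Qed.

Lemma approxh_near s p x : p \in approxh s -> x \in p.2 ->
  exists2 y, y \in s & ball y h x.
Proof.
rewrite mem_cat => /orP[pp xp|/mem_mapc[q qs ->] /mapP[u uq ->]].
  have [y ys [->|->]] := prism1_mem pp xp; exists y => //=.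
    by apply: rV_ballI => // i; exact: Phi_near.
  exact: ballxx.
have [sb _] := sorth_mem (size_map _ _) qs.
have /mapP[y ys ->] := sb _ uq; exists y => //.
by apply: rV_ballI => // i; exact: Phi_near.
Qed.

Lemma approxh_size s p : p \in approxh s -> size p.2 = (size s).+1.
Proof.
rewrite mem_cat => /orP[/prism1_size//|/mem_mapc[q qs ->]].
by rewrite size_map; have [_ ->] := sorth_mem (size_map _ _) qs.
Qed.

Lemma mesh_le : e1 <= h.
Proof.
rewrite /e1 ler_pdivrMr// ler_pdivrMr ?ltr0n//.
have : 1 <= n.+1%:R :> R by rewrite ler1n.
by move=> N1; rewrite -mulrA ler_peMr ?(ltW h0)// (le_trans N1)// ler_peMl// ler1n.
Qed.

Lemma approxh_fine s p : finel e1 s -> p \in approxh s -> finel (3 * h) p.2.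
Proof.
move=> fs pp x y xp yp.
have [x' x's xx] := approxh_near pp xp; have [y' y's yy] := approxh_near pp yp.
have -> : 3 * h = h + h + h by ring.
apply: ball_triangle yy; apply: ball_triangle (ball_sym xx) _.
by apply: le_ball (fs _ _ x's y's); exact: mesh_le.
Qed.

Lemma approx_fine s p : finel e1 s -> p \in approx s -> finel (3 * h) p.2.
Proof.
move=> fs pp x y xp yp.
have [x' x's xx] := approx_near pp xp; have [y' y's yy] := approx_near pp yp.
have -> : 3 * h = h + h + h by ring.
apply: ball_triangle yy; apply: ball_triangle (ball_sym xx) _.
by apply: le_ball (fs _ _ x's y's); exact: mesh_le.
Qed.

Lemma ellp_approxh_near t y s : finel e1 s ->
  ev (fun s => psi G (map (ellp t y) s)) (approxh s) != 0 ->
  forall x, x \in s -> ball y (5 * h) x.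
Proof.
move=> fs nz x xs.
have [p pp p0] : exists2 p, p \in approxh s & psi G (map (ellp t y) p.2) != 0.
  apply: contrapT => h'; case/eqP: nz; apply: ev_0 => p pp.
  by apply/eqP/negPn/negP => p0; apply: h'; exists p.
have [q [q' qe]] : exists q q', p.2 = q :: q'.
  by have := approxh_size pp; case: p.2 => // q q' _; exists q, q'.
have qp : q \in p.2 by rewrite qe mem_head.
have yq := ellp_near (approxh_fine fs pp) p0 qp.
have [z zs zq] := approxh_near pp qp.
have -> : 5 * h = 3 * h + h + h by ring.
apply: ball_triangle (ball_triangle yq (ball_sym zq)) _.
by apply: le_ball (fs _ _ zs xs); exact: mesh_le.
Qed.

Lemma ev_approx_kuhn v t s : finel e1 s ->
  ev (fun s => psi G (map (ellp t (cubemid c h v)) s)) (approx s) =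
  ev (fun l => (l == kuhn v t)%:R) (sortc G (size s) (map Phi s)).
Proof.
move=> fs; rewrite ev_mapc; apply: eq_ev_in => p pp.
have [so sb sz] := sortc_mem (size_map _ _) pp.
by rewrite psi_kuhn// => u w /sb us /sb ws; exact: (padj_map fs).
Qed.

End Approx.

Lemma padj_kuhn (v : grid n) t : padj (kuhn v t).
Proof.
have aux k k' : (k <= k')%N -> cube_le (kuhn_vertex v t k) (kuhn_vertex v t k').
  move=> kk' i; rewrite !cd_mk; case: ltnP => [h|h]; case: ltnP => h' /=; lia.
move=> u w /mapP[k _ ->] /mapP[k' _ ->].
by have [/aux|/ltnW/aux] := leqP k k'; [left | right].
Qed.

Lemma grid_enum (N : nat) : exists Vs : seq (grid n), forall v,
  (forall i, `|cd v i| <= N%:Z) -> v \in Vs.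
Proof.
exists [seq mkgrid (fun i => (nat_of_ord ((f : {ffun 'I_n -> 'I_(N + N).+1}) i))%:Z - N%:Z) | f <- enum {ffun 'I_n -> 'I_(N + N).+1}].
move=> v vN; apply/mapP; exists [ffun i => inord (absz (cd v i + N%:Z))]; first by rewrite mem_enum.
apply: cd_inj => i; rewrite cd_mk ffunE; have := vN i => h.
by rewrite inordK; lia.
Qed.

(** Both cocycles come from adapted labellings once the sign of [t] is absorbed, and a prism joins
    the labellings. Its support lies near the box with opposite corners [y] and [y']. *)
Lemma theta_shift (t : {perm 'I_n}) y y' : exists2 H : seq V -> G,
  forall s, psi G (map (ellp t y) s) =
    (-1) ^+ (lift_perm ord_max ord_max t : {perm 'I_n.+1}) * theta G y' s + dc H s &
  forall e s, finel e s -> H s != 0 -> s != [::] /\ forall x, x \in s -> forall i,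
    Num.min (y' 0 i) (y 0 i) - e < x 0 i < Num.max (y' 0 i) (y 0 i) + e.
Proof.
pose L := lift_perm ord_max ord_max t \o ellp t y.
exists (fun s => (-1) ^+ (lift_perm ord_max ord_max t : {perm 'I_n.+1}) *
   ev (@psi G n) (prism1 G (lbl y') L s)) => [s0|e s0 fs nz].
  by rewrite dcZ -psi_homotopy psi_ellp -/L mulrBr addrC subrK.
have [p pp p0] : exists2 p, p \in prism1 G (lbl y') L s0 & psi G p.2 != 0.
  apply: contrapT => h'; case/eqP: nz; rewrite ev_0 ?mulr0// => p pp.
  by apply/eqP/negPn/negP => p0; apply: h'; exists p.
split; last exact: adapted_prism_near (adapted_lbl y') (adapted_ellp t y) fs pp p0.
by case: s0 pp {fs nz}.
Qed.

(* H^n of R^n with compact supports is generated by the class of theta. *)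
Lemma Rn_cocycle (F : seq V -> G) (c : V) (r e0 r' : R) : (0 < n)%N -> 0 < e0 -> 0 < r -> r < r' ->
  (forall s, size s = n.+2 -> finel e0 s -> dc F s = 0) ->
  (forall s, size s = n.+1 -> finel e0 s -> (forall x, x \in s -> ~ ball c r x) -> F s = 0) ->
  exists (a : G) (H : seq V -> G) (e : R), [/\ 0 < e,
    forall s, size s = n.+1 -> finel e s -> F s = a * theta G c s + dc H s &
    forall s, size s = n -> finel e s -> (forall x, x \in s -> ~ ball c r' x) -> H s = 0].
Proof.
move=> n0 e00 r0 rr' Fd F0.
(* Approximations of fine lists are [3 * h]-fine, and supports grow from [r] to at most [r + 7 * h]:
   the midpoints used lie within [r + 2 * h] of [c], and the homotopies spread by [5 * h]. *)
pose h := Num.min (e0 / 4) ((r' - r) / 8).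
have h0 : 0 < h by rewrite lt_min !divr_gt0// subr_gt0.
have he : 3 * h <= e0.
  have : h <= e0 / 4 by rewrite ge_min lexx.
  lra.
have hr : 8 * h <= r' - r.
  have : h <= (r' - r) / 8 by rewrite ge_min lexx orbT.
  lra.
have [Phi [Pn Pa]] := round_map_exists c h0.
pose e1 : R := h / n.+1%:R / 2.
have e10 : 0 < e1 by rewrite !divr_gt0// ltr0n.
have e1h : e1 <= h by exact: mesh_le.
pose N := (Num.truncn (r / h + 1)).+1.
have [Vs VsP] := grid_enum N.
(* Finitely many simplices, among them all that meet the ball of radius [r]. *)
pose T0 := undup [seq kuhn v t | v <- Vs, t <- enum {perm 'I_n}].
pose gam := gridpt c h.
have gamN v : ball c (r + h) (gam v) -> v \in Vs.
  move=> /rV_ballE[_ b]; apply: VsP => i; have := b i.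
  rewrite mxE opprD addrA subrr add0r normrN normrM gtr0_norm// => b'.
  have {}b' : `|(cd v i)%:~R| < r / h + 1 :> R.
    have -> : r / h + 1 = (r + h) / h by rewrite mulrDl divff// gt_eqF.
    by rewrite ltr_pdivlMr// mulrC.
  rewrite -(ler_int R) intr_norm (ltW (lt_trans b' _))//.
  exact: truncnS_gt.
have T0P l : sorted <%O l -> padj l -> size l = n.+1 -> l \notin T0 ->
    forall x, x \in map gam l -> ~ ball c r x.
  move=> so al zl lT _ /mapP[u ul ->] b; case/negP: lT.
  have [v [t lE]] := sorted_padj_kuhn so al zl.
  rewrite mem_undup; apply/allpairsP; exists (v, t); split=> //=; last exact: mem_enum.
  apply: gamN; have vl : v \in l.
    rewrite lE; apply/mapP; exists 0%N; first by rewrite mem_iota.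
    by apply: cd_inj => i; rewrite cd_mk ltn0 addr0.
  have [r0' b'] := rV_ballE b; apply: rV_ballI => [|i]; first by rewrite addr_gt0.
  have := b' i; rewrite !mxE.
  have : `|(cd u i)%:~R - (cd v i)%:~R| <= 1 :> R.
    exact: padj_norm al ul vl.
  rewrite ler_norml !ltr_norml => /andP[? ?] /andP[? ?]; apply/andP; split; nra.
have vsE (t : seq (grid n)) : exists p : grid n * {perm 'I_n},
    (exists v t', t = kuhn v t') -> t = kuhn p.1 p.2.
  have [[v [t' ->]]|ne] := pselect (exists v t', t = kuhn v t'); first by exists (v, t').
  by exists (mkgrid (fun=> 0), 1%g).
have [vs vsP] := choice vsE.
pose sg t : G := (-1) ^+ (lift_perm ord_max ord_max (vs t).2 : {perm 'I_n.+1}).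
pose md t := cubemid c h (vs t).1.
pose Psi t s := psi G (map (ellp (vs t).2 (md t)) s).
have Psi_dc t s : dc (Psi t) s = 0 by exact: ellp_dc.
have HE (t : seq (grid n)) : exists H : seq V -> G,
   (forall s, Psi t s = sg t * theta G c s + dc H s) /\
   forall e s, finel e s -> H s != 0 -> forall x, x \in s -> forall i,
    Num.min (c 0 i) (md t 0 i) - e < x 0 i < Num.max (c 0 i) (md t 0 i) + e.
  have [H h1 h2] := theta_shift (vs t).2 (md t) c.
  by exists H; split=> // e s fs /(h2 _ _ fs)[].
have [H HP] := choice HE.
have T0E t : t \in T0 -> t = kuhn (vs t).1 (vs t).2.
  by rewrite mem_undup => /allpairsP[[v t'] [_ _ tE]]; apply: vsP; exists v, t'.
(* On approximations [F] equals the combination of label cocycles weighted by its values on the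
   simplices; each label cocycle is a sign times [theta] up to a coboundary. *)
have sE s : size s = n.+1 -> finel e1 s ->
    ev F (approx c h Phi s) = \sum_(t <- T0) F (map gam t) * ev (Psi t) (approx c h Phi s).
  move=> zs fs; pose F' s := \sum_(t <- T0) F (map gam t) * Psi t s.
  transitivity (ev F' (approx c h Phi s)); last first.
    by rewrite ev_sumf; apply: eq_bigr => t _; rewrite ev_scalef.
  apply: eq_ev_in => p pp; rewrite /F'.
  have fp := approx_fine h0 Pn fs pp.
  have [l [so al zl] [pE lsub]] := approx_mem Pa fs pp; rewrite pE in fp *.
  rewrite [RHS]big_seq (eq_bigr (fun t => F (map gam t) * (l == t)%:R)); last first.
    by move=> t /T0E te; rewrite /Psi psi_kuhn// -te.
  rewrite -big_seq; have [lT|lnT] := boolP (l \in T0).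
    rewrite (bigD1_seq l) ?undup_uniq//= eqxx mulr1 big1 ?addr0// => t /negPf tl.
    by rewrite eq_sym tl mulr0.
  rewrite big1_seq; last first.
    move=> t /andP[_ tT]; case: eqP => [lt|_]; last by rewrite mulr0.
    by rewrite lt tT in lnT.
  apply: F0; first by rewrite size_map zl.
    exact: finel_le fp.
  by apply: T0P lnT => //; rewrite zl.
pose Psih t s := ev (Psi t) (approxh c h Phi s).
have PsiA t s : ev (Psi t) (approx c h Phi s) = sg t * theta G c s + dc (H t) s - dc (Psih t) s.
  have := approx_homotopy c h Phi (Psi t) s.
  rewrite [X in _ = X + _]ev_0 ?add0r => [eA|p _]; last exact: Psi_dc.
  have [<- _] := HP t; rewrite -/(Psih t) -eA; ring.
(* Discarding the simplices away from the ball, on which [F] vanishes, keeps the primitive supported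
   within [r']. *)
pose T1 := [seq t <- T0 | has (fun x => `[< ball c r x >]) (map gam t)].
exists (\sum_(t <- T0) F (map gam t) * sg t),
  (fun s => ev F (approxh c h Phi s) + \sum_(t <- T1) F (map gam t) * (H t s - Psih t s)), e1.
split=> // [s zs fs|s zs fs sr].
  have T1E (K : seq (grid n) -> G) : \sum_(t <- T0) F (map gam t) * K t = \sum_(t <- T1) F (map gam t) * K t.
    rewrite [RHS]big_filter [RHS]big_mkcond; apply: eq_big_seq => t tT.
    have [//|/hasPn nb] := boolP (has _ (map gam t)); rewrite F0 ?mul0r//.
    - by rewrite size_map (T0E t tT) size_kuhn.
    - apply: (@finel_le _ _ (2 * h)); first by lra.
      have al : padj t by rewrite (T0E t tT); exact: padj_kuhn.
      move=> _ _ /mapP[u ut ->] /mapP[w wt ->]; apply: rV_ballI => [|i]; first by rewrite mulr_gt0.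
      rewrite !mxE opprD addrACA subrr add0r -mulrBr normrM gtr0_norm// mulrC ltr_pM2r//.
      by apply: (le_lt_trans (padj_norm _ i al ut wt)); rewrite ltr1n.
    - by move=> x xt /asboolP; apply/negP; exact: nb.
  have := approx_homotopy c h Phi F s.
  rewrite [X in _ = X + _]ev_0 ?add0r => [eA|p pp]; last first.
    by apply: Fd; [rewrite (approxh_size pp) zs | exact: finel_le (approxh_fine h0 Pn fs pp)].
  have S1 : \sum_(t <- T0) F (map gam t) * ev (Psi t) (approx c h Phi s) =
      (\sum_(t <- T0) F (map gam t) * sg t) * theta G c s +
      \sum_(t <- T1) F (map gam t) * (dc (H t) s - dc (Psih t) s).
    rewrite -T1E mulr_suml -big_split; apply: eq_bigr => t _; rewrite PsiA /=.
    by rewrite -mulrA -mulrDr addrA.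
  have S2 : dc (fun s => \sum_(t <- T1) F (map gam t) * (H t s - Psih t s)) s =
      \sum_(t <- T1) F (map gam t) * (dc (H t) s - dc (Psih t) s).
    by rewrite dc_sum; apply: eq_bigr => t _; rewrite dcZ dcB.
  by rewrite dcD S2 -eA sE// S1; ring.
have sne : exists x, x \in s.
  by case: s zs n0 {fs sr} => [<-//|x s _ _]; exists x; exact: mem_head.
rewrite ev_0 ?add0r.
  rewrite big1_seq// => t /andP[_]; rewrite mem_filter => /andP[/hasP[_ /mapP[u ut ->] /asboolP bu] tT].
  have al : padj t by rewrite (T0E t tT); exact: padj_kuhn.
  have vt : (vs t).1 \in t.
    rewrite [X in _ \in X](T0E t tT); apply/mapP; exists 0%N; first by rewrite mem_iota.
    by apply: cd_inj => i; rewrite cd_mk ltn0 addr0.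
  have mdc : ball c (r + 2 * h) (md t).
    have [_ b'] := rV_ballE bu; apply: rV_ballI => [|i]; first by lra.
    have := b' i; rewrite !mxE.
    have : `|(cd u i)%:~R - (cd (vs t).1 i)%:~R| <= 1 :> R.
      exact: padj_norm al ut vt.
    rewrite ler_norml !ltr_norml => /andP[? ?] /andP[? ?]; apply/andP; split; nra.
  have -> : H t s = 0.
    apply/eqP/negPn/negP => nz; have [_ /(_ _ _ fs nz) near] := HP t.
    have [x xs] := sne.
    apply: (sr x xs); apply: rV_ballI => [|i]; first by lra.
    have [_ /(_ i)] := rV_ballE mdc; have := near x xs i.
    rewrite !ltr_norml; case: (leP (c 0 i)) => _ /andP[? ?] /andP[? ?]; apply/andP; split; lra.
  have -> : Psih t s = 0.
    apply/eqP/negPn/negP => nz; have near := ellp_approxh_near h0 Pn fs nz.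
    have [x xs] := sne.
    apply: (sr x xs); apply: le_ball (ball_triangle mdc (near x xs)); lra.
  by rewrite subrr mulr0.
move=> p pp; apply: F0.
- by rewrite (approxh_size pp) zs.
- exact: finel_le (approxh_fine h0 Pn fs pp).
- move=> x xp bx; have [y ys yx] := approxh_near h0 Pn pp xp.
  apply: (sr y ys); apply: le_ball (ball_triangle bx (ball_sym yx)); lra.
Qed.

Definition nearset (T : pseudoMetricType R) (A : set T) (r : R) : set T :=
  [set x | exists2 a, A a & ball a r x].

(* A relative n-cycle modulo the complement of X whose local degrees vanish near
   X is trivial: on the grid it is a combination of Kuhn simplices, and its
   coefficient at a simplex close to X is a local degree up to sign. *)
Lemma Rn_chain (X : set V) (rho e0 : R) : 0 < rho -> 0 < e0 ->
  exists2 e, 0 < e & forall Y : chain G V,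
    (forall p, p \in Y -> size p.2 = n.+1 /\ finel e p.2) ->
    bd_off e (nearset X rho) Y ->
    (forall y, nearset X rho y -> ev (theta G y) Y = 0) ->
  exists W S : chain G V,
  [/\ forall F, ev F Y = ev (dc F) W + ev F S,
      forall p, p \in W -> [/\ size p.2 = n.+2, finel e0 p.2 & forall x, x \in p.2 ->
        exists2 q, q \in Y & exists2 y, y \in q.2 & ball y e0 x] &
      forall p, p \in S -> [/\ size p.2 = n.+1, finel e0 p.2, forall x, x \in p.2 ->
        exists2 q, q \in Y & exists2 y, y \in q.2 & ball y e0 x &
        forall x, x \in p.2 -> ~ nearset X (rho / 2) x]].
Proof.
move=> rho0 e00.
pose h := Num.min (e0 / 4) (rho / 20).
have h0 : 0 < h by rewrite lt_min !divr_gt0.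
have he : 3 * h <= e0.
  have : h <= e0 / 4 by rewrite ge_min lexx.
  lra.
have hr : 20 * h <= rho.
  have : h <= rho / 20 by rewrite ge_min lexx orbT.
  lra.
pose c : V := 0.
have [Phi [Pn Pa]] := round_map_exists c h0.
pose e1 : R := h / n.+1%:R / 2.
have e10 : 0 < e1 by rewrite !divr_gt0// ltr0n.
have e1h : e1 <= h by exact: mesh_le.
exists e1 => // Y Yf Yoff Y0.
pose gam := gridpt c h.
pose off s := all (fun x => `[< ~ nearset X rho x >]) s.
have offP s : reflect (forall x, x \in s -> ~ nearset X rho x) (off s).
  by apply: (iffP allP) => hs x xs; apply/asboolP; exact: hs.
pose Yg : chain G (grid n) := bindc (fun s => sortc G (size s) (map Phi s)) Y.
pose far l := all (fun x => `[< ~ nearset X (rho / 2) x >]) (map gam l).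
pose S1 := [seq p <- Yg | far p.2].
(* The approximation homotopy applied to the part of the boundary of [Y] away from [X]; the rest of
   the boundary contributes nothing by hypothesis. *)
pose S2 := bindc (approxh c h Phi) [seq p <- bd Y | off p.2].
have ev_bdY K : (forall s, finel e1 s -> (forall x, x \in s -> ~ nearset X rho x) -> K s = 0) ->
    ev (dc K) Y = 0 by exact: Yoff.
have bdf p : p \in bd Y -> finel e1 p.2 /\ size p.2 = n.
  move=> /bd_mem[q qY [sq zq]]; have [zq' fq] := Yf _ qY.
  split; first by apply: finel_sub fq; exact: mem_subseq.
  by move: zq; rewrite zq' => -[].
have Ygm p : p \in Yg -> [/\ sorted <%O p.2, padj p.2, size p.2 = n.+1 &
    exists2 q, q \in Y & {subset p.2 <= map Phi q.2}].
  move=> /mem_bind[q qY [r rs ->]]; have [zq fq] := Yf _ qY.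
  have [so sb zr] := sortc_mem (size_map _ _) rs.
  split=> //; first by move=> u w /sb us /sb ws; exact: (padj_map Pa fq).
    by rewrite zr.
  by exists q.
have degn (K : seq V -> G) : (forall s, finel e1 s -> (forall x, x \in s -> ~ nearset X rho x) -> K s = 0) ->
    ev K (bd Y) = 0 by move=> K0; rewrite ev_bd; exact: Yoff.
have Yg0 l : ~~ far l -> ev (fun w => (w == l)%:R) Yg = 0.
  move=> /allPn[_ /mapP[u ul ->] /asboolP/contrapT[x' Xx' bx']].
  have [[v [t lE]]|nk] := pselect (exists v t, l = kuhn v t); last first.
    apply: ev_0 => p pY; case: eqP => // e; case: nk; have [so al zl _] := Ygm _ pY.
    by rewrite -e; exact: sorted_padj_kuhn.
  pose md := cubemid c h v.
  have vl : v \in l.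
    rewrite lE; apply/mapP; exists 0%N; first by rewrite mem_iota.
    by apply: cd_inj => i; rewrite cd_mk ltn0 addr0.
  have al : padj l by rewrite lE; exact: padj_kuhn.
  have mdx : ball x' (rho / 2 + 2 * h) md.
    have [_ b'] := rV_ballE bx'; apply: rV_ballI => [|i]; first by lra.
    have := b' i; rewrite !mxE.
    have : `|(cd u i)%:~R - (cd v i)%:~R| <= 1 :> R.
      exact: padj_norm al ul vl.
    rewrite ler_norml !ltr_norml => /andP[? ?] /andP[? ?]; apply/andP; split; nra.
  pose Psi s := psi G (map (ellp t md) s).
  have -> : ev (fun w => (w == l)%:R) Yg = ev Psi (bindc (approx c h Phi) Y).
    rewrite !ev_bind; apply: eq_ev_in => q qY; have [_ fq] := Yf _ qY.
    by rewrite lE -(ev_approx_kuhn c h0 Pa).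
  (* The approximation homotopy alters the value only through the boundary of [Y], which is carried
     by lists farther from [X] than [Psi] reaches. *)
  have -> : ev Psi (bindc (approx c h Phi) Y) = ev Psi Y.
    rewrite ev_bind.
    rewrite (eq_ev_in (F' := fun s => Psi s - dc (fun t => ev Psi (approxh c h Phi t)) s)); last first.
      move=> p pY; have := approx_homotopy c h Phi Psi p.2.
      rewrite [X in _ = X + _]ev_0 ?add0r => [<-|q _]; last exact: ellp_dc.
      by rewrite subKr.
    rewrite ev_subf ev_bdY ?subr0// => s fs offs.
    apply/eqP/negPn/negP => nz; have near := ellp_approxh_near h0 Pn fs nz.
    have [x xs] : exists x, x \in s.
      by case: s {fs offs near} nz => [|x s _]; [rewrite ev_nil eqxx | exists x; exact: mem_head].
    apply: (offs x xs); exists x' => //.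
    by apply: le_ball (ball_triangle mdx (near x xs)); lra.
  have [H HE Hn] := theta_shift t md md.
  rewrite (eq_ev _ HE) ev_addf ev_scalef Y0; last by exists x' => //; apply: le_ball mdx; lra.
  rewrite mulr0 add0r ev_bdY// => s fs offs; apply/eqP/negPn/negP => nz.
  have [sne near] := Hn _ _ fs nz.
  have [x xs] : exists x, x \in s.
    by case: s sne {fs offs near nz} => [//|x s _]; exists x; exact: mem_head.
  apply: (offs x xs); exists x' => //.
  have mx : ball md e1 x.
    apply: rV_ballI => // i; have := near x xs i; rewrite minxx maxxx ltr_norml.
    by move=> /andP[? ?]; apply/andP; split; lra.
  by apply: le_ball (ball_triangle mdx mx); lra.
exists (bindc (approxh c h Phi) Y), (mapc gam S1 ++ S2); split.
- move=> F; rewrite ev_cat ev_mapc (ev_filter_coeff (fun w => F (map gam w)) Yg0) !ev_bind.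
  rewrite ev_filter.
  have -> : ev (fun s => if off s then ev F (approxh c h Phi s) else 0) (bd Y) =
            ev (fun s => ev F (approxh c h Phi s)) (bd Y).
    apply/esym/subr0_eq; rewrite -ev_subf; apply: degn => s fs offs.
    by have /offP -> := offs; rewrite subrr.
  rewrite ev_bd -!ev_addf; apply: eq_ev => s.
  by rewrite addrCA -approx_homotopy /approx ev_mapc addrC subrK.
- move=> p /mem_bind[q qY [r ra ->]]; have [zq fq] := Yf _ qY; split.
  + by rewrite (approxh_size ra) zq.
  + exact: finel_le (approxh_fine h0 Pn fq ra).
  + move=> x xr; exists q => //; have [y yq yx] := approxh_near h0 Pn ra xr.
    by exists y => //; apply: le_ball yx; lra.
- move=> p; rewrite mem_cat => /orP[/mem_mapc[q]|/mem_bind[q]].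
    rewrite mem_filter => /andP[fq qY] ->; have [so al zl [q' q'Y sb]] := Ygm _ qY.
    have nr x : x \in map gam q.2 -> exists2 y, y \in q'.2 & ball y h x.
      move=> /mapP[u uq ->]; have /mapP[y yq ->] := sb _ uq.
      by exists y => //; apply: rV_ballI => // i; exact: Pn.
    split=> [|x y xq yq|x xq|x xq].
    + by rewrite size_map.
    + have [_ fq'] := Yf _ q'Y.
      have [x1 x1q b1] := nr _ xq; have [x2 x2q b2] := nr _ yq.
      have bb := ball_triangle (ball_triangle (ball_sym b1) (fq' _ _ x1q x2q)) b2.
      by apply: le_ball bb; lra.
    + exists q' => //; have [y yq yx] := nr _ xq.
      by exists y => //; apply: le_ball yx; lra.
    + by move/allP: fq => /(_ _ xq)/asboolP.
  rewrite mem_filter => /andP[/offP oq qb] [r ra ->]; have [fq zq] := bdf _ qb.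
  split=> [||x xr|x xr].
  + by rewrite (approxh_size ra) zq.
  + exact: finel_le (approxh_fine h0 Pn fq ra).
  + have [q' q'Y [sq _]] := bd_mem qb; exists q' => //.
    have [y yq yx] := approxh_near h0 Pn ra xr.
    by exists y; [exact: (mem_subseq sq) | apply: le_ball yx; lra].
  + move=> [x' Xx' bx']; have [y yq yx] := approxh_near h0 Pn ra xr.
    apply: (oq y yq); exists x' => //.
    by apply: le_ball (ball_triangle bx' (ball_sym yx)); lra.
Qed.

End ApproxRn.

(** * Chain models of simplices *)

Section SimplexChains.
Variables (R : realType) (G : comNzRingType).
Local Notation Sx k := (stdsimplex R k).

Lemma Sx_ge0 k (x : Sx k) i : 0 <= val x 0 i.
Proof. by have := valP x; rewrite inE => -[]. Qed.
Lemma Sx_sum k (x : Sx k) : \sum_i val x 0 i = 1.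
Proof. by have := valP x; rewrite inE => -[]. Qed.
Lemma Sx_le1 k (x : Sx k) i : val x 0 i <= 1.
Proof.
rewrite -(Sx_sum x) (bigD1 i)//= lerDl sumr_ge0// => j _; exact: Sx_ge0.
Qed.

Definition vert_pt k (j : 'I_k.+1) : 'rV[R]_k.+1 := \row_i (i == j)%:R.
Fact vert_ptP k j : @vert_pt k j \in Sx k.
Proof.
rewrite inE; split=> [i|]; first by rewrite mxE ler0n.
rewrite (bigD1 j)//= mxE eqxx big1 ?addr0// => i /negPf ij.
by rewrite mxE ij.
Qed.
Definition vert k (j : 'I_k.+1) : Sx k := exist _ (vert_pt j) (vert_ptP j).

Definition cvx_pt k (t : R) (x y : 'rV[R]_k.+1) := (1 - t) *: x + t *: y.
Definition cvx k (t : R) (y x : Sx k) : Sx k :=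
  insubd y (cvx_pt t (val x) (val y)).
Lemma val_cvx k t y x : 0 <= t <= 1 -> val (@cvx k t y x) = cvx_pt t (val x) (val y).
Proof.
move=> /andP[t0 t1]; rewrite insubdK// inE; split=> [i|].
  by rewrite !mxE addr_ge0// mulr_ge0// ?subr_ge0//; exact: Sx_ge0.
under eq_bigr do rewrite !mxE.
by rewrite big_split/= -!mulr_sumr !Sx_sum !mulr1 subrK.
Qed.

Definition sfine k (d : R) (l : seq (Sx k)) : Prop := finel d (map val l).

Lemma sfineP k d (l : seq (Sx k)) : sfine d l <->
  forall x y, x \in l -> y \in l -> ball (val x) d (val y).
Proof.
split=> [h x y xl yl|h _ _ /mapP[x xl ->] /mapP[y yl ->]]; last exact: h.
by apply: h; apply: map_f.
Qed.

Lemma cvx_dist (t t' U V B d : R) : 0 <= t <= 1 -> 0 <= U <= 1 -> 0 <= V <= 1 ->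
  0 <= B <= 1 -> `|U - V| < d -> `|t' - t| < d ->
  `|(1 - t) * U + t * B - ((1 - t') * V + t' * B)| < 2 * d.
Proof.
move=> /andP[t0 t1] /andP[U0 U1] /andP[V0 V1] /andP[B0 B1] UV tt.
have -> : (1 - t) * U + t * B - ((1 - t') * V + t' * B) =
  (1 - t) * (U - V) + (t' - t) * (V - B) by ring.
apply: le_lt_trans (ler_normD _ _) _; rewrite !normrM mulr2n mulrDl mul1r.
apply: ltrD.
  apply: le_lt_trans UV; rewrite ler_piMl// ger0_norm; lra.
apply: le_lt_trans tt; rewrite ler_piMr// ler_norml; apply/andP; split; lra.
Qed.

(** A cone from a vertex would not be fine, so the simplex is contracted to the vertex in small
    steps and the prisms of the steps are summed; only the final constant lists are coned. Mesh and
    motion contribute [d] each, hence [2 * d]. *)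
Lemma simplex_fill_exists k (d : R) m (z : chain G (Sx k)) : 0 < d ->
  (forall p, p \in z -> size p.2 = m) -> (forall F, ev (dc F) z = 0) ->
  exists w : chain G (Sx k), [/\ forall F, ev (dc F) w = ev F z,
    forall p, p \in w -> size p.2 = m.+1 &
    (forall p, p \in z -> sfine d p.2) -> forall p, p \in w -> sfine (2 * d) p.2].
Proof.
move=> d0 zm z0; pose b : Sx k := vert ord0.
have [N [N0' Nd]] : exists N, (0 < N)%N /\ N%:R^-1 < d.
  by exists (Num.truncn d^-1).+1; split=> //; rewrite invf_plt ?posrE//; exact: truncnS_gt.
have N0 : 0 < N%:R :> R by rewrite ltr0n.
pose H j := cvx (j%:R / N%:R) b : Sx k -> Sx k.
have jN j : (j <= N)%N -> 0 <= (j%:R / N%:R : R) <= 1.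
  by move=> jN; rewrite divr_ge0//= ler_pdivrMr// mul1r ler_nat.
have H0 x : H 0%N x = x.
  apply: val_inj; rewrite val_cvx ?jN// /cvx_pt mul0r subr0 scale1r scale0r addr0//.
have HN x : H N x = b.
  by apply: val_inj; rewrite val_cvx ?jN// /cvx_pt divff ?gt_eqF// subrr scale0r add0r scale1r.
pose W := flatten [seq bindc (prism1 G (H j) (H j.+1)) z | j <- iota 0 N].
exists (oppc W ++ consc b (mapc (H N) z)); split.
- move=> F; rewrite ev_cat ev_opp ev_consc.
  have -> : ev (fun s => dc F (b :: s)) (mapc (H N) z) = ev F (mapc (H N) z).
    rewrite [LHS](eq_ev (F' := fun s => F s - dc (fun u => F (b :: u)) s)); last first.
      by move=> s /=; rewrite dc_cons.
    rewrite ev_subf [X in _ - X](_ : _ = 0) ?subr0// ev_mapc.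
    by rewrite -[RHS](z0 (fun s => F (b :: map (H N) s))); apply: eq_ev => s; rewrite dc_map.
  have -> : ev (dc F) W = ev F (mapc (H N) z) - ev F z.
    have -> : ev F z = ev F (mapc (H 0%N) z).
      by rewrite ev_mapc; apply: eq_ev => s; rewrite (eq_map H0) map_id.
    suff aux N' : ev (dc F) (flatten [seq bindc (prism1 G (H j) (H j.+1)) z | j <- iota 0 N']) =
        ev F (mapc (H N') z) - ev F (mapc (H 0%N) z) by exact: aux.
    elim: N' => [|N' IH]; first by rewrite ev_nil subrr.
    have -> : iota 0 N'.+1 = iota 0 N' ++ [:: N'] by rewrite -addn1 iotaD.
    rewrite map_cat flatten_cat ev_cat IH /= cats0.
    rewrite ev_bind !ev_mapc.
    rewrite (eq_ev (F := fun s => ev (dc F) _) (F' := fun s => F (map (H N'.+1) s) -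
       F (map (H N') s) - dc (fun t => ev F (prism1 G (H N') (H N'.+1) t)) s)); last first.
      by move=> s /=; rewrite prism_homotopy addrAC subrr add0r.
    by rewrite !ev_subf z0 subr0; ring.
  ring.
- move=> p; rewrite mem_cat => /orP[/mem_scalec[q /flattenP[l /mapP[j _ ->]]]|/mapP[q]].
    by move=> /mem_bind[r rz [r' r'p ->]] ->; rewrite (prism1_size r'p) (zm _ rz).
  by move=> /mem_mapc[r rz re] -> /=; rewrite re size_map (zm _ rz).
- move=> zf p; rewrite mem_cat => /orP[/mem_scalec[q /flattenP[l /mapP[j jN' ->]]]|/mapP[q]].
    move=> /mem_bind[r rz [r' r'p ->]] ->; apply/sfineP => x y xr yr.
    have jN0 : (j < N)%N by move: jN'; rewrite mem_iota.
    have cl u v : u \in r.2 -> v \in r.2 -> forall i,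
        `|val u 0 i - val v 0 i| < d by move=> ur vr; have /sfineP/(_ _ _ ur vr)/rV_ballE[] := zf _ rz.
    have bd01 (u : Sx k) i : 0 <= val u 0 i <= 1 by rewrite Sx_ge0 Sx_le1.
    have [u ur xe] := prism1_mem r'p xr; have [v vr ye] := prism1_mem r'p yr.
    have step : j.+1%:R / N%:R = j%:R / N%:R + N%:R^-1 :> R.
      by rewrite -natr1 mulrDl mul1r.
    have /andP[a0 a1] := jN j (ltnW jN0); have /andP[c0 c1] := jN j.+1 jN0.
    apply: rV_ballI => [|i]; first by rewrite mulr_gt0.
    have st : `|j.+1%:R / N%:R - j%:R / N%:R| < d.
      by rewrite step addrAC subrr add0r gtr0_norm// invr_gt0.
    have st' := st; rewrite distrC in st'.
    have s0 : `|0 : R| < d by rewrite normr0.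
    have [f0 f1] := (jN j (ltnW jN0), jN j.+1 jN0).
    case: xe => ->; case: ye => ->; rewrite !val_cvx// !mxE; apply: cvx_dist;
      rewrite ?bd01 ?cl ?subrr ?ler0n ?lern1 ?leq_b1//.
  move=> /mem_mapc[r rz re] ->; apply/sfineP => x y xr yr.
  have hb u : u \in b :: q.2 -> u = b.
    by rewrite inE re => /orP[/eqP//|/mapP[v _ ->]].
  by rewrite (hb _ xr) (hb _ yr); apply: ballxx; rewrite mulr_gt0.
Qed.

Definition simplex_fill k (d : R) m (z : chain G (Sx k)) : chain G (Sx k) :=
  xget [::] [set w | [/\ forall F, ev (dc F) w = ev F z,
    forall p, p \in w -> size p.2 = m.+1 &
    (forall p, p \in z -> sfine d p.2) -> forall p, p \in w -> sfine (2 * d) p.2]].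

Lemma simplex_fillP k (d : R) m (z : chain G (Sx k)) : 0 < d ->
  (forall p, p \in z -> size p.2 = m) -> (forall F, ev (dc F) z = 0) ->
  [/\ forall F, ev (dc F) (simplex_fill d m z) = ev F z,
    forall p, p \in simplex_fill d m z -> size p.2 = m.+1 &
    (forall p, p \in z -> sfine d p.2) ->
      forall p, p \in simplex_fill d m z -> sfine (2 * d) p.2].
Proof.
move=> d0 zm z0; have [w wP] := simplex_fill_exists d0 zm z0.
exact: (@xgetPex _ [::] [set w | [/\ forall F, ev (dc F) w = ev F z,
    forall p, p \in w -> size p.2 = m.+1 &
    (forall p, p \in z -> sfine d p.2) -> forall p, p \in w -> sfine (2 * d) p.2]]
  (ex_intro _ w wP)).
Qed.

Definition faces k (z : chain G (Sx k)) : chain G (Sx k.+1) :=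
  flatten [seq scalec ((-1) ^+ (i : 'I_k.+2)) (mapc (@face R k i) z) | i <- enum 'I_k.+2].

Lemma ev_faces k (z : chain G (Sx k)) F :
  ev F (faces z) = \sum_(i < k.+2) (-1) ^+ i * ev (fun s => F (map (face i) s)) z.
Proof.
rewrite /ev /faces big_flatten/= big_map big_enum/=; apply: eq_bigr => i _.
by rewrite -/(ev F _) ev_scale ev_mapc.
Qed.

Lemma mem_faces k (z : chain G (Sx k)) p : p \in faces z ->
  exists i, exists2 q, q \in z & p.2 = map (@face R k i) q.2.
Proof.
move=> /flattenP[l /mapP[i _ ->]] /mem_scalec[q /mem_mapc[r rz e] ->].
by exists i, r.
Qed.

Lemma face_fine k (i : 'I_k.+2) d (l : seq (Sx k)) : sfine d l -> sfine d (map (face i) l).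
Proof.
move=> /sfineP fl; apply/sfineP => _ _ /mapP[x xl ->] /mapP[y yl ->].
have [d0 b] := rV_ballE (fl _ _ xl yl).
apply: rV_ballI => // j; rewrite !mxE; case: unliftP => [j' _|_]; first exact: b.
by rewrite subr0 normr0.
Qed.

(* kap k is a list-chain approximation of the identity singular k-simplex, natural
   with respect to faces; kap 0 is normalized by the augmentation. *)
Definition model (kap : forall k, chain G (Sx k)) : Prop :=
  [/\ forall k p, p \in kap k -> size p.2 = k.+1,
      forall F, ev (dc F) (kap 0%N) = F [::] &
      forall k F, ev (dc F) (kap k.+1) = ev F (faces (kap k))].

Lemma face_ptE k (i : 'I_k.+2) (t : 'rV[R]_k.+1) a :
  face_pt i t 0 a = if a == i then 0 else t 0 (inord (unbump i a)).
Proof.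
rewrite mxE; case: unliftP => [c ->|->]; last by rewrite eqxx.
rewrite eq_sym (negPf (neq_lift _ _)) /= bumpK; congr (t 0 _).
by apply: val_inj; rewrite /= inordK.
Qed.

Lemma face_face k i j (x : Sx k) : (j < i)%N -> (i < k.+3)%N ->
  face (inord i : 'I_k.+3) (face (inord j : 'I_k.+2) x) =
  face (inord j : 'I_k.+3) (face (inord i.-1 : 'I_k.+2) x).
Proof.
move=> ji ik; apply: val_inj; apply/rowP => a /=; rewrite !face_ptE.
have ak := ltn_ord a; have jk : (j < k.+2)%N by lia.
have ik' : (i.-1 < k.+2)%N by lia.
have jk' : (j < k.+3)%N by lia.
rewrite -!val_eqE /= (inordK ik) (inordK jk') (inordK jk) (inordK ik') /unbump.
have [e1|e1] := eqVneq (nat_of_ord a) i.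
  have -> : (a == j :> nat) = false by apply/eqP; lia.
  rewrite inordK; last by lia.
  by have -> : ((a - (j < a))%N == i.-1) = true by apply/eqP; lia.
rewrite inordK; last by lia.
have [e2|e2] := eqVneq (nat_of_ord a) j.
  by have -> : ((a - (i < a))%N == j) = true by apply/eqP; lia.
rewrite inordK; last by lia.
have [e3|e3] := eqVneq (a - (i < a))%N j; have [e4|e4] := eqVneq (a - (j < a))%N i.-1 => //; try lia.
by congr (val x 0 (inord _)); lia.
Qed.

(** The symmetry cancels the terms at [(i, j)] and [(j, i.-1)]; the induction removes the last row
    together with the last column. *)
Lemma alt_double_sum (A : nat -> nat -> G) m :
  (forall i j, (j < i)%N -> (i <= m)%N -> A i j = A j i.-1) ->
  \sum_(i < m.+1) (-1) ^+ i * \sum_(j < m) (-1) ^+ j * A i j = 0.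
Proof.
elim: m => [|m IH] AE; first by rewrite big_ord1 big_ord0 mulr0.
rewrite big_ord_recr/=.
under eq_bigr do rewrite big_ord_recr/= mulrDr.
rewrite big_split/= IH ?add0r; last by move=> i j ji im; apply: AE => //; lia.
rewrite mulr_sumr -big_split big1// => i _ /=.
rewrite (AE m.+1 i) ?leqnn ?ltn_ord//= exprS; ring.
Qed.

(** Acyclic models: each simplex is filled from its faces, and each filling doubles the mesh. *)
Fixpoint kappa (d : R) (k : nat) : chain G (Sx k) :=
  if k is k'.+1 then simplex_fill (2 ^+ k' * d) k'.+1 (faces (kappa d k'))
  else [:: (1, [:: vert ord0])].

Lemma kappaP d : 0 < d -> model (kappa d) /\
  forall k p, p \in kappa d k -> sfine (2 ^+ k * d) p.2.
Proof.
move=> d0.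
suff H k : [/\ forall p, p \in kappa d k -> size p.2 = k.+1 /\ sfine (2 ^+ k * d) p.2,
    forall F, ev (dc F) (faces (kappa d k)) = 0 & match k with 0 => forall F, ev (dc F) (kappa d 0) = F [::]
    | k'.+1 => forall F, ev (dc F) (kappa d k'.+1) = ev F (faces (kappa d k')) end].
  split=> [|k p pk]; last by have [/(_ _ pk)[]] := H k.
  split=> [k p pk|F|k F]; first by have [/(_ _ pk)[]] := H k.
    by have [_ _] := H 0%N; apply.
  by have [_ _] := H k.+1; apply.
elim: k => [|k [IH1 IH2 IH3]].
  split=> [p|F|F].
  - rewrite inE => /eqP->; split=> //; rewrite expr0 mul1r.
    by apply/sfineP => x y; rewrite !inE => /eqP-> /eqP->; exact: ballxx.
  - rewrite ev_faces big_ord_recl big_ord1 /= !ev1 /= !dc_cons !dc_nil expr0 expr1; ring.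
  - by rewrite ev1 dc_cons dc_nil subr0.
have [||w1 w2 w3] := @simplex_fillP _ (2 ^+ k * d) k.+1 (faces (kappa d k)) _ _ IH2.
- by rewrite mulr_gt0// exprn_gt0.
- by move=> p /mem_faces[i [q qk ->]]; rewrite size_map; have [] := IH1 _ qk.
split=> // [p pk|F].
  split; first exact: w2.
  rewrite exprS -mulrA; apply: w3 pk => q /mem_faces[i [r rk ->]].
  by apply: face_fine; have [] := IH1 _ rk.
rewrite ev_faces.
have dcf (i : 'I_k.+3) : ev (fun s => dc F (map (face i) s)) (kappa d k.+1) =
    ev (dc (fun s => F (map (face i) s))) (kappa d k.+1).
  by apply: eq_ev => s; rewrite dc_map.
under eq_bigr do rewrite dcf w1 ev_faces.
pose A i j := ev (fun s => F (map (face (inord i : 'I_k.+3)) (map (face (inord j : 'I_k.+2)) s))) (kappa d k).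
rewrite -[RHS](@alt_double_sum A k.+2).
  apply: eq_bigr => i _; congr (_ * _); apply: eq_bigr => j _.
  by rewrite /A !inord_val.
move=> i j ji ik; apply: eq_ev => s; congr F.
by rewrite -!map_comp; apply: eq_map => x; exact: face_face.
Qed.

Section ModelHomotopy.
Variables (kap kap' : forall k, chain G (Sx k)) (d : R).
Hypotheses (kapP : model kap) (kap'P : model kap') (d0 : 0 < d).

(** Two models are joined by a homotopy natural in the faces, filled dimension by dimension; again
    the mesh doubles at each step. *)
Fixpoint mhom (k : nat) : chain G (Sx k) :=
  match k with
  | 0 => simplex_fill d 1 (kap 0%N ++ oppc (kap' 0%N))
  | k'.+1 => simplex_fill (2 ^+ k'.+1 * d) k'.+2
      (kap k'.+1 ++ oppc (kap' k'.+1) ++ oppc (faces (mhom k')))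
  end.

Definition mbd (k : nat) : chain G (Sx k) :=
  match k with 0 => [::] | k'.+1 => faces (mhom k') end.

Lemma mhomP k :
  [/\ forall p, p \in mhom k -> size p.2 = k.+2,
      forall F, ev (dc F) (mhom k) = ev F (kap k) - ev F (kap' k) - ev F (mbd k) &
      (forall j, (j <= k)%N -> forall p, (p \in kap j) || (p \in kap' j) -> sfine d p.2) ->
      forall p, p \in mhom k -> sfine (2 ^+ k.+1 * d) p.2].
Proof.
have [ks k0 kS] := kapP; have [ks' k0' kS'] := kap'P.
elim: k => [|k [IH1 IH2 IH3]].
  have [|F|w1 w2 w3] := @simplex_fillP _ d 1 (kap 0%N ++ oppc (kap' 0%N)) d0.
  - by move=> p; rewrite mem_cat => /orP[/ks//|/mem_scalec[q /ks' + ->]].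
  - by rewrite ev_cat ev_opp k0 k0' subrr.
  split=> [p /w2//|F|fk p pk]; first by rewrite /= w1 ev_cat ev_opp ev_nil subr0.
  rewrite expr1; apply: w3 pk => q; rewrite mem_cat => /orP[qk|/mem_scalec[r rk ->]].
    by apply: (fk 0%N) => //; rewrite qk.
  by apply: (fk 0%N) => //; rewrite rk orbT.
have d2 : 0 < 2 ^+ k.+1 * d by rewrite mulr_gt0// exprn_gt0.
have [|F|w1 w2 w3] := @simplex_fillP _ _ k.+2 (kap k.+1 ++ oppc (kap' k.+1) ++ oppc (faces (mhom k))) d2.
- move=> p; rewrite !mem_cat => /or3P[/ks//|/mem_scalec[q /ks' + ->]//|/mem_scalec[q /mem_faces[i [r rm ->]] ->]].
  by rewrite size_map IH1.
- rewrite !ev_cat !ev_opp kS kS' addrA.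
  suff -> : ev (dc F) (faces (mhom k)) = ev F (faces (kap k)) - ev F (faces (kap' k)).
    by rewrite subrr.
  rewrite [LHS]ev_faces.
  have dcf (i : 'I_k.+2) : ev (fun s => dc F (map (face i) s)) (mhom k) =
      ev (fun s => F (map (face i) s)) (kap k) - ev (fun s => F (map (face i) s)) (kap' k)
      - ev (fun s => F (map (face i) s)) (mbd k).
    by rewrite -IH2; apply: eq_ev => s; rewrite dc_map.
  under eq_bigr do rewrite dcf !mulrDr !mulrN.
  rewrite !big_split/= !sumrN -!ev_faces.
  suff -> : ev F (faces (mbd k)) = 0 by rewrite subr0.
  case: k F {IH1 IH2 IH3 d2 dcf} => [|k] F; first by rewrite ev_faces big1// => i _; rewrite ev_nil mulr0.
  rewrite ev_faces.
  under eq_bigr do rewrite ev_faces.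
  pose A i j := ev (fun s => F (map (face (inord i : 'I_k.+3)) (map (face (inord j : 'I_k.+2)) s))) (mhom k).
  rewrite -[RHS](@alt_double_sum A k.+2).
    apply: eq_bigr => i _; congr (_ * _); apply: eq_bigr => j _.
    by rewrite /A !inord_val.
  move=> i j ji ik; apply: eq_ev => s; congr F.
  by rewrite -!map_comp; apply: eq_map => x; exact: face_face.
split=> [p /w2//|F|fk p pk].
  by rewrite /= w1 !ev_cat !ev_opp addrA.
rewrite exprS -mulrA; apply: w3 pk => q; rewrite !mem_cat => /or3P[qk|/mem_scalec[r rk ->]|].
- apply: (@finel_le _ _ d); last by apply: (fk k.+1) => //; rewrite qk.
  by rewrite ler_peMl ?(ltW d0)// exprn_ege1// ler1n.
- apply: (@finel_le _ _ d); last by apply: (fk k.+1) => //; rewrite rk orbT.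
  by rewrite ler_peMl ?(ltW d0)// exprn_ege1// ler1n.
- move=> /mem_scalec[r /mem_faces[i [r' r'm ->]] ->]; apply: face_fine.
  by apply: IH3 r'm => j jk; apply: fk; exact: leqW.
Qed.

End ModelHomotopy.

(** The coarse model that replaces a simplex by the list of its vertices: values on it can be
    computed, and the model homotopy transfers them to other models. *)
Definition vmodel k : chain G (Sx k) := [:: (1, map (@vert k) (enum 'I_k.+1))].

Lemma del_enum k (i : 'I_k.+2) : take i (enum 'I_k.+2) ++ drop i.+1 (enum 'I_k.+2) =
  map (lift i) (enum 'I_k.+1).
Proof.
apply: (@eq_from_nth _ ord0) => [|a].
  rewrite size_cat size_take size_drop size_map !size_enum_ord ltn_ord subSS.
  by rewrite subnKC// -ltnS ltn_ord.
move=> ha; have ak : (a < k.+1)%N.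
  move: ha; rewrite size_cat size_take size_drop !size_enum_ord ltn_ord subSS.
  by rewrite subnKC// -ltnS ltn_ord.
rewrite nth_del [RHS](nth_map ord0) ?size_enum_ord//; apply: ord_inj => /=.
have b : (bump i a < k.+2)%N by rewrite /bump; lia.
by rewrite !nth_enum_ord.
Qed.

Lemma face_vert k (i : 'I_k.+2) (j : 'I_k.+1) : face i (vert j) = vert (lift i j).
Proof.
apply: val_inj; apply/rowP => a /=; rewrite !mxE.
case: unliftP => [b ->|->]; first by rewrite mxE (inj_eq lift_inj).
by rewrite (negPf (neq_lift _ _)).
Qed.

Lemma vmodelP : model vmodel.
Proof.
split=> [k p|F|k F].
- by rewrite inE => /eqP->; rewrite size_map size_enum_ord.
- by rewrite ev1 enum_ordSl (size0nil (size_enum_ord 0)) /= dc_cons dc_nil subr0.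
rewrite ev1 ev_faces dcE size_map size_enum_ord; apply: eq_bigr => i _.
rewrite ev1 -map_take -map_drop -map_cat del_enum -!map_comp.
by congr (_ * F _); apply: eq_map => j /=; rewrite face_vert.
Qed.

(** * An affine simplex around a point *)

Section Affine.
Variables (n : nat) (c : 'rV[R]_n) (r : R).
Hypothesis r0 : 0 < r.

(** Tail sums of barycentric coordinates descend from 1 to 0, and consecutive ones differ by a
    coordinate. [csum0] is their value at the barycenter, so that [aff] sends the barycenter to
    [c]. *)
Definition csum (t : Sx n) (j : nat) : R := \sum_(k < n.+1 | (j <= k)%N) val t 0 k.
Definition csum0 (j : nat) : R := 1 - j%:R / n.+1%:R.

Lemma csumS t (i : 'I_n.+1) : csum t i = val t 0 i + csum t i.+1.
Proof.
rewrite /csum (bigD1 i)//=; congr (_ + _); apply: eq_bigl => k.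
by rewrite ltn_neqAle andbC eq_sym.
Qed.

Lemma csum_first t : csum t 0 = 1.
Proof. by rewrite -(Sx_sum t); apply: eq_bigl => k. Qed.

Lemma csum_last t : csum t n.+1 = 0.
Proof. by rewrite /csum big1// => k; rewrite leqNgt ltn_ord. Qed.

Lemma csum01 t j : 0 <= csum t j <= 1.
Proof.
rewrite /csum sumr_ge0/=; last by move=> k _; exact: Sx_ge0.
rewrite -(Sx_sum t) [leRHS](bigID (fun k : 'I_n.+1 => (j <= k)%N))/= lerDl.
by rewrite sumr_ge0// => k _; exact: Sx_ge0.
Qed.

Lemma csum0S j : csum0 j = n.+1%:R^-1 + csum0 j.+1.
Proof.
have -> : csum0 j.+1 = 1 - (j%:R + 1) / n.+1%:R by rewrite /csum0 natr1.
by rewrite /csum0 mulrDl mul1r; ring.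
Qed.

Lemma csum001 j : (j <= n.+1)%N -> 0 <= csum0 j <= 1.
Proof.
move=> jn; rewrite /csum0 subr_ge0 ler_pdivrMr ?ltr0n// mul1r ler_nat jn/=.
by rewrite gerBl divr_ge0.
Qed.

Definition aff (t : Sx n) : 'rV[R]_n :=
  \row_j (c 0 j + r * (csum t j.+1 - csum0 j.+1)).

Lemma aff_ge t j : (c 0 j <= aff t 0 j) = (csum0 j.+1 <= csum t j.+1).
Proof. by rewrite mxE lerDl pmulr_rge0// subr_ge0. Qed.

Lemma aff_near t j : `|aff t 0 j - c 0 j| <= r.
Proof.
rewrite mxE addrAC subrr add0r normrM gtr0_norm// ler_piMr ?(ltW r0)//.
have /andP[? ?] := csum01 t j.+1; have /andP[? ?] : 0 <= csum0 j.+1 <= 1.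
  by apply: csum001; rewrite ltnS ltnW.
by rewrite ler_norml; apply/andP; split; lra.
Qed.

(** The label [i] puts the tail sums at [i] and [i.+1] weakly on opposite sides of their barycentric
    values, so coordinate [i] is at least [1 / n.+1]. Hence no point of the face opposite to vertex
    [i] is labelled [i]. *)
Lemma lbl_aff t i : lbl c (aff t) = i -> 0 < val t 0 i.
Proof.
move=> e; have n0 : 0 < n.+1%:R^-1 :> R by rewrite invr_gt0 ltr0n.
have h1 : csum0 i <= csum t i.
  case: (posnP i) => [->|i0]; first by rewrite csum_first /csum0 mul0r subr0.
  have i1n : (i.-1 < n)%N by have := ltn_ord i; lia.
  have := @ellp_before _ _ 1%g c (aff t) (Ordinal i1n).
  rewrite perm1 aff_ge /= prednK//; apply.
  by rewrite -/(lbl c (aff t)) e; lia.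
have h2 : csum t i.+1 <= csum0 i.+1.
  have [en|ni] := eqVneq (nat_of_ord i) n.
    by rewrite en csum_last /csum0 divff ?subrr// pnatr_eq0.
  have ln : (i < n)%N by have := ltn_ord i; lia.
  have := @ellp_at _ _ 1%g c (aff t) (Ordinal ln).
  rewrite perm1 ltNge aff_ge /= -ltNge => h; apply/ltW/h.
  by rewrite -/(lbl c (aff t)) e.
move: n0 h1 h2; rewrite csumS csum0S.
move: (n.+1%:R^-1) (csum0 _) (csum _ _) (val t 0 i) => q a b v; lra.
Qed.

Lemma aff_center t i : aff t = c -> 0 < val t 0 i.
Proof.
move=> e; have n0 : 0 < n.+1%:R^-1 :> R by rewrite invr_gt0 ltr0n.
have E j : (j <= n.+1)%N -> csum t j = csum0 j.
  case: j => [|j] jn; first by rewrite csum_first /csum0 mul0r subr0.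
  move: jn; rewrite ltnS leq_eqVlt => /orP[/eqP->|jn].
    by rewrite csum_last /csum0 divff ?subrr// pnatr_eq0.
  have := congr1 (fun x : 'rV_n => x 0 (Ordinal jn)) e; rewrite mxE /=.
  move=> /eqP; rewrite -subr_eq0 addrAC subrr add0r mulf_eq0 gt_eqF//= subr_eq0.
  by move=> /eqP.
have := csumS t i; rewrite (E i (ltnW (ltn_ord i))) (E i.+1 (ltn_ord i)) csum0S.
by move=> /addIr <-.
Qed.

Lemma csum_vert k j : csum (vert k) j = (j <= k)%N%:R.
Proof.
rewrite /csum /=; under eq_bigr do rewrite mxE.
have [jk|kj] := leqP j k.
  by rewrite (bigD1 k)//= eqxx big1 ?addr0// => i /andP[_ /negPf ->].
by rewrite big1// => i ji; case: eqP => // ik; move: kj; rewrite ltnNge -ik ji.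
Qed.

Lemma lbl_aff_vert k : lbl c (aff (vert k)) = k.
Proof.
have n0 : 0 < n.+1%:R^-1 :> R by rewrite invr_gt0 ltr0n.
apply: val_inj; apply: ellpP => [|j jk|j jk]; rewrite ?perm1.
- by rewrite -ltnS ltn_ord.
- rewrite aff_ge csum_vert jk; have /andP[] : 0 <= csum0 j.+1 <= 1; last by [].
  by apply: csum001; rewrite ltnS ltnW.
- rewrite ltNge aff_ge csum_vert jk ltnn -ltNge /csum0 subr_gt0.
  by rewrite ltr_pdivrMr ?ltr0n// mul1r ltr_nat ltnS -jk.
Qed.

(** On the model by vertices the labels are 0, ..., n. Any other model differs by a boundary, killed
    by the cocycle, and by lists in faces, each of which misses a label. *)
Lemma aff_theta kap : (0 < n)%N -> model kap ->
  ev (theta G c) (mapc aff (kap n)) = 1.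
Proof.
move=> n0 kapP; rewrite ev_mapc; pose F s := theta G c (map aff s).
have [_ /(_ F) + _] := mhomP kapP vmodelP (ltr01 : 0 < 1 :> R) n.
rewrite ev_0; last by move=> p _; rewrite -(dc_map aff) theta_dc.
have -> : ev F (mbd kap vmodel 1 n) = 0.
  apply: ev_0 => p pm; rewrite /F /theta.
  have [i hi] : exists i : 'I_n.+1, forall x, x \in p.2 -> val x 0 i = 0.
    move: pm; case: (n) n0 p {F} => // m _ p /mem_faces[i [q qm ->]].
    exists i => _ /mapP[x xq ->] /=.
    by rewrite mxE unlift_none.
  apply: (@psi_missing _ _ _ i); apply/negP => /mapP[_ /mapP[x xp ->]] /esym e.
  by have := lbl_aff e; rewrite hi// ltxx.
rewrite subr0 => /esym/subr0_eq ->; rewrite ev1 /F /theta /=.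
rewrite -[RHS](psi_enum G n); congr psi; set E := enum _; rewrite -2!map_comp.
by rewrite -[RHS]map_id; apply: eq_map => k /=; exact: lbl_aff_vert.
Qed.

End Affine.

End SimplexChains.

(** * Pairing cochains with singular chains *)

Section CompactUniform.
Variables (R : realType) (X : pseudoMetricType R).

(** The Lebesgue number principle, for properties that persist when [d] decreases. *)
Lemma compact_unif (A : set X) (P : R -> X -> Prop) : compact A ->
  (forall d d' x, 0 < d' -> d' <= d -> P d x -> P d' x) ->
  (forall x, A x -> exists2 d, 0 < d & forall x', A x' -> ball x d x' -> P d x') ->
  exists2 d, 0 < d & forall x, A x -> P d x.
Proof.
move=> /compact_near_coveringP cA Pm Ploc.
have := cA R 0^'+ (fun d x => A x -> P d x) _.
case=> [x Ax|e /= e0 eP].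
  have [d d0 dP] := Ploc _ Ax.
  exists (ball x d, [set e | 0 < e < d]) => /=.
    split; first exact: nbhsx_ballx.
    by near=> e; apply/andP; split; near: e; [exact: nbhs_right_gt | exact: nbhs_right_lt].
  move=> [x' e] /= [bx /andP[e0 ed]] Ax'; apply: Pm (dP _ Ax' bx) => //; exact: ltW.
exists (e / 2); first by rewrite divr_gt0.
move=> x Ax; apply: (eP (e / 2)) => //=; last by rewrite divr_gt0.
by rewrite sub0r normrN gtr0_norm ?divr_gt0// ltr_pdivrMr// ltr_pMr// ltr1n.
Unshelve. all: by end_near. Qed.

End CompactUniform.

Section Heine.
Variables (R : realType) (X Y : pseudoMetricType R).

Lemma heine (A : set X) (f : X -> Y) : compact A -> {within A, continuous f} ->
  forall e, 0 < e -> exists2 d, 0 < d &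
    forall x y, A x -> A y -> ball x d y -> ball (f x) e (f y).
Proof.
move=> cA cf e e0.
have [|x Ax|d d0 dP] := @compact_unif _ _ A
  (fun d x => forall y, A y -> ball x d y -> ball (f x) e (f y)) cA.
- by move=> d d' x d'0 dd h y Ay b; apply: h => //; exact: le_ball b.
- have /subspace_continuousP/(_ x Ax) fx := cf.
  have e20 : 0 < e / 2 by rewrite divr_gt0.
  have /nbhs_ballP[d /= d0 dP] : nbhs x [set y | A y -> ball (f x) (e / 2) (f y)].
    exact: (fx _ (nbhsx_ballx (f x) _ e20)).
  exists (d / 2) => [|x' Ax' bx' y Ay b]; first by rewrite divr_gt0.
  rewrite [e]splitr; apply: (@ball_triangle _ _ (f x)).
    by apply/ball_sym/dP => //; apply: le_ball bx'; rewrite ler_pdivrMr// ler_peMr ?ltW// ltr1n.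
  by apply: dP => //; rewrite [d]splitr; exact: ball_triangle bx' b.
by exists d => // x y Ax; exact: dP.
Qed.
End Heine.

Section SingularToVietoris.
Variables (R : realType) (M : pseudoMetricType R) (G : comNzRingType).
Local Notation Sx k := (stdsimplex R k).
Local Notation schain n := (schain R M G n).
Local Notation sch A n := (@sing_chains R M G A n).

Lemma stdsimplex_compact n : compact (Sx n).
Proof.
have cB : compact [set t : 'rV[R]_n.+1 | forall i, `[0, 1]%classic (t 0 i)].
  by apply: (@rV_compact R n.+1 (fun=> `[0, 1]%classic)) => i; exact: segment_compact.
apply: subclosed_compact cB _; last first.
  move=> t tS i; have := Sx_le1 (exist _ t (mem_set tS)) i.
  have := Sx_ge0 (exist _ t (mem_set tS)) i.
  by rewrite /= in_itv/= => -> ->.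
have cc (i : 'I_n.+1) : continuous (fun t : 'rV[R]_n.+1 => t 0 i).
  by move=> t; exact: coord_continuous.
have -> : Sx n = (\bigcap_(i in [set: 'I_n.+1]) [set t | 0 <= t 0 i]) `&`
   [set t | \sum_i t 0 i = 1].
  apply/seteqP; split=> [t [t0 t1]|t [t0 t1]]; split=> // i; first by move=> _; exact: t0.
  exact: t0.
apply: closedI.
  apply: closed_bigI => i _; apply: (@closed_comp _ _ (fun t : 'rV_n.+1 => t 0 i) [set x : R | 0 <= x]).
    by move=> t _; exact: cc.
  exact: closed_ge.
apply: (@closed_comp _ _ (fun t : 'rV_n.+1 => \sum_i t 0 i) [set x : R | x = 1]).
  move=> t _; apply: (@continuous_big R _ +%R 0 xpredT (@add_continuous R^o)
    _ _ (fun i (t : 'rV[R]_n.+1) => t 0 i)) => i _.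
  exact: cc.
exact: closed_eq.
Qed.

Lemma singular_unif n (s : Sx n -> M) e : continuous s -> 0 < e ->
  exists2 d, 0 < d & forall l, sfine d l -> finel e (map s l).
Proof.
move=> cs e0.
have [|x xS|d d0 dP] := @compact_unif _ _ (Sx n)
  (fun d x => forall u v : Sx n, val u = x -> ball x d (val v) -> ball (s u) e (s v))
  (@stdsimplex_compact n).
- by move=> d d' x d'0 dd h u v ux b; apply: h => //; exact: le_ball b.
- pose x' : Sx n := exist _ x (mem_set xS).
  have e20 : 0 < e / 2 by rewrite divr_gt0.
  have /nbhs_ballP[d /= d0 dP] := cs x' _ (nbhsx_ballx (s x') _ e20).
  have bE (u : Sx n) : ball x d (val u) -> ball (s x') (e / 2) (s u).
    by move=> b; apply: dP; rewrite -initial_ballE.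
  exists (d / 2) => [|y Sy bx u v uy b]; first by rewrite divr_gt0.
  rewrite [e]splitr; apply: (@ball_triangle _ _ (s x')).
    have {}bx : ball x (d / 2) (val u) by exact: (eq_ind_r (fun z => ball x (d / 2) z) bx uy).
    apply/ball_sym/bE; apply: le_ball bx.
    by rewrite ler_pdivrMr// ler_peMr ?ltW// ltr1n.
  by apply: bE; rewrite [d]splitr; apply: ball_triangle bx _.
exists d => // l /sfineP fl _ _ /mapP[u ul ->] /mapP[v vl ->].
by apply: (dP (val u)) => //; [exact: set_mem (valP u) | exact: fl].
Qed.

Definition ssupp n (c : schain n) : seq (Sx n -> M) :=
  finmap.enum_fset (fset_set [set s | c s != 0]).

Lemma mem_ssuppE n (c : schain n) s : finite_set [set s | c s != 0] ->
  (s \in ssupp c) = (c s != 0).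
Proof.
move=> fc; transitivity (s \in [set s | c s != 0]); first exact: in_fset_set.
by apply/idP/idP; rewrite inE.
Qed.

(** With [z] a model of the identity simplex, this is the natural map from singular to Vietoris
    chains. *)
Definition singV n (z : chain G (Sx n)) (c : schain n) : chain G M :=
  flatten [seq scalec (c s) (mapc s z) | s <- ssupp c].

Lemma mem_ssupp A n (c : schain n) s : c \in sch A n -> s \in ssupp c ->
  c s != 0 /\ continuous s /\ range s `<=` A.
Proof.
rewrite unfold_in => /asboolP[fc cA]; rewrite mem_ssuppE// => cs.
by split=> //; exact: cA.
Qed.

Lemma ev_singV n z (c : schain n) F :
  ev F (singV z c) = \sum_(s <- ssupp c) c s * ev (fun l => F (map s l)) z.
Proof.
rewrite /ev /singV big_flatten/= big_map; apply: eq_bigr => s _.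
by rewrite -/(ev F _) ev_scale ev_mapc.
Qed.

Lemma ssupp_widen A n (c : schain n) (L : seq (Sx n -> M)) (Q : (Sx n -> M) -> G) :
  c \in sch A n -> uniq L -> (forall s, c s != 0 -> s \in L) ->
  \sum_(s <- ssupp c) c s * Q s = \sum_(s <- L) c s * Q s.
Proof.
rewrite unfold_in => /asboolP[fc _] uL cL.
rewrite [RHS](bigID (fun s => c s != 0))/= [X in _ + X]big1 ?addr0; last first.
  by move=> s /negPn/eqP ->; rewrite mul0r.
rewrite -[RHS]big_filter; apply: perm_big; apply: uniq_perm; rewrite ?filter_uniq//.
  exact: finmap.fset_uniq.
move=> s; rewrite mem_ssuppE// mem_filter.
by apply/idP/andP => [cs|[]//]; split=> //; exact: cL.
Qed.

Lemma ev_singV_lin A n z (c c' : schain n) a F :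
  c \in sch A n -> c' \in sch A n ->
  ev F (singV z (a *: c + c')) = a * ev F (singV z c) + ev F (singV z c').
Proof.
move=> cA c'A; have ccA : a *: c + c' \in sch A n by rewrite rpredD// rpredZ.
pose L := undup (ssupp c ++ ssupp c').
have sL (b : schain n) : b \in sch A n -> forall s, b s != 0 -> s \in ssupp b.
  by rewrite unfold_in => /asboolP[fb _] s bs; rewrite mem_ssuppE.
have L1 s : c s != 0 -> s \in L.
  by move=> cs; rewrite mem_undup mem_cat (sL _ cA _ cs).
have L2 s : c' s != 0 -> s \in L.
  by move=> cs; rewrite mem_undup mem_cat (sL _ c'A _ cs) orbT.
have L3 s : (a *: c + c') s != 0 -> s \in L.
  rewrite schain_linE; have [c0|/L1//] := eqVneq (c s) 0.
  by rewrite c0 mulr0 add0r => /L2.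
rewrite !ev_singV (ssupp_widen _ ccA (undup_uniq _) L3).
rewrite (ssupp_widen _ cA (undup_uniq _) L1) (ssupp_widen _ c'A (undup_uniq _) L2).
rewrite mulr_sumr -big_split; apply: eq_bigr => s _ /=.
by rewrite schain_linE mulrDl mulrA.
Qed.

Lemma face_continuous n (i : 'I_n.+2) : continuous (@face R n i).
Proof.
move=> x U /nbhs_ballP[e /= e0 eU]; apply/nbhs_ballP; exists e => //= y.
rewrite -initial_ballE => b; apply: eU; rewrite -initial_ballE.
have [_ b'] := rV_ballE b; apply: rV_ballI => // j.
rewrite !mxE; case: unliftP => [k _|_]; first exact: b'.
by rewrite subr0 normr0.
Qed.

Lemma sboundary_supp n (c : schain n.+1) (L := ssupp c)
    (L' := undup [seq s \o @face R n i | s <- L, i <- enum 'I_n.+2]) : c \in sch setT n.+1 ->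
  [/\ forall t, sboundary c t = \sum_(i < n.+2) (-1) ^+ i *
        \sum_(s <- L | ((s : Sx n.+1 -> M) \o @face R n i : Sx n -> M) == t) c s,
      forall t, sboundary c t != 0 -> t \in L' & sboundary c \in sch setT n].
Proof.
move=> cT; have := cT; rewrite unfold_in => /asboolP[fc _].
have bdE t : sboundary c t = \sum_(i < n.+2) (-1) ^+ i * \sum_(s <- L | ((s : Sx n.+1 -> M) \o @face R n i : Sx n -> M) == t) c s.
  apply: eq_bigr => i _; congr (_ * _).
  pose L0 := [seq s <- L | ((s : Sx n.+1 -> M) \o @face R n i : Sx n -> M) == t].
  have uL0 : uniq L0 by rewrite filter_uniq// finmap.fset_uniq.
  rewrite -[RHS]big_filter (fsbig_seq _ _ uL0); apply/esym/fsbig_widen.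
    by move=> s /=; rewrite mem_filter => /andP[/eqP].
  move=> s [/= st sL0]; apply/eqP/negPn/negP => cs; apply: sL0 => /=.
  by rewrite mem_filter st eqxx mem_ssuppE.
have L'P t : sboundary c t != 0 -> t \in L'.
  apply: contraNT => tL'; rewrite bdE big1// => i _; rewrite big1_seq ?mulr0// => s /andP[/eqP st sL].
  by case/negP: tL'; rewrite mem_undup; apply/allpairsP; exists (s, i); split; rewrite ?mem_enum.
have bdS : sboundary c \in sch setT n.
  have cf := cT; rewrite unfold_in; apply/asboolP; split.
    by apply: (@sub_finite_set _ _ [set` L']) => //; exact: L'P.
  move=> t /L'P; rewrite mem_undup => /allpairsP[[s i] [sL _ ->]] /=; split=> //.
  have [_ [cs _]] := mem_ssupp cT sL.
  move=> x; apply: (@continuous_comp _ _ _ (face i) s); last exact: cs.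
  exact: face_continuous.
by split.
Qed.

Lemma ev_singV_faces n z (c : schain n.+1) F : c \in sch setT n.+1 ->
  ev F (singV (faces z) c) = ev F (singV z (sboundary c)).
Proof.
move=> cT; have [bdE L'P bdS] := sboundary_supp cT.
pose L := ssupp c; pose L' := undup [seq s \o @face R n i | s <- L, i <- enum 'I_n.+2].
rewrite ev_singV -/L.
rewrite ev_singV (ssupp_widen _ bdS (undup_uniq _) L'P).
transitivity (\sum_(s <- L) \sum_(i < n.+2) c s * ((-1) ^+ i * ev (fun l => F (map (s \o face i) l)) z)).
  apply: eq_bigr => s _; rewrite -mulr_sumr; congr (_ * _).
  rewrite ev_faces; apply: eq_bigr => i _; congr (_ * _).
  by apply: eq_ev => l; rewrite map_comp.
pose Q t := ev (fun l => F (map t l)) z.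
transitivity (\sum_(t <- L') \sum_(i < n.+2) \sum_(s <- L | ((s : Sx n.+1 -> M) \o @face R n i : Sx n -> M) == t) c s * ((-1) ^+ i * Q t)); last first.
  apply: eq_bigr => t _; rewrite bdE mulr_suml; apply: eq_bigr => i _.
  by rewrite -mulr_suml mulrCA mulrA.
rewrite [RHS]exchange_big [LHS]exchange_big; apply: eq_bigr => i _ /=.
under [RHS]eq_bigr do rewrite big_mkcond.
rewrite [RHS]exchange_big/=; apply: eq_big_seq => s sL.
rewrite (bigD1_seq (s \o @face R n i : Sx n -> M)) ?undup_uniq//=; last first.
  by rewrite mem_undup; apply/allpairsP; exists (s, i); split; rewrite ?mem_enum.
by rewrite eqxx big1 ?addr0// => t /negPf; rewrite eq_sym => ->.
Qed.

Lemma ev_singV_bd kap n (c : schain n.+1) F : model kap -> c \in sch setT n.+1 ->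
  ev (dc F) (singV (kap n.+1) c) = ev F (singV (kap n) (sboundary c)).
Proof.
move=> [_ _ kS] cT; rewrite -ev_singV_faces// !ev_singV; apply: eq_bigr => s _.
rewrite -kS; congr (_ * _).
by apply: eq_ev => l; rewrite dc_map.
Qed.

Lemma mem_singV n z (c : schain n) p : p \in singV z c ->
  exists2 s, s \in ssupp c & exists2 q, q \in z & p.2 = map s q.2.
Proof.
move=> /flattenP[l /mapP[s sc ->]] /mem_scalec[q /mem_mapc[r rz e] ->].
by exists s => //; exists r.
Qed.

Lemma seq_unif (T : eqType) (L : seq T) (P : R -> T -> Prop) :
  (forall d d' x, 0 < d' -> d' <= d -> P d x -> P d' x) ->
  (forall x, x \in L -> exists2 d, 0 < d & P d x) ->
  exists2 d, 0 < d & forall x, x \in L -> P d x.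
Proof.
move=> Pm; elim: L => [|x L IH] PL; first by exists 1.
have [|d d0 dP] := IH; first by move=> y yL; apply: PL; rewrite inE yL orbT.
have [d' d'0 d'P] := PL x (mem_head _ _).
exists (Num.min d d') => [|y]; first by rewrite lt_min d0.
rewrite inE => /orP[/eqP->|/dP].
  by apply: Pm d'P; rewrite ?lt_min ?d0// ge_min lexx orbT.
by apply: Pm; rewrite ?lt_min ?d0// ge_min lexx.
Qed.

Lemma chain_unif n (c : schain n) e : c \in sch setT n -> 0 < e ->
  exists2 d, 0 < d & forall s, s \in ssupp c -> forall l, sfine d l -> finel e (map s l).
Proof.
move=> cT e0; apply: (@seq_unif _ (ssupp c) (fun d s => forall l, sfine d l -> finel e (map s l))).
  by move=> d d' s _ dd h l fl; apply: h; exact: finel_le fl.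
by move=> s /(mem_ssupp cT)[_ [cs _]]; exact: singular_unif.
Qed.

(** A cocycle supported at [x] is known to vanish only outside balls, so a chain that avoids [x] has
    to avoid a ball; it does because its finitely many simplices are compact. *)
Lemma chain_dist n (c : schain n) (x : M) : hausdorff_space M ->
  c \in sch (~` [set x]) n -> exists2 r, 0 < r & c \in sch (~` ball x r) n.
Proof.
move=> hM cA.
have [|r r0 rP] := @seq_unif _ (ssupp c) (fun r s => range s `<=` ~` ball x r)
   (fun d d' s _ dd h => subset_trans h (subsetC (le_ball dd))); last first.
  exists r => //; move: (cA); rewrite !unfold_in => /asboolP[fc cP]; apply/asboolP.
  split=> // s cs; have [cs' _] := cP s cs; split=> //; apply: rP.
  by rewrite mem_ssuppE.
move=> s /(mem_ssupp cA)[_ [cs sA]].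
have [|t tS|d d0 dP] := @compact_unif _ _ (Sx n)
  (fun d t => forall u : Sx n, val u = t -> ~ ball x d (s u)) (@stdsimplex_compact n).
- by move=> d d' t _ dd h u ut b; apply: (h u ut); exact: le_ball b.
- pose t' : Sx n := exist _ t (mem_set tS).
  have xs : x != s t'.
    by apply/eqP => e; have := sA (s t') (ex_intro2 _ _ t' I erefl); rewrite -e; exact.
  have [d d0 dP] : exists2 d, 0 < d & ~ ball x d (s t').
    apply: contrapT => nd; case/eqP: xs; apply: hM => U V /nbhs_ballP[a /= a0 aU] Vs.
    exists (s t'); split; last exact: nbhs_singleton.
    by apply: aU; apply: contrapT => nb; apply: nd; exists a.
  have d20 : 0 < d / 2 by rewrite divr_gt0.
  have /nbhs_ballP[a /= a0 aP] := cs t' _ (nbhsx_ballx (s t') _ d20).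
  exists (Num.min a (d / 2)); first by rewrite lt_min a0.
  move=> y Sy b u uy bx; apply: dP; rewrite [d]splitr; apply: (@ball_triangle _ _ (s u)).
    by apply: le_ball bx; rewrite ge_min lexx orbT.
  apply: ball_sym; apply: aP; rewrite -initial_ballE.
  have {}b : ball t (Num.min a (d / 2)) (val u) by exact: (eq_ind_r (fun z => ball t _ z) b uy).
  by apply: le_ball b; rewrite ge_min lexx.
by exists d => // _ [u _ <-] b; apply: (dP (val u) _ u) => //; exact: set_mem (valP u).
Qed.

(** The homotopy between the models changes the value by [dc F], which vanishes on fine lists, and
    by [F] on lists carried by the boundary of [m], hence by [B]. The factor [2 ^+ n.+2] is the loss
    of mesh in the homotopy. *)
Lemma singV_coherent n (m : schain n.+1) F e (B : set M) kap kap' d :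
  m \in sch setT n.+1 -> sboundary m \in sch B n -> model kap -> model kap' -> 0 < d ->
  (forall k, (k <= n.+1)%N -> forall p, (p \in kap k) || (p \in kap' k) -> sfine d p.2) ->
  (forall s, s \in ssupp m -> forall l, sfine (2 ^+ n.+2 * d) l -> finel e (map s l)) ->
  (forall s, s \in ssupp (sboundary m) -> forall l, sfine (2 ^+ n.+2 * d) l -> finel e (map s l)) ->
  (forall s, finel e s -> dc F s = 0) ->
  (forall s, finel e s -> (forall x, x \in s -> B x) -> F s = 0) ->
  ev F (singV (kap n.+1) m) = ev F (singV (kap' n.+1) m).
Proof.
move=> mT bB kapP kap'P d0 fk fm fbm Fd FB.
have [h1 h2 h3] := mhomP kapP kap'P d0 n.+1.
have [h1' h2' h3'] := mhomP kapP kap'P d0 n.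
have E s : s \in ssupp m -> ev (fun l => F (map s l)) (kap n.+1) - ev (fun l => F (map s l)) (kap' n.+1)
    = ev (fun l => F (map s l)) (faces (mhom kap kap' d n)).
  move=> sm; apply/subr0_eq.
  rewrite -[X in _ - X]/(ev _ (mbd kap kap' d n.+1)) -h2 ev_0// => p pm.
  by rewrite -(dc_map s) Fd//; apply: fm => //; exact: h3 pm.
apply/subr0_eq; transitivity (ev F (singV (faces (mhom kap kap' d n)) m)).
  rewrite !ev_singV -sumrB; apply: eq_big_seq => s sm.
  by rewrite -E// mulrBr.
rewrite ev_singV_faces//; apply: ev_0 => p /mem_singV[s sm [q qz ->]].
apply: FB.
  apply: fbm => //; have := h3' (fun j jn => fk j (leqW jn)) q qz.
  by apply: finel_le; rewrite ler_pM2r// ler_weXn2l// ler1n.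
move=> _ /mapP[t _ ->]; have [_ [_]] := mem_ssupp bB sm; apply.
by exists t.
Qed.

End SingularToVietoris.

(** * Evaluation on relative singular cycles *)

Section Pairing.
Variables (R : realType) (M : pseudoMetricType R) (G : comNzRingType) (n : nat).
Hypothesis hM : hausdorff_space M.
Local Notation Sx k := (stdsimplex R k).
Local Notation schain n := (schain R M G n).
Local Notation sch A n := (@sing_chains R M G A n).
Local Notation N := n.+1.
Implicit Types (m : schain N) (F : seq M -> G) (y : M).

(** A representative of a class with support at [y]: the fineness at which [F] vanishes may depend
    on the distance [r] from [y]. *)
Definition local_cocycle y F : Prop :=
  (exists2 e, 0 < e & forall s, finel e s -> dc F s = 0) /\
  forall r, 0 < r -> exists2 e, 0 < e &
    forall s, finel e s -> (forall x, x \in s -> ~ ball y r x) -> F s = 0.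

(** Dimension [n.+2] is included because boundaries of chains of that dimension are evaluated as
    well. *)
Definition fine_model (d : R) (kap : forall k, chain G (Sx k)) : Prop :=
  model kap /\ forall k, (k <= n.+2)%N -> forall p, p \in kap k -> sfine d p.2.

Lemma fine_model_le d d' kap : d' <= d -> fine_model d' kap -> fine_model d kap.
Proof.
by move=> dd [mk fk]; split=> // k kn p pk; apply: finel_le (fk k kn p pk).
Qed.

Lemma fine_model_exists d : 0 < d -> exists kap, fine_model d kap.
Proof.
move=> d0; have d0' : 0 < d / 2 ^+ n.+2 by rewrite divr_gt0// exprn_gt0.
have [mk fk] := @kappaP R G _ d0'; exists (kappa G (d / 2 ^+ n.+2)); split=> // k kn p pk.
apply: finel_le (fk k p pk); rewrite mulrC -mulrA ler_piMr ?(ltW d0)//.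
by rewrite mulrC ler_pdivrMr ?exprn_gt0// mul1r ler_weXn2l// ler1n.
Qed.

(* The value of a cochain on a singular cycle, computed on any sufficiently fine
   Vietoris approximation of the cycle. *)
Definition pairs F m (v : G) : Prop := exists2 d, 0 < d &
  forall kap, fine_model d kap -> ev F (singV (kap N) m) = v.

Lemma pairs_uniq F m v v' : pairs F m v -> pairs F m v' -> v = v'.
Proof.
move=> [d d0 dP] [d' d'0 d'P].
have mm : 0 < Num.min d d' by rewrite lt_min d0.
have [kap fk] := fine_model_exists mm.
rewrite -(dP kap) ?(d'P kap)//; apply: fine_model_le fk; rewrite ge_min lexx ?orbT//.
Qed.

Lemma pairs_lin A F m m' a v v' : m \in sch A N -> m' \in sch A N ->
  pairs F m v -> pairs F m' v' -> pairs F (a *: m + m') (a * v + v').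
Proof.
move=> mA m'A [d d0 dP] [d' d'0 d'P].
exists (Num.min d d') => [|kap fk]; first by rewrite lt_min d0.
rewrite (ev_singV_lin _ _ _ mA m'A) dP ?d'P//; apply: fine_model_le fk.
  by rewrite ge_min lexx orbT.
by rewrite ge_min lexx.
Qed.

(** [pairs] only asserts that some fineness works; here an explicit one does, determined by the
    simplices of [m] and the fineness of [F]. *)
Lemma pairs_at F m v e B d : pairs F m v ->
  m \in sch setT N -> sboundary m \in sch B n -> 0 < d ->
  (forall s, s \in ssupp m -> forall l, sfine (2 ^+ n.+2 * d) l -> finel e (map s l)) ->
  (forall s, s \in ssupp (sboundary m) -> forall l, sfine (2 ^+ n.+2 * d) l -> finel e (map s l)) ->
  (forall s, finel e s -> dc F s = 0) ->
  (forall s, finel e s -> (forall x, x \in s -> B x) -> F s = 0) ->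
  forall kap, fine_model d kap -> ev F (singV (kap N) m) = v.
Proof.
move=> [d' d'0 d'P] mT bB d0 fm fbm Fd FB kap [mk fk].
have mm : 0 < Num.min d d' by rewrite lt_min d0.
have [kap' [mk' fk']] := fine_model_exists mm.
rewrite -(d'P kap'); last first.
  by apply: fine_model_le (conj mk' fk'); rewrite ge_min lexx orbT.
apply: (singV_coherent mT bB mk mk' d0 _ fm fbm Fd FB) => k kn p /orP[pk|pk].
  by apply: fk pk; exact: leqW.
by apply: finel_le (fk' k (leqW kn) p pk); rewrite ge_min lexx.
Qed.

Lemma local_cocycle_at y F r : local_cocycle y F -> 0 < r -> exists2 e, 0 < e &
  (forall s, finel e s -> dc F s = 0) /\
  forall s, finel e s -> (forall x, x \in s -> ~ ball y r x) -> F s = 0.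
Proof.
move=> [[e e0 eP] h] r0; have [e' e'0 e'P] := h _ r0.
exists (Num.min e e'); first by rewrite lt_min e0.
split=> s fs; [apply: eP | apply: e'P]; apply: finel_le fs; rewrite ge_min lexx ?orbT//.
Qed.

Lemma pairs_exists y F m : local_cocycle y F -> m \in sch setT N ->
  sboundary m \in sch (~` [set y]) n -> exists v, pairs F m v.
Proof.
move=> Fy mT bm; have [r r0 br] := chain_dist hM bm.
have [e e0 [Fd Fr]] := local_cocycle_at Fy r0.
have bT : sboundary m \in sch setT n by apply: sing_chains_sub bm.
have [d1 d10 f1] := chain_unif mT e0; have [d2 d20 f2] := chain_unif bT e0.
pose d := Num.min d1 d2 / 2 ^+ n.+2.
have d0 : 0 < d by rewrite divr_gt0 ?exprn_gt0// lt_min d10.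
have d12 : 2 ^+ n.+2 * d = Num.min d1 d2 by rewrite mulrC divfK// gt_eqF ?exprn_gt0.
have [kap [mk fk]] := fine_model_exists d0.
exists (ev F (singV (kap N) m)), d => // kap' [mk' fk'].
apply: (@singV_coherent _ _ _ _ m F e (~` ball y r) kap' kap d) => //.
- by move=> k kn p /orP[pk|pk]; [apply: fk' pk | apply: fk pk]; exact: leqW.
- by move=> s sm l fl; apply: f1 => //; apply: finel_le fl; rewrite d12 ge_min lexx.
- by move=> s sm l fl; apply: f2 => //; apply: finel_le fl; rewrite d12 ge_min lexx orbT.
Qed.

Lemma pairs_bound y F m : local_cocycle y F ->
  m \in @rel_bound R M G (~` [set y]) N -> m \in sch setT N -> pairs F m 0.
Proof.
move=> Fy; rewrite unfold_in => /asboolP[c cT aA] mT.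
have [_ _ bcT] := sboundary_supp cT.
have [r r0 br] := chain_dist hM aA.
have [e e0 [Fd Fr]] := local_cocycle_at Fy r0.
have aT : m - sboundary c \in sch setT N by apply: sing_chains_sub aA.
have [d1 d10 f1] := chain_unif cT e0; have [d2 d20 f2] := chain_unif aT e0.
exists (Num.min d1 d2) => [|kap [mk fk]]; first by rewrite lt_min d10.
have -> : m = 1 *: (m - sboundary c) + sboundary c by rewrite scale1r subrK.
rewrite (ev_singV_lin _ _ _ aT bcT) mul1r -ev_singV_bd// !ev_0 ?addr0//.
- move=> p /mem_singV[s sc [q qk ->]]; apply: Fd; apply: f1 => //.
  by apply: finel_le (fk n.+2 (leqnn _) q qk); rewrite ge_min lexx.
- move=> p /mem_singV[s sc [q qk ->]]; apply: Fr.
    apply: f2 => //; apply: finel_le (fk N (leqnSn _) q qk).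
    by rewrite ge_min lexx orbT.
  move=> _ /mapP[t _ ->]; have [_ [_]] := mem_ssupp br sc; apply.
  by exists t.
Qed.

Lemma pairs_congr y F m m' v : local_cocycle y F -> m \in sch setT N -> m' \in sch setT N ->
  m - m' \in @rel_bound R M G (~` [set y]) N -> pairs F m' v -> pairs F m v.
Proof.
move=> Fy mT m'T mm' pv.
have -> : m = 1 *: (m - m') + m' by rewrite scale1r subrK.
have -> : v = 1 * 0 + v by rewrite mulr0 add0r.
have bT : m - m' \in sch setT N by rewrite rpredB.
exact: pairs_lin bT m'T (pairs_bound Fy mm' bT) pv.
Qed.

Lemma rel_cycleE A m : m \in @rel_cycle R M G A N ->
  m \in sch setT N /\ sboundary m \in sch A n.
Proof. by move=> /andP. Qed.

Lemma subquot_class0 (V : lmodType G) (Z B : submodClosed V) (Z0 : 0 \in Z) :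
  subquot_class B Z0 = 0.
Proof.
have h : (-1) *: 0 + 0 \in Z by rewrite scaler0 addr0.
have e := @subquot_class_linear _ _ Z B (-1) 0 0 Z0 Z0 h.
rewrite (scaleN1r (subquot_class B Z0)) (addNr (subquot_class B Z0)) in e.
by rewrite -[RHS]e; apply/subquot_classP; rewrite scaler0 addr0 subrr rpred0.
Qed.

Lemma subquot_class_scale (V : lmodType G) (Z B : submodClosed V) (a : G) (z : V)
  (zZ : z \in Z) (azZ : a *: z \in Z) :
  subquot_class B azZ = a *: subquot_class B zZ.
Proof.
have Z0 : 0 \in Z by exact: rpred0.
have h : a *: z + 0 \in Z by rewrite addr0.
rewrite -[RHS]addr0 -(subquot_class0 B Z0) -(subquot_class_linear B zZ Z0 h).
by apply/subquot_classP; rewrite addr0 subrr rpred0.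
Qed.

Lemma subquot_repr_scale (V : lmodType G) (Z B : submodClosed V) (a : G)
  (x : subquot Z B) (z : V) (zZ : z \in Z) :
  subquot_class B zZ = a *: x -> z - a *: subquot_repr x \in B.
Proof.
have arZ : a *: subquot_repr x \in Z by apply: rpredZ; exact: subquot_reprP.
move=> e; apply/(subquot_classP _ zZ arZ); rewrite (subquot_class_scale B (subquot_reprP x) arZ) (subquot_classK x).
exact: e.
Qed.

(** A cycle of value 1 is a multiple of the generator modulo boundaries, so the value of the
    generator divides 1. *)
Lemma generator_pairs_neq0 y (mu : sing_homology R G (~` [set y]) N) F m v :
  local_generator mu -> local_cocycle y F ->
  m \in @rel_cycle R M G (~` [set y]) N -> pairs F m 1 ->
  pairs F (subquot_repr mu) v -> v != 0.
Proof.
move=> gen Fy mZ m1 muv; have [a ea] := gen (subquot_class _ mZ).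
have muZ := subquot_reprP mu.
have amuZ : a *: subquot_repr mu \in @rel_cycle R M G (~` [set y]) N by exact: rpredZ.
have mb := subquot_repr_scale ea.
have [mT _] := rel_cycleE mZ; have [muT _] := rel_cycleE muZ.
have [amuT _] := rel_cycleE amuZ.
have pav : pairs F (a *: subquot_repr mu) (a * v).
  rewrite -[_ *: _]addr0 -[_ * _]addr0; apply: (pairs_lin _ muT _ muv); first exact: rpred0.
  exists 1 => // kap _; rewrite /singV ev_0// => p /mem_singV[s].
  by rewrite mem_ssuppE ?eqxx// (_ : [set _ | _] = set0)//; apply/seteqP; split=> t //=; rewrite eqxx.
apply/eqP => v0; have := pairs_uniq m1 (pairs_congr Fy mT amuT mb pav).
by rewrite v0 mulr0 => /eqP; rewrite oner_eq0.
Qed.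

End Pairing.

(** * Charts *)

Section Charts.
Variables (R : realType) (M : metricType R) (n : nat).
Local Notation N := n.+1.
Local Notation V := 'rV[R]_N.

Definition cball (c : V) (r : R) : set V := [set v | forall i, `|v 0 i - c 0 i| <= r].

Lemma cball_compact c r : compact (cball c r).
Proof.
have -> : cball c r = [set v : V | forall i, `[c 0 i - r, c 0 i + r]%classic (v 0 i)].
  apply/seteqP; split=> v h i; have := h i; rewrite /= in_itv/= ler_norml; move=> /andP[? ?].
    by apply/andP; split; lra.
  by apply/andP; split; lra.
by apply: (@rV_compact R N (fun i => `[c 0 i - r, c 0 i + r]%classic)) => i; exact: segment_compact.
Qed.

Lemma ball_cball c r v : ball c r v -> cball c r v.
Proof. by move=> /rV_ballE[_ h] i; rewrite distrC ltW. Qed.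
Lemma cball_ball c r r' v : r < r' -> 0 < r' -> cball c r v -> ball c r' v.
Proof. by move=> rr r0 h; apply: rV_ballI => // i; rewrite distrC (le_lt_trans (h i)). Qed.
Lemma cball_le c r r' v : r <= r' -> cball c r v -> cball c r' v.
Proof. by move=> rr h i; exact: le_trans (h i) rr. Qed.
Lemma cball_add c r r' v w : cball c r v -> ball v r' w -> cball c (r + r') w.
Proof.
move=> h /rV_ballE[_ b] i; have := h i; have := b i.
by rewrite ltr_norml !ler_norml => /andP[? ?] /andP[? ?]; apply/andP; split; lra.
Qed.

Lemma rV_ball_open c r : open (ball c r : set V).
Proof.
rewrite openE => v /rV_ballE[r0 h]; apply/nbhs_ballP.
pose m := \big[Num.min/r]_(i < N) (r - `|c 0 i - v 0 i|).
have m0 : 0 < m by rewrite /m; elim/big_ind: _ => // [a b a0 b0|i _]; rewrite ?lt_min ?a0 ?subr_gt0.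
exists m => // w /rV_ballE[_ b]; apply: rV_ballI => // i.
have mi : m <= r - `|c 0 i - v 0 i| by exact: bigmin_le_cond.
have := b i; have := ler_distD (v 0 i) (c 0 i) (w 0 i).
move: mi; lra.
Qed.

Definition is_chart (f : M -> V) (g : V -> M) (c : V) (r : R) : Prop :=
  [/\ 0 < r, forall v, cball c (4 * r) v -> f (g v) = v,
      {within cball c (4 * r), continuous g},
      {within g @` cball c (4 * r), continuous f} &
      forall a, 0 < a -> a <= 4 * r -> open (g @` ball c a)].

Lemma chart_exists (x : M) (O : set M) : locally_euclidean R M N -> nbhs x O ->
  exists f g c r, [/\ is_chart f g c r, g c = x & g @` cball c (4 * r) `<=` O].
Proof.
move=> lE Ox; have [U [W [f [g [[oU Ux] oW [cf cg] fW gU]]]]] := lE x.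
have [Wfx gfx] := fW _ Ux.
have gO : nbhs (f x) [set v | W v -> O (g v)].
  have Ogfx : nbhs (g (f x)) O by rewrite gfx.
  have /subspace_continuousP/(_ _ Wfx) cgx := cg.
  exact: cgx Ogfx.
have /nbhs_ballP[e /= e0 eP] : nbhs (f x) (W `&` [set v | W v -> O (g v)]).
  by apply: filterI => //; exact: open_nbhs_nbhs.
have e80 : 0 < e / 8 by rewrite divr_gt0.
have cW v : cball (f x) (4 * (e / 8)) v -> W v /\ O (g v).
  move=> h; have [|Wv] := eP v; last by move=> /(_ Wv).
  by apply: cball_ball h => //; lra.
exists f, g, (f x), (e / 8); split=> //; last by move=> _ [v /cW[_ Ov] <-].
split=> //.
- by move=> v /cW[/gU[]].
- by apply: continuous_subspaceW cg => v /cW[].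
- by apply: continuous_subspaceW cf => _ [v /cW[/gU[Ugv _] _] <-].
- move=> a a0 a4; have -> : g @` ball (f x) a = U `&` f @^-1` ball (f x) a.
    apply/seteqP; split=> [_ [v bv <-]|y [Uy by_]].
      have [Wv _] : W v /\ O (g v) by apply: cW; apply: cball_le a4 _; exact: ball_cball.
      by have [Ug fg] := gU _ Wv; split=> //=; rewrite fg.
    by exists (f y) => //; have [] := fW _ Uy.
  have cf' : {in U, continuous f} by rewrite -continuous_open_subspace.
  by apply: (continuous_inP f oU).1 => //; exact: rV_ball_open.
Qed.

Section OneChart.
Variables (f : M -> V) (g : V -> M) (c : V) (r : R).
Hypothesis fgP : is_chart f g c r.

Definition cdom : set M := g @` cball c (4 * r).
Definition cdisc (a : R) : set M := g @` cball c a.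

Let r0 : 0 < r. Proof. by have [] := fgP. Qed.

Lemma chartK v : cball c (4 * r) v -> f (g v) = v.
Proof. by have [_ h _ _ _] := fgP; exact: h. Qed.

Lemma chartP x : cdom x -> g (f x) = x /\ cball c (4 * r) (f x).
Proof. by move=> [v vb <-]; rewrite chartK. Qed.

Lemma cdiscE a x : a <= 4 * r -> cdisc a x <-> cdom x /\ cball c a (f x).
Proof.
move=> ar; split=> [[v vb <-]|[/chartP[gf _] h]]; last by exists (f x).
have vb4 : cball c (4 * r) v by exact: cball_le vb.
by rewrite chartK//; split=> //; exists v.
Qed.

Lemma cdisc_le a b x : a <= b -> cdisc a x -> cdisc b x.
Proof. by move=> ab [v vb <-]; exists v => //; exact: cball_le vb. Qed.

Lemma cdisc_compact a : a <= 4 * r -> compact (cdisc a).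
Proof.
move=> ar; apply: continuous_compact; last exact: cball_compact.
have [_ _ cg _ _] := fgP; apply: continuous_subspaceW cg => v.
exact: cball_le.
Qed.

Lemma chart_unif e : 0 < e -> exists2 d, 0 < d &
  forall x y, cdom x -> cdom y -> ball x d y -> ball (f x) e (f y).
Proof.
by have [_ _ _ cf _] := fgP; move=> e0; apply: heine cf _ e0; exact: cdisc_compact.
Qed.

Lemma chart_inv_unif e : 0 < e -> exists2 d, 0 < d &
  forall u v, cball c (4 * r) u -> cball c (4 * r) v -> ball u d v -> ball (g u) e (g v).
Proof.
by have [_ _ cg _ _] := fgP; move=> e0; apply: heine cg _ e0; exact: cball_compact.
Qed.

Lemma cdisc_nbhd a b : a < b -> 0 < b -> b <= 4 * r -> exists2 d, 0 < d &
  forall x, cdisc a x -> forall y, ball x d y -> cdisc b y.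
Proof.
move=> ab b0 br; apply: compact_unif.
- by apply: cdisc_compact; lra.
- by move=> d d' x d'0 dd h y b'; apply: h; exact: le_ball b'.
move=> _ [v vb <-]; have [_ _ _ _ og] := fgP.
have : nbhs (g v) (g @` ball c b).
  by apply: open_nbhs_nbhs; split; [exact: og | exists v => //; exact: cball_ball vb].
move=> /nbhs_ballP[d /= d0 dP]; exists (d / 2) => [|x _ bx y b']; first by rewrite divr_gt0.
have [|w wb <-] := dP y; last by exists w => //; exact: ball_cball.
by rewrite [d]splitr; exact: ball_triangle bx b'.
Qed.

Variable G : comNzRingType.

Definition indom (s : seq M) : bool := all (fun x => `[< cdom x >]) s.
Lemma indomP s : reflect (forall x, x \in s -> cdom x) (indom s).
Proof. by apply: (iffP allP) => h x xs; apply/asboolP; exact: h. Qed.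
Lemma indom_sub s t : {subset t <= s} -> indom s -> indom t.
Proof. by move=> ts /indomP h; apply/indomP => x /ts/h. Qed.

(* The generator of the cohomology with supports at y, read in the chart. *)
Definition thM (y : M) (s : seq M) : G :=
  if indom s then theta G (f y) (map f s) else 0.

Lemma finel_chart e : 0 < e -> exists2 d, 0 < d & forall s, finel d s -> indom s ->
  finel e (map f s).
Proof.
move=> /chart_unif[d d0 dP]; exists d => // s fs /indomP sd _ _ /mapP[x xs ->] /mapP[y ys ->].
by apply: dP; [exact: sd | exact: sd | exact: fs].
Qed.

Lemma finel_chart_inv e : 0 < e -> exists2 d, 0 < d & forall l : seq V, finel d l ->
  (forall v, v \in l -> cball c (4 * r) v) -> finel e (map g l).
Proof.
move=> /chart_inv_unif[d d0 dP]; exists d => // l fl lb _ _ /mapP[u ul ->] /mapP[v vl ->].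
by apply: dP; [exact: lb | exact: lb | exact: fl].
Qed.

Lemma indom_dichotomy : exists2 d, 0 < d & forall s, finel d s ->
  indom s \/ forall x, x \in s -> ~ cdisc (3 * r) x.
Proof.
have r34 : 3 * r < 4 * r by rewrite ltr_pM2r// ltr_nat.
have r4 : 0 < 4 * r by rewrite mulr_gt0.
have [d d0 dP] := cdisc_nbhd r34 r4 (lexx _).
exists d => // s fs; have [h|nh] := pselect (exists2 x, x \in s & cdisc (3 * r) x).
  by have [x xs dx] := h; left; apply/indomP => y ys; apply: (dP x dx); exact: fs.
by right=> x xs dx; apply: nh; exists x.
Qed.

Lemma thM_near e : 0 < e -> exists2 d, 0 < d & forall y, cdisc (2 * r) y ->
  forall s, finel d s -> thM y s != 0 -> forall x, x \in s -> ball y e x.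
Proof.
move=> /chart_inv_unif[e' e'0 e'P]; have [d d0 dP] := finel_chart e'0.
have r24 : 2 * r <= 4 * r by rewrite ler_pM2r// ler_nat.
exists d => // y /(cdiscE _ r24)[yd _] s fs; rewrite /thM; case: ifP => [sd|]; last by rewrite eqxx.
move=> nz x xs; have [gx fx] := chartP ((indomP _ sd) x xs); have [gy fy] := chartP yd.
rewrite -gx -gy; apply: e'P => //.
by apply: theta_near (dP _ fs sd) nz _ _; exact: map_f.
Qed.

(** Extension by zero does no harm: a fine list that leaves the chart stays outside the cube of
    radius [3 * r], and [theta] is nonzero only near its base point in the cube of radius
    [2 * r]. *)
Lemma thM_cocycle : exists2 d, 0 < d & forall y, cdisc (2 * r) y ->
  forall s, finel d s -> dc (thM y) s = 0.
Proof.
have [d1 d10 d1P] := indom_dichotomy; have [d2 d20 d2P] := finel_chart r0.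
exists (Num.min d1 d2) => [|y yd s fs]; first by rewrite lt_min d10.
have f1 : finel d1 s by apply: finel_le fs; rewrite ge_min lexx.
have f2 : finel d2 s by apply: finel_le fs; rewrite ge_min lexx orbT.
have [sd|sn] := d1P _ f1.
  rewrite -[RHS](theta_dc G (f y) (map f s)) dc_map.
  apply: eq_dc_in => t ts _; rewrite /thM ifT//.
  by apply: indom_sub sd; exact: mem_subseq.
rewrite /dc ev_0// => p pb; rewrite /thM; case: ifP => // pd.
apply/eqP/negPn/negP => nz.
have fp : finel r (map f p.2) by apply: d2P => //; exact: finel_bd1 pb f2.
have [x xp] : exists x, x \in p.2.
  by case: p.2 nz => [|x t _]; [rewrite theta_size ?eqxx | exists x; exact: mem_head].
have xs := bd1_mem pb xp; apply: (sn x xs).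
have r34 : 3 * r <= 4 * r by rewrite ler_pM2r// ler_nat.
have r24 : 2 * r <= 4 * r by rewrite ler_pM2r// ler_nat.
apply/(cdiscE _ r34); split; first exact: (indomP _ pd).
have [_ fy] := (cdiscE y r24).1 yd.
have -> : 3 * r = 2 * r + r by ring.
by apply: cball_add fy _; apply: theta_near fp nz _ _; exact: map_f.
Qed.

Lemma thM_local y : cdisc (2 * r) y -> local_cocycle y (thM y).
Proof.
move=> yd; split; first by have [d d0 dP] := thM_cocycle; exists d => // s; exact: dP.
move=> e e0; have [d d0 dP] := thM_near e0; exists d => // s fs sn.
apply/eqP/negPn/negP => nz; have [x xs] : exists x, x \in s.
  case: s nz {fs sn} => [|x s _]; last by exists x; exact: mem_head.
  by rewrite /thM /= theta_size ?eqxx.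
exact: (sn x xs (dP y yd s fs nz x xs)).
Qed.

Lemma thM_size y s : size s != N.+1 -> thM y s = 0.
Proof. by move=> sz; rewrite /thM; case: ifP => // _; rewrite theta_size// size_map. Qed.

Lemma chart_cocycle (F : seq M -> G) (e0 a b : R) (y : M) :
  0 < e0 -> 0 < a -> a < b -> b <= r -> cdisc r y ->
  (forall s, size s = N.+2 -> finel e0 s -> dc F s = 0) ->
  (forall s, size s = N.+1 -> finel e0 s ->
     (forall x, x \in s -> ~ (cdom x /\ ball (f y) a (f x))) -> F s = 0) ->
  exists (k : G) (H : seq M -> G) (e : R), [/\ 0 < e,
    forall s, size s = N.+1 -> finel e s -> F s = k * thM y s + dc H s &
    forall s, finel e s -> (forall x, x \in s -> ~ (cdom x /\ ball (f y) b (f x))) -> H s = 0].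
Proof.
move=> e00 a0 ab br yd Fd F0.
have r14 : r <= 4 * r by rewrite ler_peMl ?ler1n// ltW.
have [ydom fyc] := (cdiscE y r14).1 yd.
have inb v : ball (f y) r v -> cball c (2 * r) v.
  by move=> bv; rewrite (_ : 2 * r = r + r); [exact: cball_add bv | ring].
have r24 : 2 * r <= 4 * r by rewrite ler_pM2r// ler_nat.
pose inB (l : seq V) := all (fun v => `[< cball c (4 * r) v >]) l.
have inBP l : reflect (forall v, v \in l -> cball c (4 * r) v) (inB l).
  by apply: (iffP allP) => h x xs; apply/asboolP; exact: h.
pose F' l := if inB l then F (map g l) else 0.
have [d d0 dP] := finel_chart_inv e00.
pose e1 := Num.min d r.
have e10 : 0 < e1 by rewrite lt_min d0 r0.
have fd (l : seq V) : finel e1 l -> finel d l by apply: finel_le; rewrite ge_min lexx.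
have fr (l : seq V) : finel e1 l -> finel r l by apply: finel_le; rewrite ge_min lexx orbT.
have F'0 l : size l = N.+1 -> finel e1 l -> (forall v, v \in l -> ~ ball (f y) a v) -> F' l = 0.
  move=> sl fl lo; rewrite /F'; case: ifP => // /inBP lb; apply: F0.
  - by rewrite size_map.
  - by apply: dP => //; exact: fd.
  - move=> _ /mapP[v vl ->] [_]; rewrite chartK; last exact: lb.
    exact: lo.
have F'd l : size l = N.+2 -> finel e1 l -> dc F' l = 0.
  move=> sl fl; have [lb|/negP nlb] := boolP (inB l).
    rewrite -[RHS](Fd (map g l)); [|by rewrite size_map|by apply: dP; [exact: fd | exact/inBP]].
    rewrite dc_map; apply: eq_dc_in => t tl _; rewrite /F' ifT//.
    by apply/inBP => v vt; move/inBP: lb; apply; exact: (mem_subseq tl).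
  rewrite /dc ev_0// => p pl; apply: F'0.
  - by have := bd1_size pl; rewrite sl => -[].
  - exact: finel_bd1 pl fl.
  move=> v vp bv; apply: nlb; apply/inBP => w wl.
  have -> : 4 * r = 2 * r + 2 * r by ring.
  apply: (@cball_add _ _ _ v).
    by apply: inb; apply: le_ball bv; lra.
  have bvw := fr _ fl _ _ (bd1_mem pl vp) wl; apply: le_ball bvw.
  by rewrite ler_peMl ?ler1n// ltW.
have [k [H' [e2 [e20 H'E H'0]]]] := @Rn_cocycle R G N F' (f y) a e1 b isT e10 a0 ab F'd F'0.
have [d3 d30 d3P] := finel_chart e20; have [d4 d40 d4P] := indom_dichotomy.
(* The vanishing of [H'] is known only for lists of size [N], hence the guard on the size. *)
exists k, (fun s => if indom s && (size s == N) then H' (map f s) else 0),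
  (Num.min (Num.min d3 d4) e0).
have ch (s : seq M) : finel (Num.min (Num.min d3 d4) e0) s -> [/\ finel d3 s, finel d4 s & finel e0 s].
  by move=> fs; split; apply: finel_le fs; rewrite !ge_min lexx ?orbT.
split; first by rewrite !lt_min d30 d40.
- move=> s sz /ch[f3 f4 f0]; have [sd|nsd] := boolP (indom s).
    have fb v : v \in map f s -> cball c (4 * r) v.
      by move=> /mapP[x xs ->]; have [] := chartP ((indomP _ sd) x xs).
    have gf : map g (map f s) = s.
      rewrite -map_comp -[RHS]map_id; apply/eq_in_map => x xs /=.
      by have [] := chartP ((indomP _ sd) x xs).
    have := H'E (map f s); rewrite size_map => /(_ sz (d3P _ f3 sd)).
    rewrite /F' (introT (inBP _) fb) gf => ->; rewrite /thM sd; congr (_ + _).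
    rewrite dc_map; apply: eq_dc_in => t ts szt; rewrite (indom_sub _ sd) /=; last exact: mem_subseq.
    by move: szt; rewrite sz => -[<-]; rewrite eqxx.
  have [sd|sn] := d4P _ f4; first by rewrite sd in nsd.
  have nb x : x \in s -> ~ (cdom x /\ ball (f y) r (f x)).
    move=> xs [xd bx]; apply: (sn x xs); apply/cdiscE; first by rewrite ler_pM2r// ler_nat.
    by split=> //; apply: cball_le (inb _ bx); rewrite ler_pM2r// ler_nat.
  rewrite F0//; last first.
    by move=> x xs [xd bx]; apply: (nb x xs); split=> //; apply: le_ball bx; lra.
  rewrite /thM (negPf nsd) mulr0 add0r /dc ev_0// => p pb; case: ifP => // /andP[pd /eqP szp].
  apply: H'0; first by rewrite size_map.
    by apply: d3P => //; exact: finel_bd1 pb f3.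
  move=> _ /mapP[x xp ->] bx; apply: (nb x (bd1_mem pb xp)).
  by split; [exact: (indomP _ pd) | exact: le_ball bx].
- move=> s /ch[f3 f4 f0] sn; case: ifP => // /andP[sd /eqP sz]; apply: H'0.
  + by rewrite size_map.
  + exact: d3P.
  + by move=> _ /mapP[x xs ->] bx; apply: (sn x xs); split=> //; exact: (indomP _ sd).
Qed.

(** The distance [rho'] is fixed before the fineness [e0], since a glued fundamental class needs one
    margin for all finenesses. *)
Lemma chart_chain (X : set M) (rho : R) : 0 < rho -> X `<=` cdisc r ->
  exists2 rho' : R, 0 < rho' & forall e0, 0 < e0 -> exists2 e, 0 < e & forall Y : chain G M,
    (forall p, p \in Y -> [/\ size p.2 = N.+1, finel e p.2 & forall x, x \in p.2 -> cdisc (3 * r) x]) ->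
    bd_off e (nearset X rho) Y ->
    (forall y, nearset X rho y -> cdisc (2 * r) y -> ev (thM y) Y = 0) ->
  exists W S : chain G M,
  [/\ forall F, ev F Y = ev (dc F) W + ev F S,
      forall p, p \in W -> finel e0 p.2 &
      forall p, p \in S -> [/\ size p.2 = N.+1, finel e0 p.2 &
        forall x, x \in p.2 -> ~ nearset X rho' x]].
Proof.
move=> rho0 Xr.
have r14 : r <= 4 * r by rewrite ler_peMl ?ler1n// ltW.
have r24 : 2 * r <= 4 * r by rewrite ler_pM2r// ler_nat.
have r34 : 3 * r <= 4 * r by rewrite ler_pM2r// ler_nat.
have [d1 d10 d1P] := chart_inv_unif rho0.
pose rf := Num.min d1 r.
have rf0 : 0 < rf by rewrite lt_min d10 r0.
pose Xf : set V := f @` X.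
have Xdom x : X x -> cdom x /\ cball c r (f x) by move=> /Xr/(cdiscE _ r14).
have Xfb v : nearset Xf rf v -> cball c (2 * r) v.
  move=> [_ [x Xx <-] b]; rewrite (_ : 2 * r = r + r); last by ring.
  apply: cball_add (Xdom x Xx).2 _; apply: le_ball b.
  by rewrite ge_min lexx orbT.
have Xfg v : nearset Xf rf v -> nearset X rho (g v).
  move=> nv; have vb := Xfb v nv; case: nv => _ [x Xx <-] b; exists x => //.
  have [xd xb] := Xdom x Xx; have [gfx fxb] := chartP xd.
  rewrite -[X in ball X]gfx; apply: d1P => //; first exact: cball_le vb.
  by apply: le_ball b; rewrite ge_min lexx.
have rf20 : 0 < rf / 2 by rewrite divr_gt0.
have [d3 d30 d3P] := chart_unif rf20; exists d3 => // e0 e00.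
have [d2 d20 d2P] := finel_chart_inv e00.
pose ef := Num.min d2 r.
have ef0 : 0 < ef by rewrite lt_min d20 r0.
have [e1 e10 e1P] := @Rn_chain R G N Xf rf ef rf0 ef0.
have [d4 d40 d4P] := finel_chart e10.
exists d4 => // Y YP Yoff Y0.
have Yd p : p \in Y -> indom p.2.
  by move=> /YP[_ _ h]; apply/indomP => x /h/(cdiscE _ r34)[].
have gfY p : p \in Y -> map g (map f p.2) = p.2.
  move=> pY; rewrite -map_comp -[RHS]map_id; apply/eq_in_map => x xs /=.
  by have [] := chartP ((indomP _ (Yd _ pY)) x xs).
have [|||W [S [YE WP SP]]] := e1P (mapc f Y).
- move=> p /mem_mapc[q qY ->]; have [sz fq _] := YP _ qY.
  by split; [rewrite size_map | apply: d4P => //; exact: Yd].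
- move=> F' F'0; rewrite ev_mapc.
  pose F s := if indom s then F' (map f s) else 0.
  rewrite -[RHS](Yoff F) => [|s fs sn].
    apply: eq_ev_in => p pY; rewrite dc_map; apply: eq_dc_in => t ts _.
    by rewrite /F ifT//; apply: indom_sub (Yd _ pY); exact: mem_subseq.
  rewrite /F; case: ifP => // sd; apply: F'0; first exact: d4P.
  move=> _ /mapP[x xs ->] nx; apply: (sn x xs).
  by have [<- _] := chartP ((indomP _ sd) x xs); exact: Xfg.
- move=> v nv; have vb := Xfb v nv.
  have v4 : cball c (4 * r) v by exact: cball_le vb.
  rewrite -[RHS](Y0 (g v)); [|exact: Xfg|by exists v].
  rewrite ev_mapc; apply: eq_ev_in => p pY.
  by rewrite /thM (Yd _ pY) chartK.
have nearb (p : G * seq V) : (forall x, x \in p.2 -> exists2 q, q \in mapc f Y &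
    exists2 y, y \in q.2 & ball y ef x) -> forall x, x \in p.2 -> cball c (4 * r) x.
  move=> h x /h[q /mem_mapc[q' q'Y ->] [_ /mapP[y yq ->] b]].
  have [_ _ /(_ y yq)/(cdiscE _ r34)[_ yb]] := YP _ q'Y.
  rewrite (_ : 4 * r = 3 * r + r); last by ring.
  by apply: cball_add yb _; apply: le_ball b; rewrite ge_min lexx orbT.
have fd2 (l : seq V) : finel ef l -> finel d2 l by apply: finel_le; rewrite ge_min lexx.
exists (mapc g W), (mapc g S); split.
- move=> F; have -> : ev F Y = ev (fun l => F (map g l)) (mapc f Y).
    by rewrite ev_mapc; apply: eq_ev_in => p pY; rewrite gfY.
  rewrite YE !ev_mapc; congr (_ + _); apply: eq_ev => l; by rewrite dc_map.
- move=> p /mem_mapc[q qW ->]; have [_ fq nq] := WP _ qW.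
  by apply: d2P; [exact: fd2 | exact: nearb nq].
- move=> p /mem_mapc[q qS ->]; have [sz fq nq oq] := SP _ qS.
  split; [by rewrite size_map | by apply: d2P; [exact: fd2 | exact: nearb nq] |].
  move=> _ /mapP[v vq ->] [x Xx b]; apply: (oq v vq); exists (f x); first by exists x.
  have vb := nearb _ nq v vq; rewrite -[X in ball _ _ X](chartK vb).
  by apply: d3P => //; [exact: (Xdom x Xx).1 | exists v].
Qed.

End OneChart.

End Charts.

(** * A singular simplex on which the local cocycle has value 1 *)

Section ChartSimplex.
Variables (R : realType) (M : metricType R) (n : nat) (G : comNzRingType).
Local Notation N := n.+1.
Local Notation V := 'rV[R]_N.
Local Notation Sx k := (stdsimplex R k).
Local Notation schain n := (schain R M G n).
Local Notation sch A n := (@sing_chains R M G A n).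
Variables (f : M -> V) (g : V -> M) (c : V) (r : R).
Hypothesis fgP : is_chart f g c r.
Variable y : M.
Hypothesis yd : cdisc g c (2 * r) y.

Let r0 : 0 < r. Proof. by have [] := fgP. Qed.
Let ydP : cdom g c r y /\ cball c (2 * r) (f y).
Proof. by apply/(cdiscE fgP); rewrite ?ler_pM2r ?ler_nat. Qed.

Lemma aff_continuous : continuous (@aff R N (f y) r : Sx N -> V).
Proof.
move=> t U /nbhs_ballP[e /= e0 eU]; apply/nbhs_ballP.
have d0 : 0 < e / (r * N.+1%:R) by rewrite divr_gt0// mulr_gt0// ltr0n.
exists (e / (r * N.+1%:R)) => //= u; rewrite -initial_ballE => /rV_ballE[_ b]; apply: eU.
apply: rV_ballI => // j; rewrite !mxE.
rewrite (_ : _ - _ = r * (csum t j.+1 - csum u j.+1)); last by ring.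
rewrite normrM gtr0_norm// -ltr_pdivlMl// /csum -sumrB.
apply: le_lt_trans (ler_norm_sum _ _ _) _.
apply: (@le_lt_trans _ _ (\sum_(k < N.+1 | (j.+1 <= k)%N) (e / (r * N.+1%:R)))).
  by apply: ler_sum => k _; exact/ltW/b.
apply: (@lt_le_trans _ _ (\sum_(k < N.+1) (e / (r * N.+1%:R)))).
  rewrite [ltRHS](bigID (fun k : 'I_N.+1 => (j.+1 <= k)%N))/= ltrDl.
  rewrite (bigD1 ord0)//= ltr_pwDl// sumr_ge0// => k _; exact: ltW.
rewrite sumr_const card_ord -[X in X <= _]mulr_natr.
have : N.+1%:R != 0 :> R by rewrite pnatr_eq0.
have := gt_eqF r0; move: (N.+1%:R) r => q r1 /negbT r1n qn.
by rewrite (_ : e / (r1 * q) * q = r1^-1 * e)//; field; rewrite r1n.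
Qed.

Definition chart_simplex (t : Sx N) : M := g (aff (f y) r t).

Lemma aff_cball t : cball c (4 * r) (aff (f y) r t).
Proof.
have [_ yc] := ydP; apply: (@cball_le _ _ _ (2 * r + r)); first by have := r0; lra.
move=> i; have := aff_near (f y) r0 t i; have := yc i.
by rewrite !ler_norml => /andP[? ?] /andP[? ?]; apply/andP; split; lra.
Qed.

Lemma chart_simplex_continuous : continuous chart_simplex.
Proof.
move=> t; have [_ _ cg _ _] := fgP.
have /subspace_continuousP/(_ _ (aff_cball t)) cgt := cg.
move=> U /cgt h; have h' := @aff_continuous t _ h.
have : nbhs t [set u | cball c (4 * r) (aff (f y) r u) -> U (chart_simplex u)] by exact: h'.
suff -> : [set u | cball c (4 * r) (aff (f y) r u) -> U (chart_simplex u)] =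
  [set u | U (chart_simplex u)] by [].
by apply/seteqP; split=> u /=; [apply; exact: aff_cball | move=> + _].
Qed.

Definition chart_chain1 : schain N := fun t => (t == chart_simplex)%:R.

Lemma chart_chain1_neq0 s : (chart_chain1 s != 0) = (s == chart_simplex).
Proof.
rewrite /chart_chain1; case: (s == _) => /=; first exact: oner_neq0.
by apply/negbTE; rewrite negbK.
Qed.

Lemma chart_chain1_finite : finite_set [set s | chart_chain1 s != 0].
Proof.
rewrite (_ : [set _ | _] = [set chart_simplex]) ?finite_set1//.
by apply/seteqP; split=> s /=; rewrite chart_chain1_neq0 => /eqP.
Qed.

Lemma ssupp_chart_chain1 : ssupp chart_chain1 =i [:: chart_simplex].
Proof.
by move=> s; rewrite (mem_ssuppE _ chart_chain1_finite) mem_seq1 chart_chain1_neq0.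
Qed.

Lemma chart_chain1_sch : chart_chain1 \in sch setT N.
Proof.
rewrite unfold_in; apply/asboolP; split; first exact: chart_chain1_finite.
move=> s; rewrite chart_chain1_neq0 => /eqP ->.
by split=> //; exact: chart_simplex_continuous.
Qed.

Lemma chart_chain1_cycle : chart_chain1 \in @rel_cycle R M G (~` [set y]) N.
Proof.
apply/andP; split; first exact: chart_chain1_sch.
have [_ bs bT] := sboundary_supp chart_chain1_sch.
rewrite unfold_in; apply/asboolP; move: (bT); rewrite unfold_in => /asboolP[fb bP]; split=> // t tb.
split; first by have [] := bP _ tb.
move: (bs _ tb); rewrite mem_undup => /allpairsP[[s i] [/= + _ ->]].
rewrite ssupp_chart_chain1 mem_seq1 => /eqP -> _ [u _ <-] /= e.
(* Only points with all barycentric coordinates positive can be sent to [y], so the faces avoid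
   it. *)
have yE : aff (f y) r (face i u) = f y by rewrite -[in RHS]e /chart_simplex (chartK fgP)//; exact: aff_cball.
by have := aff_center r0 i yE; rewrite /= mxE unlift_none ltxx.
Qed.

Lemma chart_chain1_pairs : pairs (thM f g c r G y) chart_chain1 1.
Proof.
exists 1 => // kap [mk _]; have uq : perm_eq (ssupp chart_chain1) [:: chart_simplex].
  apply: uniq_perm => //; last exact: ssupp_chart_chain1.
  exact: finmap.fset_uniq.
rewrite ev_singV (perm_big _ uq) big_seq1 /chart_chain1 eqxx mul1r.
rewrite -[RHS](@aff_theta R G N (f y) r r0 kap isT mk) ev_mapc; apply: eq_ev => l.
have ch t : cdom g c r (chart_simplex t) by exists (aff (f y) r t) => //; exact: aff_cball.
rewrite /thM ifT; last by apply/indomP => x /mapP[t _ ->].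
rewrite -map_comp; congr theta; apply: eq_map => t /=.
by rewrite (chartK fgP)//; exact: aff_cball.
Qed.

Lemma thM_generator_neq0 (mu : sing_homology R G (~` [set y]) N) v :
  local_generator mu -> pairs (thM f g c r G y) (subquot_repr mu) v -> v != 0.
Proof.
move=> gen; apply: generator_pairs_neq0 gen _ chart_chain1_cycle chart_chain1_pairs.
  exact: metric_hausdorff.
exact: thM_local.
Qed.

End ChartSimplex.

(** * The fundamental class *)

Record chart (R : realType) (M : metricType R) (N : nat) := Chart {
  ch_fun : M -> 'rV[R]_N.+1; ch_inv : 'rV[R]_N.+1 -> M;
  ch_center : 'rV[R]_N.+1; ch_rad : R;
  chP : is_chart ch_fun ch_inv ch_center ch_rad }.

Section Gluing.
Variables (R : realType) (M : metricType R) (n : nat) (G : comNzRingType).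
Local Notation N := n.+1.
Local Notation V := 'rV[R]_N.
Local Notation Sx k := (stdsimplex R k).
Local Notation sch A n := (@sing_chains R M G A n).
Implicit Types (C : chart M n) (L : set M).

Definition disc C a : set M := cdisc (ch_inv C) (ch_center C) (a * ch_rad C).
Definition th C : M -> seq M -> G :=
  thM (ch_fun C) (ch_inv C) (ch_center C) (ch_rad C) G.

Lemma ch_rad_gt0 C : 0 < ch_rad C. Proof. by have [] := chP C. Qed.

Lemma disc_compact C a : a <= 4 -> compact (disc C a).
Proof. by move=> a4; apply: cdisc_compact (chP C) _ _; rewrite ler_pM2r ?ch_rad_gt0. Qed.

Lemma disc_le C a b x : a <= b -> disc C a x -> disc C b x.
Proof. by move=> ab; apply: cdisc_le; rewrite ler_pM2r ?ch_rad_gt0. Qed.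

Lemma disc_nbhd C a b : a < b -> 0 < b -> b <= 4 -> exists2 d, 0 < d &
  forall x, nearset (disc C a) d x -> disc C b x.
Proof.
move=> ab b0 b4; have [|||d d0 dP] := @cdisc_nbhd _ _ _ _ _ _ _ (chP C) (a * ch_rad C) (b * ch_rad C).
- by rewrite ltr_pM2r ?ch_rad_gt0.
- by rewrite mulr_gt0 ?ch_rad_gt0.
- by rewrite ler_pM2r ?ch_rad_gt0.
by exists d => // x [y yd b']; exact: dP yd _ b'.
Qed.

Lemma th_size C y s : size s != N.+1 -> th C y s = 0.
Proof. exact: thM_size. Qed.

Lemma nearset_le (A : set M) d d' x : d <= d' -> nearset A d x -> nearset A d' x.
Proof. by move=> dd [a Aa b]; exists a => //; exact: le_ball b. Qed.

Lemma nearset_ball (A : set M) d d' x y : nearset A d x -> ball x d' y -> nearset A (d + d') y.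
Proof. by move=> [a Aa b] b'; exists a => //; exact: ball_triangle b b'. Qed.

Variables (k : nat) (C : 'I_k -> chart M n).
Variable mu : forall x : M, sing_homology R G (~` [set x]) N.

Lemma th_unif a : 0 < a -> exists2 d, 0 < d & forall i y, disc (C i) 2 y ->
  (forall s, finel d s -> dc (th (C i) y) s = 0) /\
  (forall s, finel d s -> th (C i) y s != 0 -> forall x, x \in s -> ball y a x).
Proof.
move=> a0; have [|i _|d d0 dP] := @seq_unif R _ (enum 'I_k) (fun d i => forall y, disc (C i) 2 y ->
  (forall s, finel d s -> dc (th (C i) y) s = 0) /\
  (forall s, finel d s -> th (C i) y s != 0 -> forall x, x \in s -> ball y a x)).
- move=> d d' i d'0 dd h y /h[h1 h2]; split=> s fs; [apply: h1 | apply: h2];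
  exact: finel_le fs.
- have [d1 d10 d1P] := thM_cocycle (chP (C i)) G.
  have [d2 d20 d2P] := thM_near (chP (C i)) G a0.
  exists (Num.min d1 d2) => [|y yd]; first by rewrite lt_min d10.
  split=> s fs; [apply: d1P => // | apply: d2P => //]; apply: finel_le fs;
  by rewrite ge_min lexx ?orbT.
by exists d => // i; apply: dP; rewrite mem_enum.
Qed.

Definition degree i y (v : G) : Prop := pairs (th (C i) y) (subquot_repr (mu y)) v.

Lemma degree_exists i y : disc (C i) 2 y -> exists v, degree i y v.
Proof.
move=> yd; have [muT muB] := rel_cycleE (subquot_reprP (mu y)).
apply: pairs_exists muT muB; first exact: metric_hausdorff.
exact: (thM_local (chP _) G yd).
Qed.

(* Approximations, of every fineness, of a fundamental class of M along L. *)
Definition fundamental_on L : Prop := exists2 m, 0 < m & forall e, 0 < e ->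
  exists z : chain G M, [/\ forall p, p \in z -> size p.2 = N.+1 /\ finel e p.2,
    bd_off e (nearset L m) z &
    forall i y v, nearset L m y -> disc (C i) 2 y -> degree i y v -> ev (th (C i) y) z = v].

(** A class of the orientation over a neighborhood is turned into list chains by fine models; its
    local degrees are right because it restricts to the chosen generators. *)
Lemma fundamental_disc L U (d : R) (muU : sing_homology R G (~` U) N) : 0 < d ->
  (forall y, nearset L d y -> U y) ->
  (forall y (Uy : U y), rel_map (setC_point Uy) muU = mu y) -> fundamental_on L.
Proof.
move=> d0 LU muP; have d20 : 0 < d / 2 by rewrite divr_gt0.
have [mT mB] := rel_cycleE (subquot_reprP muU); set m := subquot_repr muU in mT mB.
have bT : sboundary m \in sch setT n by apply: sing_chains_sub mB.
exists (d / 2) => // e e0; have [d1 d10 d1P] := th_unif d20.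
pose e' := Num.min e d1.
have e'0 : 0 < e' by rewrite lt_min e0.
have [d2 d2_0 f2] := chain_unif mT e'0; have [d3 d3_0 f3] := chain_unif bT e'0.
pose dd := Num.min d2 d3 / 2 ^+ n.+2.
have dd0 : 0 < dd by rewrite divr_gt0 ?exprn_gt0// lt_min d2_0.
have dE : 2 ^+ n.+2 * dd = Num.min d2 d3 by rewrite mulrC divfK// gt_eqF ?exprn_gt0.
have ddle : dd <= Num.min d2 d3.
  by rewrite -dE ler_peMl ?(ltW dd0)// exprn_ege1// ler1n.
have {}f2 s : s \in ssupp m -> forall l, sfine (2 ^+ n.+2 * dd) l -> finel e' (map s l).
  by move=> sm l fl; apply: f2 => //; apply: finel_le fl; rewrite dE ge_min lexx.
have {}f3 s : s \in ssupp (sboundary m) -> forall l, sfine (2 ^+ n.+2 * dd) l -> finel e' (map s l).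
  by move=> sm l fl; apply: f3 => //; apply: finel_le fl; rewrite dE ge_min lexx orbT.
have [kap kapP] := @fine_model_exists R G n _ dd0; have [mk fk] := kapP.
have fk' j q : (j <= n.+2)%N -> q \in kap j -> sfine (2 ^+ n.+2 * dd) q.2.
  by move=> jn qj; apply: finel_le (fk j jn q qj); rewrite dE.
exists (singV (kap N) m); split.
- move=> p /mem_singV[s sm [q qk ->]]; rewrite size_map; have [-> // _ _] := mk; split=> //.
  apply: finel_le (f2 s sm _ _); first by rewrite ge_min lexx.
  exact: (fk' N).
- move=> F F0; rewrite ev_singV_bd// ev_0// => p /mem_singV[s sm [q qk ->]].
  apply: F0.
    apply: finel_le (f3 s sm _ _); first by rewrite ge_min lexx.
    by apply: (fk' n) => //; exact: leqW.
  move=> _ /mapP[t _ ->] h; have [_ [_ sU]] := mem_ssupp mB sm.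
  apply: (sU (s t)); first by exists t.
  by apply: LU; apply: nearset_le h; rewrite ler_pdivrMr// ler_peMr ?(ltW d0)// ler1n.
move=> i y v yL yd yv.
have Uxy x : ball y (d / 2) x -> U x.
  by move=> b; apply: LU; rewrite [d]splitr; exact: nearset_ball b.
have Uy : U y by apply: Uxy; exact: ballxx.
have [h1 h2] := d1P i y yd.
have yloc : local_cocycle y (th (C i) y) by exact: (thM_local (chP _) G yd).
have myv : pairs (th (C i) y) m v.
  have [muT _] := rel_cycleE (subquot_reprP (mu y)).
  apply: pairs_congr yloc mT muT _ yv; first exact: metric_hausdorff.
  pose mZ := rel_cycle_sub (setC_point Uy) (subquot_reprP muU).
  apply/(subquot_classP _ mZ (subquot_reprP (mu y))); rewrite (subquot_classK (mu y)).
  exact: muP.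
apply: (pairs_at myv mT mB dd0 f2 f3 _ _ kapP) => s fs.
  by apply: h1; apply: finel_le fs; rewrite ge_min lexx orbT.
move=> sU; apply/eqP/negPn/negP => nz.
have [x xs] : exists x, x \in s.
  case: s nz {fs sU} => [|x s _]; last by exists x; exact: mem_head.
  by rewrite th_size ?eqxx.
apply: (sU x xs); apply/Uxy/(h2 s) => //.
by apply: finel_le fs; rewrite ge_min lexx orbT.
Qed.

Lemma fundamental_on0 : fundamental_on set0.
Proof.
exists 1 => // e e0; exists [::]; split=> // [F _|i y v [//]].
exact: ev_nil.
Qed.

(** In general a point close to two sets need not be close to their intersection; compactness gives
    this with a uniform bound. *)
Lemma compact_near_inter (A B : set M) (d : R) : compact A -> compact B -> 0 < d ->
  exists2 a, 0 < a & forall x, nearset A a x -> nearset B a x -> nearset (A `&` B) d x.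
Proof.
move=> cA cB d0; have d20 : 0 < d / 2 by rewrite divr_gt0.
have [|x Ax|a a0 aP] := @compact_unif _ _ A (fun a x => nearset B a x ->
    nearset (A `&` B) (d / 2) x) cA.
- by move=> a a' x a'0 aa h h'; apply: h; exact: nearset_le h'.
- have [Bx|nBx] := pselect (B x).
    exists (d / 2) => // x' _ b _; exists x => //.
  have /nbhs_ballP[e /= e0 eP] : nbhs x (~` B).
    by apply: open_nbhs_nbhs; split=> //; apply/closed_openC/(compact_closed _ cB)/metric_hausdorff.
  exists (e / 2) => [|x' _ b [y By b']]; first by rewrite divr_gt0.
  by case: (eP y _ By); rewrite [e]splitr; exact: ball_triangle b (ball_sym b').
have m0 : 0 < Num.min (a / 2) (d / 2) by rewrite lt_min !divr_gt0.
exists (Num.min (a / 2) (d / 2)) => // x [y Ay b] [y' By' b'].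
rewrite [d]splitr; apply: (@nearset_ball _ _ _ y).
  apply: aP => //; exists y' => //; rewrite [a]splitr.
  apply: ball_triangle (le_ball _ b') (ball_sym (le_ball _ b)); by rewrite ge_min lexx.
by apply: le_ball b; rewrite ge_min lexx orbT.
Qed.

Lemma filter_ev (z : chain G M) (P : pred (seq M)) F :
  ev F z = ev F [seq p <- z | P p.2] + ev F [seq p <- z | ~~ P p.2].
Proof.
rewrite ev_filter (ev_filter F (fun s => ~~ P s)) -ev_addf; apply: eq_ev => s.
by case: (P s); rewrite ?addr0 ?add0r.
Qed.

(** Mayer-Vietoris: the chains for [L] and for the disc [Q] have equal local degrees near the
    intersection, so their difference is a boundary plus lists away from it. Such a fine list is
    away from [L] or from [Q], and those away from [Q] are added to the chain of [Q]. *)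
Lemma fundamental_glue L j : compact L -> fundamental_on L ->
  fundamental_on (disc (C j) 1) -> fundamental_on (L `|` disc (C j) 1).
Proof.
move=> cL [mL mL0 zL] [mQ mQ0 zQ]; set Q := disc (C j) 1.
have cQ : compact Q by apply: disc_compact; rewrite ler1n.
have [|||d12 d12_0 Q2] := @disc_nbhd (C j) 1 2; rewrite ?ltr1n ?ltr0n ?ler_nat//.
have [|||d23 d23_0 Q3] := @disc_nbhd (C j) 2 3; rewrite ?ltr_nat ?ler_nat//.
pose rho := Num.min (Num.min mL mQ) (d12 / 2).
have rho0 : 0 < rho by rewrite !lt_min mL0 mQ0 divr_gt0.
have rhoL : rho <= mL by rewrite !ge_min lexx.
have rhoQ : rho <= mQ by rewrite !ge_min lexx orbT.
have rho12 : rho + rho <= d12 by rewrite [leRHS]splitr lerD// ge_min lexx orbT.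
pose X := L `&` Q.
have XQ : X `<=` cdisc (ch_inv (C j)) (ch_center (C j)) (ch_rad (C j)).
  by move=> x [_]; rewrite /Q /disc mul1r.
have [rho' rho'0 chX] := chart_chain (chP (C j)) G rho0 XQ.
have q0 : 0 < Num.min rho' d12 by rewrite lt_min rho'0.
have [a1 a10 a1P] := compact_near_inter cL cQ q0.
pose a := Num.min (Num.min mL mQ) (a1 / 2).
have a0 : 0 < a by rewrite !lt_min mL0 mQ0 divr_gt0.
have aL : a <= mL by rewrite !ge_min lexx.
have aQ : a <= mQ by rewrite !ge_min lexx orbT.
have aa1 : a <= a1 / 2 by rewrite ge_min lexx orbT.
have a20 : 0 < a / 2 by rewrite divr_gt0.
exists (a / 2) => // e e0.
have [d dP0 dP] : exists2 d, 0 < d & forall i y, disc (C i) 2 y ->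
    (forall s, finel d s -> dc (th (C i) y) s = 0) /\
    (forall s, finel d s -> th (C i) y s != 0 -> forall x, x \in s -> ball y (Num.min (a / 2) rho) x).
  by apply: th_unif; rewrite lt_min a20.
have [eP [eP0 ePe ePd ePa]] : exists eP, [/\ 0 < eP, eP <= e, eP <= d & eP <= a1 / 2].
  exists (Num.min (Num.min e d) (a1 / 2)).
  by rewrite !lt_min !ge_min e0 dP0 divr_gt0// !lexx !orbT.
have [e1 e10 chE] := chX _ eP0.
pose ez := Num.min (Num.min e1 eP) d23.
have ez0 : 0 < ez by rewrite /ez lt_min d23_0 andbT lt_min e10.
have ez1 : ez <= e1 by rewrite !ge_min lexx.
have ezP : ez <= eP by rewrite !ge_min lexx orbT.
have ez23 : ez <= d23 by rewrite !ge_min lexx !orbT.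
have [z [zs zb zv]] := zL _ ez0; have [z' [zs' zb' zv']] := zQ _ ez0.
pose y := z ++ oppc z'.
have evy F : ev F y = ev F z - ev F z' by rewrite ev_cat ev_opp.
have yP p : p \in y -> size p.2 = N.+1 /\ finel ez p.2.
  by rewrite mem_cat => /orP[/zs//|/mem_scalec[q qz ->]]; exact: zs'.
(* [chart_chain] can treat only the part inside the chart; the part left out stays off the disc of
   radius 2, hence away from [Q]. *)
pose in3 (s : seq M) := all (fun x => `[< disc (C j) 3 x >]) s.
pose near := [seq p <- y | in3 p.2]; pose far := [seq p <- y | ~~ in3 p.2].
have evnf F : ev F near = ev F z - ev F z' - ev F far.
  by rewrite -evy (filter_ev y in3) addrK.
have far_off p : p \in far -> forall x, x \in p.2 -> ~ disc (C j) 2 x.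
  rewrite mem_filter => /andP[n3 /yP[_ fp]] x xp x2; case/negP: n3.
  apply/allP => x' xp'; apply/asboolP; apply: Q3; exists x => //.
  by apply: le_ball (fp _ _ xp xp').
have [p||v vX|W [S [ESW fW fS]]] := chE near.
- rewrite mem_filter => /andP[/allP i3 /yP[sz fp]]; split=> //; first exact: finel_le fp.
  by move=> x /i3/asboolP.
- move=> F F0; rewrite evnf zb ?zb' ?subrr ?sub0r.
  + rewrite ev_0 ?oppr0// => p pf; apply: ev_0 => q qb; apply: F0.
      apply: finel_bd1 qb _; move: pf; rewrite mem_filter => /andP[_ /yP[_]].
      exact: finel_le.
    move=> x /(bd1_mem qb) xp [x' [_ Qx'] b]; apply: (far_off _ pf _ xp); apply: Q2.
    by exists x' => //; apply: le_ball b; apply: le_trans rho12; rewrite lerDl ltW.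
  + move=> s fs sn; apply: F0; first exact: finel_le fs.
    by move=> x xs [x' [_ Qx'] b]; apply: (sn x xs); exists x' => //; exact: le_ball b.
  + move=> s fs sn; apply: F0; first exact: finel_le fs.
    by move=> x xs [x' [Lx' _] b]; apply: (sn x xs); exists x' => //; exact: le_ball b.
- move=> v2; have [w wd] := degree_exists v2.
  have nL : nearset L mL v by have [x [Lx _] b] := vX; exists x => //; exact: le_ball b.
  have nQ : nearset Q mQ v by have [x [_ Qx] b] := vX; exists x => //; exact: le_ball b.
  have := evnf (th (C j) v); rewrite (zv _ _ _ nL v2 wd) (zv' _ _ _ nQ v2 wd) subrr sub0r => ->.
  rewrite ev_0 ?oppr0// => p pf; apply/eqP/negPn/negP => nz.
  have [x xp] : exists x, x \in p.2.
    case: p.2 nz => [|x s _]; last by exists x; exact: mem_head.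
    by rewrite th_size ?eqxx.
  apply: (far_off _ pf _ xp); have [_ h] := dP j v v2.
  have fp : finel d p.2.
    move: pf; rewrite mem_filter => /andP[_ /yP[_]]; apply: finel_le.
    exact: le_trans ezP ePd.
  apply: Q2; have [x' [_ Qx'] b] := vX; exists x' => //; apply: le_ball rho12 _ _.
  apply: ball_triangle b _; apply: le_ball (h _ fp nz _ xp).
  by rewrite ge_min lexx orbT.
pose T := S ++ far.
have TP p : p \in T -> [/\ size p.2 = N.+1, finel eP p.2 &
    forall x, x \in p.2 -> ~ nearset X (Num.min rho' d12) x].
  rewrite mem_cat => /orP[/fS[sz fp op]|pf].
    split=> // x xp h; apply: (op x xp); apply: nearset_le h.
    by rewrite ge_min lexx.
  have := pf; rewrite mem_filter => /andP[_ /yP[sz fp]]; split=> //; first exact: finel_le fp.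
  move=> x xp [x' [_ Qx'] b]; apply: (far_off _ pf _ xp); apply: Q2; exists x' => //.
  by apply: le_ball b; rewrite ge_min lexx orbT.
pose mt (s : seq M) := has (fun x => `[< nearset Q a x >]) s.
pose T1 := [seq p <- T | mt p.2]; pose T2 := [seq p <- T | ~~ mt p.2].
have T1off p : p \in T1 -> forall x, x \in p.2 -> ~ nearset L a x.
  rewrite mem_filter => /andP[/hasP[x xp /asboolP Qx] /TP[_ fp op]] x' xp' Lx'.
  apply: (op x' xp'); apply: a1P.
    by apply: nearset_le Lx'; apply: le_trans aa1 _; rewrite ler_pdivrMr// ler_peMr ?(ltW a10)// ler1n.
  rewrite [a1]splitr; apply: nearset_ball (nearset_le aa1 Qx) _.
  by apply: le_ball ePa _ _; exact: fp.
have T2off p : p \in T2 -> forall x, x \in p.2 -> ~ nearset Q a x.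
  rewrite mem_filter => /andP[/hasPn h _] x /h/asboolPn; exact.
(* Near [Q] the glued chain is [z']. By [evzz] it is also [z] up to a boundary and the lists of
   [T1], which is its form near [L]. *)
pose zz := z' ++ T2.
have evzz F : ev F zz = ev F z - ev (dc F) W - ev F T1.
  have e2 : ev F z - ev F z' = ev (dc F) W + ev F T1 + ev F T2.
    by rewrite -addrA -(filter_ev T mt) ev_cat addrA -ESW evnf subrK.
  by rewrite ev_cat; move: e2 => /(canRL (subrK _)) ->; ring.
have T0 F (z0 : chain G M) (A : set M) : (forall p, p \in z0 -> finel eP p.2 /\
      forall x, x \in p.2 -> ~ A x) ->
    (forall s, finel eP s -> (forall x, x \in s -> ~ A x) -> F s = 0) -> ev (dc F) z0 = 0.
  move=> zA F0; apply: ev_0 => p pz; apply: ev_0 => q qb; have [fp op] := zA _ pz.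
  by apply: F0; [exact: finel_bd1 qb fp | move=> x /(bd1_mem qb); exact: op].
exists zz; split.
- move=> p; rewrite mem_cat => /orP[/zs'[sz fp]|].
    by split=> //; apply: finel_le fp; exact: le_trans ezP ePe.
  by rewrite mem_filter => /andP[_ /TP[sz fp _]]; split=> //; exact: finel_le fp.
- move=> F F0.
  (* [F1] vanishes on lists away from [Q], and [F2] on fine lists away from [L]; each is tested on
     the form of the chain adapted to it. *)
  pose F1 s := if mt s then F s else 0; pose F2 s := if mt s then 0 else F s.
  have E12 s : F s = F1 s + F2 s by rewrite /F1 /F2; case: (mt s); rewrite ?addr0 ?add0r.
  have -> : ev (dc F) zz = ev (dc F1) zz + ev (dc F2) zz.
    by rewrite -ev_addf; apply: eq_ev => s; rewrite -dcD; exact: eq_dc.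
  have -> : ev (dc F1) zz = 0.
    have F10 s : (forall x, x \in s -> ~ nearset Q a x) -> F1 s = 0.
      move=> h; rewrite /F1; case: ifP => // /hasP[x xs /asboolP]; by move/(h x xs).
    rewrite ev_cat zb' ?add0r; last first.
      by move=> s _ h; apply: F10 => x xs h'; apply: (h x xs); exact: nearset_le h'.
    apply: (T0 _ _ (nearset Q a)) => [p pT|s _]; last exact: F10.
    split; last exact: T2off.
    by move: pT; rewrite mem_filter => /andP[_ /TP[]].
  have F20 s : finel e s -> (forall x, x \in s -> ~ nearset L a x) -> F2 s = 0.
    move=> fs h; rewrite /F2; case: ifPn => // /hasPn h'; apply: F0 => // x xs [x' [Lx'|Qx'] b].
      apply: (h x xs); exists x' => //; apply: le_ball b.
      by rewrite ler_pdivrMr// ler_peMr ?(ltW a0)// ler1n.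
    move/asboolPn: (h' x xs); apply; exists x' => //; apply: le_ball b.
    by rewrite ler_pdivrMr// ler_peMr ?(ltW a0)// ler1n.
  rewrite add0r evzz zb ?sub0r; last first.
    move=> s fs h; apply: F20; first by apply: finel_le fs; exact: le_trans ezP ePe.
    by move=> x xs h'; apply: (h x xs); exact: nearset_le h'.
  rewrite (T0 F2 T1 (nearset L a)).
  - by rewrite subr0 ev_0 ?oppr0// => p _; exact: dcK.
  - move=> p pT; split; last exact: T1off.
    by move: pT; rewrite mem_filter => /andP[_ /TP[]].
  - by move=> s fs; apply: F20; exact: finel_le fs.
- move=> i v w vn v2 vw; have [h1 h2] := dP i v v2.
  have off (z0 : chain G M) A : nearset A (a / 2) v -> (forall p, p \in z0 -> finel eP p.2 /\
      forall x, x \in p.2 -> ~ nearset A a x) -> ev (th (C i) v) z0 = 0.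
    move=> Av z0P; apply: ev_0 => p pz; have [fp op] := z0P _ pz.
    apply/eqP/negPn/negP => nz; have [x xp] : exists x, x \in p.2.
      case: p.2 nz => [|x s _]; last by exists x; exact: mem_head.
      by rewrite th_size ?eqxx.
    apply: (op x xp); rewrite [a]splitr; apply: nearset_ball Av _.
    apply: le_ball (h2 _ (finel_le ePd fp) nz _ xp).
    by rewrite ge_min lexx.
  have [Lv|Qv] : nearset L (a / 2) v \/ nearset Q (a / 2) v.
    by case: vn => x [Lx|Qx] b; [left|right]; exists x.
  + have aL' : nearset L mL v.
      apply: nearset_le Lv; apply: le_trans aL.
      by rewrite ler_pdivrMr// ler_peMr ?(ltW a0)// ler1n.
    rewrite evzz (zv _ _ _ aL' v2 vw) (off T1 L)//; last first.
      move=> p pT; split; last exact: T1off.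
      by move: pT; rewrite mem_filter => /andP[_ /TP[]].
    rewrite ev_0 ?subr0// => p /fW fp; apply: h1; exact: finel_le fp.
  + have aQ' : nearset Q mQ v.
      apply: nearset_le Qv; apply: le_trans aQ.
      by rewrite ler_pdivrMr// ler_peMr ?(ltW a0)// ler1n.
    rewrite ev_cat (zv' _ _ _ aQ' v2 vw) (off T2 Q) ?addr0//.
    move=> p pT; split; last exact: T2off.
    by move: pT; rewrite mem_filter => /andP[_ /TP[]].
Qed.

Lemma fundamental_bigcup : (forall j, fundamental_on (disc (C j) 1)) ->
  fundamental_on (\bigcup_j disc (C j) 1).
Proof.
move=> fj.
have h (l : seq 'I_k) : compact [set x | exists2 j, j \in l & disc (C j) 1 x] /\
    fundamental_on [set x | exists2 j, j \in l & disc (C j) 1 x].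
  elim: l => [|j l [cl fl]].
    have -> : [set x | exists2 j, j \in [::] & disc (C j) 1 x] = set0.
      by apply/seteqP; split=> x //= [].
    by split; [exact: compact0 | exact: fundamental_on0].
  have -> : [set x | exists2 i, i \in j :: l & disc (C i) 1 x] =
      [set x | exists2 j, j \in l & disc (C j) 1 x] `|` disc (C j) 1.
    apply/seteqP; split=> x /=.
      by move=> [i]; rewrite in_cons => /orP[/eqP -> ?|il di]; [right|left; exists i].
    by move=> [[i il di]|dj]; [exists i => //; rewrite in_cons il orbT|exists j => //; exact: mem_head].
  split; last exact: fundamental_glue.
  by apply: compactU => //; apply: disc_compact; rewrite ler1n.
have [_] := h (enum 'I_k).
suff -> : [set x | exists2 j, j \in enum 'I_k & disc (C j) 1 x] = \bigcup_j disc (C j) 1 by [].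
apply/seteqP; split=> x /=; first by move=> [j _ dj]; exists j.
by move=> [j _ dj]; exists j => //; rewrite mem_enum.
Qed.

End Gluing.

(** * Transport of local classes *)

Lemma connected_induction (R : realType) (T : pseudoMetricType R) (S : set T) (P : T -> Prop) x0 :
  connected S -> S x0 -> P x0 ->
  (forall x, S x -> exists2 d, 0 < d & forall x', S x' -> ball x d x' -> P x <-> P x') ->
  forall x, S x -> P x.
Proof.
move=> cS Sx0 Px0 loc x Sx.
have op (Q : T -> Prop) : (forall x, S x -> exists2 d, 0 < d & forall x', S x' -> ball x d x' -> Q x -> Q x') ->
    exists2 U, open U & S `&` [set x | Q x] = S `&` U.
  move=> locQ; exists (interior [set x | S x -> Q x]); first exact: open_interior.
  apply/seteqP; split=> y [Sy Qy]; split=> //; last exact: (interior_subset Qy).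
  have [d d0 dP] := locQ y Sy; apply/nbhs_ballP; exists d => // z b Sz.
  exact: dP Qy.
have [|U oU eU] := op P.
  by move=> y /loc[d d0 dP]; exists d => // z Sz /(dP z Sz)[].
have [|U' oU' eU'] := op (fun x => ~ P x).
  by move=> y /loc[d d0 dP]; exists d => // z Sz /(dP z Sz)[_ h] nP /h.
suff e : S `&` [set x | P x] = S by have : S x by []; rewrite -e => -[].
apply: cS; first by exists x0.
  by exists U.
exists (~` U'); first exact: open_closedC.
apply/seteqP; split=> y [Sy h]; split=> //.
  by move=> Uy; have : (S `&` U') y by []; rewrite -eU' => -[_].
apply: contrapT => nP; apply: h; have : (S `&` [set x | ~ P x]) y by [].
by rewrite eU' => -[].
Qed.

Section Transport.
Variables (R : realType) (M : metricType R) (n : nat) (G : comNzRingType).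
Local Notation N := n.+1.
Variables (k : nat) (C : 'I_k -> chart M n).
Hypothesis Ccov : forall x, exists i, disc (C i) 1 x.
Local Notation th i := (@th R M n G (C i)).

(** Near [x'] the cocycle of [x] is a top cocycle with compact support in the chart of [x'], hence a
    multiple of the generator there up to a coboundary of small support. *)
Lemma local_transport rho : 0 < rho -> exists2 d, 0 < d & forall i i' x x',
  disc (C i) 2 x -> disc (C i') 1 x' -> ball x d x' ->
  exists (a : G) H e, [/\ 0 < e, forall s, size s = N.+1 -> finel e s ->
      th i x s = a * th i' x' s + dc H s &
    forall s, finel e s -> (forall z, z \in s -> ~ ball x' rho z) -> H s = 0].
Proof.
move=> rho0; have [|i' _|d d0 dP] := @seq_unif R _ (enum 'I_k) (fun d i' => forall i x x',
  disc (C i) 2 x -> disc (C i') 1 x' -> ball x d x' ->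
  exists (a : G) H e, [/\ 0 < e, forall s, size s = N.+1 -> finel e s ->
      th i x s = a * th i' x' s + dc H s &
    forall s, finel e s -> (forall z, z \in s -> ~ ball x' rho z) -> H s = 0]).
- move=> d d' i' d'0 dd h i x x' dx dx' b; apply: h dx dx' _; exact: le_ball b.
- have r0 := ch_rad_gt0 (C i').
  have [b0 b00 b0P] := chart_inv_unif (chP (C i')) rho0.
  pose b := Num.min b0 (ch_rad (C i')).
  have b_gt0 : 0 < b by rewrite lt_min b00.
  have a0 : 0 < b / 2 by rewrite divr_gt0.
  have ab : b / 2 < b by rewrite ltr_pdivrMr// ltr_pMr// ltr1n.
  have br : b <= ch_rad (C i') by rewrite ge_min lexx orbT.
  have [d1 d10 d1P] := chart_unif (chP (C i')) a0.
  have [|||d2 d20 d2P] := @disc_nbhd _ _ _ (C i') 1 4; rewrite ?ltr1n ?ltr0n//.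
  pose d := Num.min d1 d2.
  have d_gt0 : 0 < d by rewrite lt_min d10.
  have d2_0 : 0 < d / 2 by rewrite divr_gt0.
  have [e e0 eP] := th_unif G C d2_0.
  exists (d / 2) => // i x x' dx dx' bxx'; have [h1 h2] := eP i x dx.
  have dx'1 : cdisc (ch_inv (C i')) (ch_center (C i')) (ch_rad (C i')) x'.
    by move: dx'; rewrite /disc mul1r.
  have x'dom : disc (C i') 4 x' by apply: disc_le dx'; rewrite ler1n.
  have [|a [H [e' [e'0 E H0]]]] := chart_cocycle (chP (C i')) e0 a0 ab br dx'1 (fun s _ => h1 s).
    move=> s sz fs sn; apply/eqP/negPn/negP => nz.
    have [z zs] : exists z, z \in s by case: s sz {fs sn nz} => // z s _; exists z; exact: mem_head.
    have bz : ball x' d z by rewrite [d]splitr; apply: ball_triangle (ball_sym bxx') (h2 _ fs nz z zs).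
    have zd : disc (C i') 4 z by apply: d2P; exists x' => //; apply: le_ball bz; rewrite ge_min lexx orbT.
    apply: (sn z zs); split=> //; apply: d1P => //.
    by apply: le_ball bz; rewrite ge_min lexx.
  exists a, H, e'; split=> // s fs sn; apply: H0 => // z zs [zd bz]; apply: (sn z zs).
  have [gx fx] := chartP (chP (C i')) x'dom; have [gz fz] := chartP (chP (C i')) zd.
  rewrite -gx -gz; apply: b0P => //; apply: le_ball bz.
  by rewrite ge_min lexx.
by exists d => // i i' x x'; apply: dP; rewrite mem_enum.
Qed.

(** The primitive may be nonzero only on lists meeting the points of depth [rho] in [W]: a uniform
    form of support in [W], stable under composition. *)
Definition transported (W : set M) (F F' : seq M -> G) : Prop :=
  exists (a : G) H e rho, [/\ 0 < e, 0 < rho,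
    forall s, size s = N.+1 -> finel e s -> F s = a * F' s + dc H s &
    forall s, finel e s -> (forall z, z \in s -> ~ (ball z rho `<=` W)) -> H s = 0].

Lemma transported_trans W F F' F'' :
  transported W F F' -> transported W F' F'' -> transported W F F''.
Proof.
move=> [a [H [e [r [e0 r0 E H0]]]]] [a' [H' [e' [r' [e'0 r'0 E' H'0]]]]].
exists (a * a'), (fun s => a * H' s + H s), (Num.min e e'), (Num.min r r').
split; rewrite ?lt_min ?e0 ?r0//.
- move=> s sz fs; rewrite dcD dcZ E// ?E'//; last by apply: finel_le fs; rewrite ge_min lexx.
    by rewrite mulrDr mulrA addrA.
  by apply: finel_le fs; rewrite ge_min lexx orbT.
- move=> s fs sn; rewrite H0 ?H'0 ?mulr0 ?addr0//.
  + by apply: finel_le fs; rewrite ge_min lexx orbT.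
  + move=> z zs h; apply: (sn z zs) => y b; apply: h; apply: le_ball b.
    by rewrite ge_min lexx orbT.
  + by apply: finel_le fs; rewrite ge_min lexx.
  + move=> z zs h; apply: (sn z zs) => y b; apply: h; apply: le_ball b.
    by rewrite ge_min lexx.
Qed.

Lemma transported_local (W : set M) r : 0 < r -> exists2 d, 0 < d & forall i i' x x',
  disc (C i) 1 x -> disc (C i') 1 x' -> ball x d x' -> ball x' r `<=` W ->
  transported W (th i x) (th i' x').
Proof.
move=> r0; have r20 : 0 < r / 2 by rewrite divr_gt0.
have [d d0 dP] := local_transport r20; exists d => // i i' x x' xd x'd b bW.
have x2 : disc (C i) 2 x by apply: disc_le xd; rewrite ler1n.
have [a [H [e [e0 E H0]]]] := dP i i' x x' x2 x'd b.
exists a, H, e, (r / 2); split=> // s fs sn; apply: H0 => // z zs bz.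
apply: (sn z zs) => y byz; apply: bW; rewrite [r]splitr; exact: ball_triangle bz byz.
Qed.

Lemma transported_connected (S W : set M) i i' x x' : connected S ->
  (forall y, S y -> nbhs y W) -> S x -> S x' -> disc (C i) 1 x -> disc (C i') 1 x' ->
  transported W (th i x) (th i' x').
Proof.
move=> cS SW Sx Sx' xd x'd.
suff h : forall y, S y -> forall j, disc (C j) 1 y -> transported W (th i x) (th j y).
  exact: h.
have bl y : S y -> exists2 d, 0 < d & forall j j' z z', disc (C j) 1 z -> disc (C j') 1 z' ->
    ball y d z -> ball y d z' -> transported W (th j z) (th j' z').
  move=> /SW/nbhs_ballP[r /= r0 rW]; have r20 : 0 < r / 2 by rewrite divr_gt0.
  have [d d0 dP] := transported_local W r20.
  have m0 : 0 < Num.min (d / 2) (r / 2) by rewrite lt_min !divr_gt0.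
  exists (Num.min (d / 2) (r / 2)) => // j j' z z' zd z'd bz bz'; apply: dP => //.
    rewrite [d]splitr; apply: ball_triangle (ball_sym (le_ball _ bz)) (le_ball _ bz');
    by rewrite ge_min lexx.
  move=> w bw; apply: rW; rewrite [r]splitr; apply: ball_triangle (le_ball _ bz') bw.
  by rewrite ge_min lexx orbT.
have bxx (y : M) d : 0 < d -> ball y d y by move=> d0; exact: ballxx.
apply: (@connected_induction R M S _ x cS Sx).
  by have [d d0 dP] := bl x Sx; move=> j xj; apply: dP => //; exact: bxx.
move=> y /bl[d d0 dP]; exists d => // z Sz b.
have [jy jyP] := Ccov y; have [jz jzP] := Ccov z.
split=> h j jd.
  by apply: transported_trans (h jy jyP) _; apply: dP => //; exact: bxx.
by apply: transported_trans (h jz jzP) _; apply: dP => //; exact: bxx.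
Qed.

(** The route leads from [x] to a close point of [K], along [K] by connectedness, and out to [x'].
    The distance [d] is fixed before the points, which are later picked within it. *)
Lemma transported_near (K W : set M) r : connected K -> 0 < r ->
  (forall y, K y -> ball y r `<=` W) -> exists2 d, 0 < d & forall i i' x x',
    nearset K d x -> nearset K d x' -> disc (C i) 1 x -> disc (C i') 1 x' ->
    transported W (th i x) (th i' x').
Proof.
move=> cK r0 rW; have r20 : 0 < r / 2 by rewrite divr_gt0.
have [d d0 dP] := transported_local W r20.
exists (Num.min d (r / 2)) => [|i i' x x' [y Ky b] [y' Ky' b'] xd x'd]; first by rewrite lt_min d0.
have [j jP] := Ccov y; have [j' j'P] := Ccov y'.
apply: (@transported_trans _ _ (th j y)).
  apply: dP => //; first by apply/ball_sym; apply: le_ball b; rewrite ge_min lexx.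
  by apply: subset_trans (rW y Ky); apply: le_ball; rewrite ler_pdivrMr// ler_peMr ?(ltW r0)// ler1n.
apply: (@transported_trans _ _ (th j' y')).
  by apply: (transported_connected cK) => // z Kz; apply/nbhs_ballP; exists r => //; exact: rW.
apply: dP => //; first by apply: le_ball b'; rewrite ge_min lexx.
move=> z bz; apply: (rW y' Ky'); rewrite [r]splitr; apply: ball_triangle (le_ball _ b') bz.
by rewrite ge_min lexx orbT.
Qed.

End Transport.

(** The near-covering form of compactness, applied to the filter of finite lists ordered by
    inclusion. *)
Lemma compact_finite_cover (X : topologicalType) (U : X -> set X) : compact [set: X] ->
  (forall x, nbhs x (U x)) -> exists l : seq X, forall x, exists2 y, y \in l & U y x.
Proof.
move=> /compact_near_coveringP cX nU.
pose F : set_system (seq X) := filter_from setT (fun l0 : seq X => [set l : seq X | {subset l0 <= l}]).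
have FF : Filter F.
  apply: filter_from_filter; first by exists [::].
  move=> l1 l2 _ _; exists (l1 ++ l2) => // l h.
  by split=> x xl; apply: h; rewrite mem_cat xl ?orbT.
have [|l _ lP] := cX _ F (fun l x => exists2 y, y \in l & U y x) FF.
  move=> x _; exists (U x, [set l : seq X | {subset [:: x] <= l}]) => /=.
    by split; [exact: nU | exists [:: x]].
  by move=> [x' l] /= [Ux' h]; exists x => //; apply: h; exact: mem_head.
by exists l => x; exact: (lP l).
Qed.

(** * The fundamental class of the whole manifold *)

Section Atlas.
Variables (R : realType) (M : metricType R) (n : nat) (G : comNzRingType).
Hypothesis G_idom : forall a b : G, a * b = 0 -> a = 0 \/ b = 0.
Local Notation N := n.+1.
Variable mu : forall x : M, sing_homology R G (~` [set x]) N.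
Hypothesis muP : orientation mu.

Lemma atlas_exists (x0 : M) : closed_manifold M N -> exists k (C : 'I_k -> chart M n),
  (forall x, exists i, disc (C i) 1 x) /\ fundamental_on C mu setT.
Proof.
move=> [cM lE].
have chx (x : M) : exists C : chart M n, nbhs x (disc C 1) /\
    exists2 U, disc C 4 `<=` U & exists muU : sing_homology R G (~` U) N,
      forall y (Uy : U y), rel_map (setC_point Uy) muU = mu y.
  have [_ /(_ x)[U Ux [muU muUP]]] := muP.
  have [f [g [c [r [ch gc cU]]]]] := chart_exists lE Ux.
  have [r0 _ _ _ og] := ch.
  exists (Chart ch); split; last by exists U => //; exists muU.
  have : nbhs x (g @` ball c r).
    apply: open_nbhs_nbhs; split; first by apply: og; rewrite // ler_peMl ?ler1n// ltW.
    by exists c => //; exact: ballxx.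
  by apply: filterS => _ [v bv <-]; exists v => //=; rewrite mul1r; exact: ball_cball.
have [C CP] := choice chx.
have [|l lP] := compact_finite_cover (U := fun x => disc (C x) 1) cM.
  by move=> x; have [] := CP x.
exists (size l), (fun i : 'I_(size l) => C (nth x0 l i)).
have cov x : exists i : 'I_(size l), disc (C (nth x0 l i)) 1 x.
  have [y yl xy] := lP x.
  have yi : (index y l < size l)%N by rewrite index_mem.
  by exists (Ordinal yi); rewrite /= nth_index.
split=> //; have -> : setT = \bigcup_(i : 'I_(size l)) disc (C (nth x0 l i)) 1.
  by apply/esym/seteqP; split=> x // _; have [i xi] := cov x; exists i.
apply: fundamental_bigcup => i; have [_ [U CU [muU muUP]]] := CP (nth x0 l i).
have [|||d d0 dP] := @disc_nbhd _ _ _ (C (nth x0 l i)) 1 4; rewrite ?ltr1n ?ltr0n//.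
by apply: fundamental_disc d0 _ muUP => y /dP/CU.
Qed.

(** Evaluation on a fundamental chain at the fineness of the primitive kills the coboundary and
    leaves [a] times a local degree, which is nonzero because the orientation consists of
    generators. *)
Lemma fundamental_exact k (C : 'I_k -> chart M n) i y (a : G) H e :
  fundamental_on C mu setT -> 0 < e -> disc (C i) 1 y ->
  (forall s, size s = N.+1 -> finel e s -> a * th G (C i) y s = dc H s) -> a = 0.
Proof.
move=> [m m0 zP] e0 yd E; have y2 : disc (C i) 2 y by apply: disc_le yd; rewrite ler1n.
have [z [zs zb zv]] := zP e e0.
have [v vd] := degree_exists mu y2.
have vn0 : v != 0 by apply: (thM_generator_neq0 (chP (C i)) y2 (muP.1 y)) vd.
have : ev (fun s => a * th G (C i) y s) z = 0.
  (* The chain is a cycle only against cochains that vanish on the empty list, the one list without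
     a point near [M]. *)
  pose F s := if s is [::] then 0 else H s.
  rewrite -[RHS](zb F).
    apply: eq_ev_in => p /zs[sz fp]; rewrite E//; apply: eq_dc_in => t _.
    by rewrite sz => -[]; case: t.
  by case=> [|x s] _ h //; case: (h x (mem_head _ _)); exists x => //; exact: ballxx.
rewrite ev_scalef (zv i y v)//; last by exists y => //; exact: ballxx.
by move=> /G_idom[|v0] //; rewrite v0 eqxx in vn0.
Qed.

End Atlas.

(** * Cech cohomology and cochains on lists *)

Definition list_cochain (G : comNzRingType) (X : topologicalType) (q : nat)
    (F : seq X -> G) : cochain X G q :=
  fun s => F (map s (enum 'I_q.+1)).
Arguments list_cochain {G X} q F s.

Section ListCochains.
Variable G : comNzRingType.

Lemma list_cochain_cobound (X : topologicalType) q (F : seq X -> G) s :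
  cobound (list_cochain q F) s = dc F (map s (enum 'I_q.+2)).
Proof.
rewrite dcE size_map size_enum_ord /cobound; apply: eq_bigr => i _; congr (_ * F _).
by rewrite -map_take -map_drop -map_cat del_enum -map_comp.
Qed.

Lemma map_nth_enum_ord (T : Type) (x0 : T) (s : seq T) q : size s = q ->
  map (fun i : 'I_q => nth x0 s i) (enum 'I_q) = s.
Proof.
move=> <-; apply: (@eq_from_nth _ x0) => [|i]; first by rewrite size_map size_enum_ord.
rewrite size_map size_enum_ord => il.
case: (posnP (size s)) => [s0|s0]; first by rewrite s0 in il.
rewrite (nth_map (Ordinal il)) ?size_enum_ord//; congr nth.
by rewrite nth_enum_ord.
Qed.

Variables (R : realType) (M : metricType R).

Lemma list_cochain_cocycle q (F : seq M -> G) e : 0 < e ->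
  (forall s, size s = q.+2 -> finel e s -> dc F s = 0) ->
  list_cochain q F \in @cech_cocycle M G q.
Proof.
move=> e0 Fd; have e20 : 0 < e / 2 by rewrite divr_gt0.
rewrite unfold_in; apply/asboolP; exists (fun x => interior (ball x (e / 2))).
  by move=> x; split; [exact: open_interior | exact: nbhsx_ballx].
move=> s [y ys]; rewrite list_cochain_cobound; apply: Fd; first by rewrite size_map size_enum_ord.
move=> _ _ /mapP[i _ ->] /mapP[j _ ->]; rewrite [e]splitr.
by apply: (@ball_triangle _ _ y); [|apply: ball_sym]; apply: interior_subset; exact: ys.
Qed.

Variable K : set M.

(** Tautness of [K]: a class that vanishes on [K] vanishes near [K]. Points near [K] are pushed into
    [K] by a map that need not be continuous but moves them little, and a prism compares [F] with
    the pushed cochain. *)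
Lemma cech_coboundary_near q (F : seq M -> G) e : compact K -> K !=set0 -> 0 < e ->
  (forall s, size s = q.+2 -> finel e s -> (forall x, x \in s -> nearset K e x) -> dc F s = 0) ->
  cochain_pull (set_val : K -> M) (list_cochain q F) \in @cech_coboundary K G q ->
  exists (xi : seq M -> G) d, [/\ 0 < d, xi [::] = 0 & forall s, size s = q.+1 -> finel d s ->
    (forall x, x \in s -> nearset K d x) -> F s = dc xi s].
Proof.
move=> cK [y0 Ky0] e0 Fd Fcob.
(* The primitive is normalized to vanish on the empty list; in degree 0 a coboundary is zero on a
   nerve, and the zero primitive serves. *)
have [U pU [xi0 xi00 xi0P]] : exists2 U : K -> set K, pointed_cover U & exists2 xi0 : seq K -> G, xi0 [::] = 0 &
    forall s : seq K, size s = q.+1 -> (exists v, forall x, x \in s -> U x v) ->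
    F (map val s) = dc xi0 s.
  pose u0 : K := exist _ y0 (mem_set Ky0).
  have nv (U : K -> set K) s (sz : size s = q.+1) : (exists v, forall x, x \in s -> U x v) ->
      nerve U (fun i : 'I_q.+1 => nth u0 s i).
    by move=> [v vP]; exists v => i _; apply: vP; rewrite mem_nth// sz.
  have fE s (sz : size s = q.+1) : cochain_pull (set_val : K -> M) (list_cochain q F)
      (fun i : 'I_q.+1 => nth u0 s i) = F (map val s).
    by rewrite /cochain_pull /list_cochain -[in RHS](map_nth_enum_ord u0 sz) -[in RHS]map_comp.
  case: q Fd Fcob nv fE => [|q] Fd; rewrite unfold_in /= => /asboolP[U pU].
    move=> cU nv fE; exists U => //; exists (fun=> 0) => // s sz sv.
    by rewrite /dc ev_0// -(fE s sz) cU//; exact: nv.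
  move=> [g gP] nv fE; exists U => //.
  exists (fun l => if size l == 0 then 0 else g (fun i : 'I_q.+1 => nth u0 l i)) => // s sz sv.
  rewrite -(fE s sz) gP; last exact: nv.
  set xi := fun l => _; rewrite -[in RHS](map_nth_enum_ord u0 sz) -list_cochain_cobound.
  rewrite /cobound; apply: eq_bigr => i _; congr (_ * _).
  rewrite /list_cochain /xi size_map size_enum_ord /=; congr g; apply/funext => j.
  by rewrite (nth_map ord0) ?size_enum_ord// nth_ord_enum.
have e1_0 : 0 < e / 8 by rewrite divr_gt0.
have [d0 d0_0 d0P] : exists2 d, 0 < d & forall y, K y -> exists u : K, ball y (e / 8) (val u) /\
    forall v : K, ball y d (val v) -> U u v.
  apply: compact_unif cK _ _.
    move=> d d' x d'0 dd [u [bu h]]; exists u; split=> // v b; apply: h; exact: le_ball b.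
  move=> y Ky; pose u : K := exist _ y (mem_set Ky).
  have [oU Uu] := pU u.
  have /nbhs_ballP[r /= r0 rP] : nbhs u (U u) by exact: open_nbhs_nbhs.
  exists (Num.min (r / 2) (e / 8)) => [|y' Ky' b]; first by rewrite lt_min e1_0 divr_gt0.
  exists u; split; first by apply: ball_sym; apply: le_ball b; rewrite ge_min lexx orbT.
  move=> v bv; apply: rP; rewrite -initial_ballE [r]splitr.
  by apply: ball_triangle (le_ball _ b) (le_ball _ bv); rewrite ge_min lexx.
pose d := Num.min (d0 / 3) (e / 8).
have d_gt0 : 0 < d by rewrite lt_min e1_0 divr_gt0.
have dd0 : 3 * d <= d0.
  by apply: (@le_trans _ _ (3 * (d0 / 3))); [rewrite ler_pM2l// ge_min lexx | rewrite mulrC divfK].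
have de : d <= e / 8 by rewrite ge_min lexx orbT.
clearbody d.
(* The image of [x] is an index [u] of the cover such that [U u] contains a ball of uniform radius
   around a point of [K] close to [x]: the images of a fine list then span a simplex of the
   nerve. *)
have chP' (x : M) : exists u : K, nearset K d x -> exists2 y, K y &
    [/\ ball y d x, ball y (e / 8) (val u) & forall v : K, ball y d0 (val v) -> U u v].
  have [[y Ky b]|nK] := pselect (nearset K d x).
    by have [u [bu uP]] := d0P y Ky; exists u => _; exists y.
  by exists (exist _ y0 (mem_set Ky0)).
have [P PP] := choice chP'.
pose P' := val \o P.
have bP x : nearset K d x -> ball x (d + e / 8) (P' x).
  by move=> /PP[y Ky [b b' _]]; exact: ball_triangle (ball_sym b) b'.
pose h t := ev F (prism1 G id P' t).
exists (fun t => xi0 (map P t) - h t), d; split=> // [|s sz fs sK].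
  by rewrite /h /= xi00 ev_nil subrr.
have E := prism_homotopy id P' F s; rewrite map_id in E.
rewrite (ev_0 (F := dc F)) ?addr0 in E; last first.
  move=> p pp; apply: Fd; first by rewrite (prism1_size pp) sz.
    move=> z z' /(prism1_mem pp)[x xs h1] /(prism1_mem pp)[x' xs' h2].
    have b1 (w v : M) : nearset K d w -> v = w \/ v = P' w -> ball w (d + e / 8) v.
      move=> nw [->|->]; last exact: bP.
      by apply: ballxx; rewrite addr_gt0.
    apply: (@le_ball _ _ _ ((d + e / 8) + d + (d + e / 8))); first by move: de; lra.
    apply: ball_triangle (b1 _ _ (sK _ xs') h2).
    by apply: ball_triangle (fs _ _ xs xs'); apply: ball_sym; exact: b1 (sK _ xs) h1.
  move=> z /(prism1_mem pp)[x xs [->|->]].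
    by apply: nearset_le (sK _ xs); apply: le_trans de _; rewrite ler_pdivrMr// ler_peMr ?(ltW e0)// ler1n.
  by exists (P' x); [exact: set_mem (valP (P x)) | exact: ballxx].
have E2 : F (map P' s) = dc (fun t => xi0 (map P t)) s.
  rewrite map_comp -dc_map; apply: xi0P; first by rewrite size_map.
  case: s sz fs sK {E} => // x s _ fs sK; have [v Kv [bv _ _]] := PP x (sK _ (mem_head _ _)).
  exists (exist _ v (mem_set Kv)) => _ /mapP[z zs ->]; have [w Kw [bw _ wU]] := PP z (sK _ zs).
  apply: wU => /=; apply: le_ball dd0 _ _; rewrite (_ : 3 * d = d + d + d); last by ring.
  apply: ball_triangle (ball_sym bv); apply: ball_triangle bw _.
  by apply: fs => //; exact: mem_head.
by rewrite dcB -E2 -E opprB addrC subrK.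
Qed.

End ListCochains.


Section Classes.
Variable G : comNzRingType.

Lemma subquot_class_sum (V : lmodType G) (Z B : submodClosed V) (I : Type) (r : seq I)
  (z : I -> V) (zZ : forall i, z i \in Z) (a : I -> G) :
  exists h : \sum_(j <- r) a j *: z j \in Z,
  subquot_class B h = \sum_(j <- r) a j *: subquot_class B (zZ j).
Proof.
have Z0 : (0 : V) \in Z by exact: rpred0.
elim: r => [|i r [h IH]].
  have h : \sum_(j <- [::]) a j *: z j \in Z by rewrite big_nil.
  exists h; rewrite [RHS]big_nil -(subquot_class0 B Z0); apply/subquot_classP.
  by rewrite big_nil subrr rpred0.
have h' : a i *: z i + \sum_(j <- r) a j *: z j \in Z by rewrite rpredD// rpredZ.
have h2 : \sum_(j <- i :: r) a j *: z j \in Z by rewrite big_cons.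
exists h2; rewrite [RHS]big_cons -IH -(subquot_class_linear B (zZ i) h h').
by apply/subquot_classP; rewrite big_cons subrr rpred0.
Qed.

Lemma subquot_class_eq0 (V : lmodType G) (Z B : submodClosed V) (z : V) (zZ : z \in Z) :
  subquot_class B zZ = 0 <-> z \in B.
Proof.
have [h] := @subquot_class_sum V Z B void [::] (fun=> z) (fun=> zZ) (fun=> 0).
rewrite [X in _ = X]big_nil => h0; rewrite -h0; split=> [/subquot_classP|zB].
  by rewrite big_nil subr0.
by apply/subquot_classP; rewrite big_nil subr0.
Qed.

Variables (X : topologicalType) (q c : nat) (f : 'I_c -> cochain X G q).
Hypothesis fZ : forall i, f i \in @cech_cocycle X G q.

Definition cech_class i : cech X G q := subquot_class (@cech_coboundary X G q) (fZ i).

Lemma cech_class_indep : (forall a : 'I_c -> G,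
    \sum_i a i *: f i \in @cech_coboundary X G q -> forall i, a i = 0) ->
  lin_indep cech_class.
Proof.
move=> h a; have [hZ <-] := @subquot_class_sum _ _ (@cech_coboundary X G q) _
  (index_enum 'I_c) f fZ a.
by move=> /subquot_class_eq0; exact: h.
Qed.

End Classes.

Section RestrictedClasses.
Variables (G : comNzRingType) (M : topologicalType) (K : set M) (q c : nat).
Variables (f : 'I_c -> cochain M G q) (fZ : forall i, f i \in @cech_cocycle M G q).
Local Notation pull := (@cochain_pull K M G set_val q).

Lemma pull_cocycle i : pull (f i) \in @cech_cocycle K G q.
Proof. exact: (cochain_pull_cocycle (@incl_continuous M K)). Qed.

Lemma cech_restrict_class i : cech_restrict K (cech_class fZ i) = cech_class pull_cocycle i.
Proof.
rewrite /cech_restrict /cech_map /cech_class subquot_map_class.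
  by apply/subquot_classP; rewrite subrr rpred0.
exact: (cochain_pull_coboundary (@incl_continuous M K)).
Qed.

Lemma cech_restrict_class0 i : pull (f i) = 0 -> cech_restrict K (cech_class fZ i) = 0.
Proof.
by rewrite cech_restrict_class => f0; apply/subquot_class_eq0; rewrite f0 rpred0.
Qed.

Lemma restricted_classes_indep : (forall a : 'I_c -> G,
    \sum_i a i *: pull (f i) \in @cech_coboundary K G q -> forall i, a i = 0) ->
  exists (beta : 'I_c -> cech M G q) (gamma : 'I_c -> cech K G q),
    [/\ lin_indep beta, lin_indep gamma & forall j, cech_restrict K (beta j) = gamma j].
Proof.
move=> h; exists (cech_class fZ), (cech_class pull_cocycle); split.
- apply: cech_class_indep => a /(cochain_pull_coboundary (@incl_continuous M K)) aB.
  by apply: h; move: aB; rewrite linear_sum; under eq_bigr do rewrite linearZ.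
- exact: cech_class_indep.
- exact: cech_restrict_class.
Qed.

End RestrictedClasses.

(** * Classes attached to ends *)

(* The closedness conditions say that A i is open and closed in B \ K. For the
   application B is an isolating block, the A i are c of its K-ends, and ef_joined
   connects each of them to a base end of the same component of I(K) \ K. *)
Record end_family (R : realType) (M : metricType R) (K B : set M) (c : nat)
    (A : 'I_c -> set M) : Prop := EndFamily {
  ef_compact : compact K;
  ef_nonempty : K !=set0;
  ef_connected : connected K;
  ef_nbhs : set_nbhs K B;
  ef_sub : forall i x, A i x -> B x /\ ~ K x;
  ef_disj : forall i j x, A i x -> A j x -> i = j;
  ef_closed : forall i, closed (K `|` A i);
  ef_closedC : forall i, closed (B `\` A i);
  ef_joined : forall i V, set_nbhs K V -> exists x b D,
    [/\ [/\ V x, V b & A i x], [/\ B b, ~ K b & forall j, ~ A j b] &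
        [/\ connected D, D x, D b & forall y, D y -> ~ K y]] }.

Arguments ef_closed {R M K B c A} _ i.
Arguments ef_closedC {R M K B c A} _ i.

Section EndFamily.
Variables (R : realType) (M : metricType R) (K B : set M) (c : nat) (A : 'I_c -> set M).
Hypothesis AP : end_family K B A.

Lemma ef_radius : exists2 r, 0 < r & forall y, K y -> ball y r `<=` B.
Proof.
apply: compact_unif (ef_compact AP) _ _.
  by move=> d d' x d'0 dd h y b; apply: h; exact: le_ball b.
move=> x /(ef_nbhs AP)/nbhs_ballP[r /= r0 rB]; exists (r / 2) => [|x' _ b y b'].
  by rewrite divr_gt0.
by apply: rB; rewrite [r]splitr; exact: ball_triangle b b'.
Qed.

Lemma nearset_nbhs d : 0 < d -> set_nbhs K (nearset K d).
Proof.
move=> d0 x Kx; apply/nbhs_ballP; exists d => // y b; by exists x.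
Qed.

Lemma ef_closedK : closed K.
Proof. by apply: (compact_closed _ (ef_compact AP)); exact: metric_hausdorff. Qed.

Lemma closed_radius (F : set M) x : closed F -> ~ F x ->
  exists2 d, 0 < d & forall y, ball x d y -> ~ F y.
Proof.
move=> cF nFx; have /nbhs_ballP[d /= d0 dP] : nbhs x (~` F).
  by apply: open_nbhs_nbhs; split=> //; exact: closed_openC.
by exists d.
Qed.

(** Different ends may come arbitrarily close to each other at [K], so the uniform separation is
    stated only at a distance from [K]. *)
Lemma ef_separated d i : compact [set: M] -> 0 < d -> exists2 e, 0 < e &
  forall z z', A i z -> ~ nearset K d z -> B z' -> ball z e z' -> A i z'.
Proof.
move=> cM d0; have cKA : compact (K `|` A i).
  exact: (subclosed_compact (ef_closed AP i) cM (@subsetT _ _)).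
have [|z [Kz|Az]|e e0 eP] := @compact_unif _ _ _ (fun e z => ~ nearset K d z ->
   forall z', B z' -> ball z e z' -> A i z') cKA.
- by move=> e e' x e'0 ee h n z' Bz' b; apply: h => //; exact: le_ball b.
- by exists d => // z' _ b []; exists z.
- have [|e e0 eP] := @closed_radius _ z (ef_closedC AP i); first by case.
  exists (e / 2) => [|z1 _ b1 _ z' Bz' b']; first by rewrite divr_gt0.
  apply: contrapT => nA; apply: (eP z') => //.
  by rewrite [e]splitr; exact: ball_triangle b1 b'.
by exists e => // z z' Az nz Bz' b; apply: (eP z) => //; right.
Qed.

End EndFamily.

(** * Classes in degree n - 1 *)

Section Betas.
Variables (R : realType) (M : metricType R) (n : nat) (G : comNzRingType).
Hypothesis G_idom : forall a b : G, a * b = 0 -> a = 0 \/ b = 0.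
Local Notation N := n.+1.
Variable mu : forall x : M, sing_homology R G (~` [set x]) N.
Hypotheses (muP : orientation mu) (Mn : closed_manifold M N).
Variables (K B : set M) (c : nat) (A : 'I_c -> set M).
Hypothesis AP : end_family K B A.
Variables (k : nat) (C : 'I_k -> chart M n).
Hypotheses (Ccov : forall x, exists i, disc (C i) 1 x) (Cfund : fundamental_on C mu setT).

(* Two primitives H1, H2 of the difference between the local class at x and a
   multiple of the one at b: H1 vanishes near K, and H2 is supported in B. *)
Record transport_data := TransportData {
  td_x : M; td_b : M; td_ix : 'I_k; td_ib : 'I_k; td_coef : G;
  td_H1 : seq M -> G; td_H2 : seq M -> G }.

(** One number [d] serves both as fineness and as margin, so that finitely many specifications can
    share their minimum. *)
Definition transport_spec (i : 'I_c) (t : transport_data) (d : R) : Prop :=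
  let: TransportData x b ix ib a H1 H2 := t in
  [/\ disc (C ix) 1 x, A i x &
   forall s, finel d s ->
    [/\ size s = N.+1 -> th G (C ix) x s = a * th G (C ib) b s + dc H1 s /\
          th G (C ix) x s = a * th G (C ib) b s + dc H2 s,
        (forall z, z \in s -> ~ (ball z d `<=` ~` K)) -> H1 s = 0,
        (forall z, z \in s -> ~ (ball z d `<=` B)) -> H2 s = 0,
        (forall z, z \in s -> ~ A i z -> th G (C ix) x s = 0) &
        (forall j z, z \in s -> A j z -> th G (C ib) b s = 0)]].

Lemma transport_spec_le i t d d' : d' <= d -> transport_spec i t d -> transport_spec i t d'.
Proof.
case: t => x b ix ib a H1 H2 dd [xd Ax h]; split=> // s fs.
have [h1 h2 h3 h4 h5] := h s (finel_le dd fs); split=> //.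
- move=> h'; apply: h2 => z zs h''; apply: (h' z zs); apply: subset_trans h''; exact: le_ball.
- move=> h'; apply: h3 => z zs h''; apply: (h' z zs); apply: subset_trans h''; exact: le_ball.
Qed.

Lemma transport_exists (i : 'I_c) : exists t, exists2 d, 0 < d & transport_spec i t d.
Proof.
have [r r0 rB] := ef_radius AP.
have [d1 d10 d1P] := transported_near G Ccov (ef_connected AP) r0 rB.
have m0 : 0 < Num.min d1 (r / 2) by rewrite lt_min d10 divr_gt0.
have [x [b [D [[xV bV Ax] [Bb nKb nAb] [cD Dx Db DK]]]]] :=
  ef_joined AP i (nearset_nbhs (K := K) m0).
have [ix ixP] := Ccov x; have [ib ibP] := Ccov b.
have xK1 : nearset K d1 x by apply: nearset_le xV; rewrite ge_min lexx.
have bK1 : nearset K d1 b by apply: nearset_le bV; rewrite ge_min lexx.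
have nbK y : D y -> nbhs y (~` K).
  by move=> /DK nKy; apply: open_nbhs_nbhs; split=> //; exact/closed_openC/(ef_closedK AP).
have [a [H1 [e1 [r1 [e10 r10 E1 H10]]]]] := transported_connected G Ccov cD nbK Dx Db ixP ibP.
have [a' [H2 [e2 [r2 [e20 r20 E2 H20]]]]] := d1P ix ib x b xK1 bK1 ixP ibP.
(* Subtracting the two relations exhibits [a - a'] times the class at [b] as a coboundary on all of
   [M]. *)
have eq_a : a = a'.
  have m1 : 0 < Num.min e1 e2 by rewrite lt_min e10.
  apply/eqP; rewrite -subr_eq0; apply/eqP.
  apply: (fundamental_exact G_idom muP (H := fun s => H2 s - H1 s) Cfund m1 ibP) => s sz fs.
  have f1 : finel e1 s by apply: finel_le fs; rewrite ge_min lexx.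
  have f2 : finel e2 s by apply: finel_le fs; rewrite ge_min lexx orbT.
  have := E1 s sz f1; rewrite (E2 s sz f2) dcB mulrBl => /esym h.
  by rewrite -(addrK (dc H1 s) (a * _)) h; ring.
have xB : nbhs x B.
  have [y Ky b1] := xV; apply/nbhs_ballP; exists (r / 2) => [|z bz]; first by rewrite /= divr_gt0.
  apply: (rB y) => //; rewrite [r]splitr; apply: ball_triangle (le_ball _ b1) bz.
  by rewrite ge_min lexx orbT.
have [qa qa0 qaP] : exists2 q, 0 < q & forall z, ball x q z -> A i z.
  have [|q q0 qP] := closed_radius (x := x) (ef_closedC AP i); first by case.
  have /nbhs_ballP[q' /= q'0 q'P] := xB.
  exists (Num.min q q') => [|z bz]; first by rewrite lt_min q0.
  apply: contrapT => nA; apply: (qP z); first by apply: le_ball bz; rewrite ge_min lexx.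
  by split=> //; apply: q'P; apply: le_ball bz; rewrite ge_min lexx orbT.
have [qb qb0 qbP] : exists2 q, 0 < q & forall j z, ball b q z -> ~ A j z.
  have [|j _|q q0 qP] := @seq_unif R _ (enum 'I_c) (fun q j => forall z, ball b q z -> ~ A j z).
  - by move=> d d' j d'0 dd h z bz; apply: h; exact: le_ball bz.
  - have [|q q0 qP] := closed_radius (x := b) (ef_closed AP j).
      by move=> [//|/(nAb j)].
    by exists q => // z /qP nKA Az; apply: nKA; right.
  by exists q => // j; apply: qP; rewrite mem_enum.
have q20 : 0 < Num.min qa qb by rewrite lt_min qa0.
have [d dP0 dP] := th_unif G C q20.
have x2 : disc (C ix) 2 x by apply: disc_le ixP; rewrite ler1n.
have b2 : disc (C ib) 2 b by apply: disc_le ibP; rewrite ler1n.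
have [_ hx] := dP ix x x2; have [_ hb] := dP ib b b2.
have [dd [dd0 dd1 [dd2 dd3 dd4] dd5]] : exists dd, [/\ 0 < dd, dd <= d,
    [/\ dd <= e1, dd <= e2 & dd <= r1] & dd <= r2].
  exists (Num.min d (Num.min (Num.min e1 e2) (Num.min r1 r2))).
  by rewrite !lt_min !ge_min dP0 e10 e20 r10 r20 !lexx !orbT.
exists (TransportData x b ix ib a H1 H2), dd => //; split=> // s fs.
have fd : finel d s by exact: finel_le fs.
have Aix z : z \in s -> th G (C ix) x s != 0 -> A i z.
  move=> zs nz; apply: qaP; apply: le_ball (hx s fd nz z zs).
  by rewrite ge_min lexx.
split.
- move=> sz; split; first by apply: E1 => //; exact: finel_le fs.
  by rewrite eq_a; apply: E2 => //; exact: finel_le fs.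
- move=> h; apply: H10; first exact: finel_le fs.
  by move=> z zs h'; apply: (h z zs); apply: subset_trans h'; exact: le_ball.
- move=> h; apply: H20; first exact: finel_le fs.
  by move=> z zs h'; apply: (h z zs); apply: subset_trans h'; exact: le_ball.
- by move=> z zs nA; apply/eqP/negPn/negP => /(Aix z zs).
- move=> j z zs Aj; apply/eqP/negPn/negP => nz.
  apply: (qbP j z) => //; apply: le_ball (hb s fd nz z zs).
  by rewrite ge_min lexx orbT.
Qed.

Lemma transport_family : exists t : 'I_c -> transport_data, exists2 d, 0 < d &
  forall i, transport_spec i (t i) d.
Proof.
have [t tP] := choice transport_exists.
have [|i _|d d0 dP] := @seq_unif R _ (enum 'I_c) (fun d i => transport_spec i (t i) d).
- by move=> d d' i d'0 dd; exact: transport_spec_le.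
- exact: tP.
by exists t, d => // i; apply: dP; rewrite mem_enum.
Qed.

Lemma cochain_sumE (X : topologicalType) q (I : Type) (r : seq I) (f : I -> cochain X G q) s :
  (\sum_(i <- r) f i) s = \sum_(i <- r) f i s.
Proof. exact: (big_morph (fun f : cochain X G q => f s)). Qed.

Lemma end_classes_exist : exists (beta : 'I_c -> cech M G n) (gamma : 'I_c -> cech K G n),
  [/\ lin_indep beta, lin_indep gamma & forall j, cech_restrict K (beta j) = gamma j].
Proof.
have [t [d d0 tP]] := transport_family.
have [r r0 rB] := ef_radius AP.
pose H1 i := td_H1 (t i); pose H2 i := td_H2 (t i).
pose thx i := th G (C (td_ix (t i))) (td_x (t i)).
pose thb i s := td_coef (t i) * th G (C (td_ib (t i))) (td_b (t i)) s.
have xP i : disc (C (td_ix (t i))) 1 (td_x (t i)) /\ A i (td_x (t i)).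
  by have := tP i; case: (t i) => ? ? ? ? ? ? ? [].
have sP i s : finel d s ->
    [/\ size s = N.+1 -> thx i s = thb i s + dc (H1 i) s /\ thx i s = thb i s + dc (H2 i) s,
        (forall z, z \in s -> ~ (ball z d `<=` ~` K)) -> H1 i s = 0,
        (forall z, z \in s -> ~ (ball z d `<=` B)) -> H2 i s = 0,
        (forall z, z \in s -> ~ A i z -> thx i s = 0) &
        (forall j z, z \in s -> A j z -> thb i s = 0)].
  move=> fs; have := tP i; rewrite /thx /thb /H1 /H2; case: (t i) => x b ix ib a H H' [_ _ /(_ s fs)].
  move=> [h1 h2 h3 h4 h5]; split=> // j z zs Aj /=.
  by rewrite (h5 j z zs Aj) mulr0.
pose F i s := H1 i s - H2 i s.
have Fd i s : size s = n.+2 -> finel d s -> dc (F i) s = 0.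
  move=> sz fs; rewrite dcB; have [/(_ sz)[e1 e2] _ _ _ _] := sP i s fs.
  by move: e1; rewrite e2 => /addrI ->; rewrite subrr.
apply: (restricted_classes_indep (fun i => list_cochain_cocycle d0 (@Fd i))) => a aB i0.
pose Phi s := \sum_i a i * F i s.
have [xi [d1 [d10 xi0 xiP]]] : exists (xi : seq M -> G) d, [/\ 0 < d, xi [::] = 0 &
    forall s, size s = n.+1 -> finel d s -> (forall x, x \in s -> nearset K d x) -> Phi s = dc xi s].
  apply: (cech_coboundary_near (ef_compact AP) (ef_nonempty AP) d0).
    move=> s sz fs _; rewrite dc_sum big1// => i _; rewrite dcZ Fd ?mulr0//.
  suff <- : \sum_i a i *: cochain_pull (set_val : K -> M) (list_cochain n (F i)) =
    cochain_pull (set_val : K -> M) (list_cochain n Phi) by [].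
  by apply/funext => s; rewrite cochain_sumE.
have [d2 [d20 d21 d2d d2r]] : exists d2, [/\ 0 < d2, d2 <= d1, d2 <= d & d2 <= r / 2].
  exists (Num.min d1 (Num.min d (r / 2))).
  by rewrite !lt_min !ge_min d10 d0 divr_gt0// !lexx !orbT.
have d22 : d2 / 2 <= d2 by rewrite ler_pdivrMr// ler_peMr ?(ltW d20)// ler1n.
pose nK (s : seq M) := all (fun x => `[< nearset K d2 x >]) s.
pose xi' s := if nK s then xi s else 0.
(* Near [K] the cochains [H1] vanish, so the combination of the [- H2] is there [Phi], the
   coboundary of [xi]. Subtracting the coboundary of the truncation [xi'] makes [zeta] zero near [K]
   without changing its coboundary. *)
pose zeta s := - (\sum_i a i * H2 i s) - dc xi' s.
have [es es0 esP] : exists2 e, 0 < e & forall z z', A i0 z -> ~ nearset K (d2 / 2) z ->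
    B z' -> ball z e z' -> A i0 z'.
  by apply: (ef_separated AP i0); [have [] := Mn | rewrite divr_gt0].
have [e [e0 ed ees]] : exists e, [/\ 0 < e, e <= d2 / 2 & e <= es].
  exists (Num.min (d2 / 2) es).
  by rewrite !lt_min !ge_min es0 divr_gt0// !lexx !orbT.
have eld : e <= d by apply: le_trans ed _; exact: le_trans d22 d2d.
have zeta_near s : size s = n.+1 -> finel e s -> forall z, z \in s -> nearset K (d2 / 2) z -> zeta s = 0.
  move=> sz fs z zs zK.
  have sK x : x \in s -> nearset K d2 x.
    by move=> xs; rewrite [d2]splitr; apply: nearset_ball zK _; apply: le_ball ed _ _; exact: fs.
  have -> : zeta s = Phi s - dc xi s.
    congr (_ - _).
      rewrite -sumrN; apply: eq_bigr => i _; rewrite /F.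
      have [_ h _ _ _] := sP i s (finel_le eld fs).
      rewrite h ?sub0r ?mulrN// => x xs bK; have [y Ky b] := sK x xs.
      by apply: (bK y) => //; apply: ball_sym; apply: le_ball b.
    apply: eq_dc_in => u us _; rewrite /xi' ifT//; apply/allP => x xu.
    by apply/asboolP/sK; exact: (mem_subseq us).
  rewrite xiP ?subrr//.
    by apply: finel_le fs; apply: le_trans ed _; exact: le_trans d22 d21.
  by move=> x /sK; exact: nearset_le.
have zeta_supp s : size s = n.+1 -> finel e s -> zeta s != 0 ->
    exists2 z, z \in s & ball z d2 `<=` B.
  move=> sz fs /eqP nz; apply: contrapT => nex; apply: nz.
  have nB z : z \in s -> ~ ball z d2 `<=` B by move=> zs zB; apply: nex; exists z.
  rewrite /zeta big1 => [|i _].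
    rewrite oppr0 sub0r [dc _ _]ev_0 ?oppr0// => p pb; rewrite /xi'; case: ifPn => // /allP pK.
    have pm x : x \in p.2 -> x \in s by exact: bd1_mem pb.
    case: p.2 pK pm => // z u /(_ z (mem_head _ _))/asboolP[y Ky b] /(_ z (mem_head _ _)) zs.
    case: (nB z zs) => w bw; apply: (rB y Ky); rewrite [r]splitr.
    by apply: ball_triangle (le_ball d2r b) (le_ball d2r bw).
  have [_ _ h _ _] := sP i s (finel_le eld fs).
  rewrite h ?mulr0// => z zs h'; apply: (nB z zs); apply: subset_trans h'; exact: le_ball.
pose inA (s : seq M) := all (fun x => `[< A i0 x >]) s.
(* Cutting down creates no new coboundary: a list on which [zeta] is nonzero has a point deep in [B]
   and away from [K]. There [A i0] is uniformly separated, so a fine list with such a face in [A i0]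
   lies in [A i0]. *)
pose zeta0 s := if inA s && (size s == n.+1) then zeta s else 0.
suff : - a i0 = 0 by move/eqP; rewrite oppr_eq0 => /eqP.
apply: (fundamental_exact G_idom muP (H := zeta0) Cfund e0 (xP i0).1) => s sz fs.
have fd := finel_le eld fs.
have [_ _ _ hx _] := sP i0 s fd.
have [/allP sA|/allPn[z0 z0s /asboolPn nAz0]] := boolP (inA s).
  have -> : dc zeta0 s = dc zeta s.
    apply: eq_dc_in => u us szu; rewrite /zeta0 ifT//; apply/andP; split.
      by apply/allP => x xu; apply: sA; exact: (mem_subseq us).
    by move: szu; rewrite sz => -[<-].
  rewrite dcB dcK subr0 [RHS](_ : _ = - (\sum_i a i * dc (H2 i) s)); last first.
    rewrite [LHS]ev_oppf; congr (- _); rewrite -[LHS]/(dc _ s) dc_sum.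
    by apply: eq_bigr => i _; rewrite dcZ.
  rewrite mulNr; congr (- _); rewrite (bigD1 i0)//= big1 ?addr0 => [|i ii0].
    congr (_ * _); have [/(_ sz)[_ e2] _ _ _ hb] := sP i0 s fd.
    have [z zs] : exists z, z \in s by case: s sz {fs sA fd hx e2 hb} => // z u _; exists z; exact: mem_head.
    by rewrite -/(thx i0 s) e2 (hb i0 z zs) ?add0r//; apply/asboolP; exact: sA.
  have [/(_ sz)[_ e2] _ _ hxi hb] := sP i s fd.
  have [z zs] : exists z, z \in s by case: s sz {fs sA fd hx e2 hxi hb} => // z u _; exists z; exact: mem_head.
  have Az : A i0 z by apply/asboolP; exact: sA.
  have := e2; rewrite (hb i0 z zs Az) add0r => <-; rewrite (hxi z zs) ?mulr0// => Aiz.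
  by rewrite (ef_disj AP Aiz Az) eqxx in ii0.
rewrite -/(thx i0 s) (hx z0 z0s nAz0) mulr0; apply/esym/ev_0 => p pb; rewrite /zeta0.
case: ifP => // /andP[/allP pA /eqP szp]; apply/eqP/negPn/negP => nz.
have fp : finel e p.2 by exact: finel_bd1 pb fs.
have [z zp zB] := zeta_supp p.2 szp fp nz.
have zfar : ~ nearset K (d2 / 2) z.
  by move=> zK; rewrite (zeta_near p.2 szp fp z zp zK) eqxx in nz.
have bz : ball z e z0 by apply: fs => //; exact: bd1_mem pb zp.
apply: nAz0; apply: (esP z z0) => //.
- by apply/asboolP; exact: pA.
- by apply: zB; apply: le_ball bz; exact: le_trans ed d22.
- exact: le_ball bz.
Qed.

End Betas.

(** * Classes in degree 1 *)

Section Alphas.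
Variables (R : realType) (M : metricType R) (G : comNzRingType).
Variables (K B : set M) (c : nat) (A : 'I_c -> set M).
Hypothesis AP : end_family K B A.

Definition end_ind (i : 'I_c) (x : M) : G := (`[< A i x >])%:R.

(* The Mayer-Vietoris coboundary of the indicator function of A i. *)
Definition end_cochain (i : 'I_c) : cochain M G 1 := fun s =>
  if `[< K (s ord0) \/ K (s ord_max) >] then end_ind i (s ord_max) - end_ind i (s ord0) else 0.

Lemma end_ind0 i x : ~ A i x -> end_ind i x = 0.
Proof. by move=> nA; rewrite /end_ind asboolF. Qed.

Lemma end_ind_id i j x : A i x -> end_ind j x = (j == i)%:R.
Proof.
move=> Ax; rewrite /end_ind; case: eqP => [->|ji]; first by rewrite asboolT.
by rewrite asboolF// => Aj; apply: ji; exact: ef_disj AP _ _ _ Aj Ax.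
Qed.

(** This cover is fine enough that the end of a vertex off [K] can be read at the common point of a
    simplex whenever that point lies in [B]. *)
Lemma end_cover : exists2 U : M -> set M, pointed_cover U & forall x,
  (K x -> U x `<=` B) /\
  (~ K x -> forall y, U x y -> ~ K y /\ forall i, B y -> A i x <-> A i y).
Proof.
have h x : exists2 d, 0 < d & (K x -> ball x d `<=` B) /\
    (~ K x -> forall y, ball x d y -> ~ K y /\ forall i, B y -> A i x <-> A i y).
  have [Kx|nKx] := pselect (K x).
    by have [r r0 rB] := ef_radius AP; exists r => //; split=> // _; exact: rB.
  have [d1 d10 d1P] := closed_radius (ef_closedK AP) nKx.
  have [|i _|d2 d20 d2P] := @seq_unif R _ (enum 'I_c) (fun d i => forall y, ball x d y -> B y -> A i x <-> A i y).
  - by move=> d d' i d'0 dd h y b; apply: h; exact: le_ball b.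
  - have [Ax|nAx] := pselect (A i x).
      have [|d d0 dP] := closed_radius (x := x) (ef_closedC AP i); first by case.
      by exists d => // y b By; split=> // _; apply: contrapT => nAy; exact: (dP y b).
    have [|d d0 dP] := closed_radius (x := x) (ef_closed AP i); first by case.
    by exists d => // y b By; split=> // Ay; case: (dP y b); right.
  exists (Num.min d1 d2) => [|]; first by rewrite lt_min d10.
  split=> // _ y b; split; first by apply: d1P; apply: le_ball b; rewrite ge_min lexx.
  move=> i; apply: d2P; first by rewrite mem_enum.
  by apply: le_ball b; rewrite ge_min lexx orbT.
have h' (x : M) : exists d, 0 < d /\ (K x -> ball x d `<=` B) /\
    (~ K x -> forall y, ball x d y -> ~ K y /\ forall i, B y -> A i x <-> A i y).
  by have [d d0 dP] := h x; exists d.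
have [d dP] := choice h'.
exists (fun x => interior (ball x (d x))).
  move=> x; have [d0 _] := dP x; split; first exact: open_interior.
  exact: nbhsx_ballx.
move=> x; have [_ [h1 h2]] := dP x; split=> [Kx y /interior_subset|nKx y /interior_subset].
  exact: h1.
exact: h2.
Qed.

Lemma cobound1E (f : cochain M G 1) (s : 'I_3 -> M) :
  cobound f s = f (s \o lift (@inord 2 0)) - f (s \o lift (@inord 2 1)) + f (s \o lift (@inord 2 2)).
Proof.
have e0 : ord0 = @inord 2 0 by apply: val_inj; rewrite /= inordK.
have e1 : lift ord0 ord0 = @inord 2 1 by apply: val_inj; rewrite /= inordK.
have e2 : lift ord0 (lift ord0 ord0) = @inord 2 2 by apply: val_inj; rewrite /= inordK.
rewrite /cobound !big_ord_recl big_ord0 e2 e1 e0 addr0 !inordK// expr0 expr1 sqrrN expr1n.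
by rewrite !mul1r mulN1r addrA.
Qed.

Lemma end_cochain_cocycle i : end_cochain i \in @cech_cocycle M G 1.
Proof.
have [U pU UP] := end_cover.
rewrite unfold_in; apply/asboolP; exists U => // s [y ys].
have {}ys a : U (s a) y by exact: ys.
rewrite cobound1E /end_cochain /=.
set p0 := s (@inord 2 0); set p1 := s (@inord 2 1); set p2 := s (@inord 2 2).
have l01 : lift (@inord 2 0) (ord0 : 'I_2) = inord 1 by apply: val_inj; rewrite /= !inordK.
have l02 : lift (@inord 2 0) (ord_max : 'I_2) = inord 2 by apply: val_inj; rewrite /= !inordK.
have l10 : lift (@inord 2 1) (ord0 : 'I_2) = inord 0 by apply: val_inj; rewrite /= !inordK.
have l12 : lift (@inord 2 1) (ord_max : 'I_2) = inord 2 by apply: val_inj; rewrite /= !inordK.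
have l20 : lift (@inord 2 2) (ord0 : 'I_2) = inord 0 by apply: val_inj; rewrite /= !inordK.
have l21 : lift (@inord 2 2) (ord_max : 'I_2) = inord 1 by apply: val_inj; rewrite /= !inordK.
rewrite l01 l02 l10 l12 l20 l21 -/p0 -/p1 -/p2.
have [[a Ka]|nK] := pselect (exists a, K (s a)).
  (* A vertex in [K] puts the common point [y] in [B], and vertices off [K] then have the indicator
     of [y]. So on this simplex the cochain is the coboundary of the indicator function. *)
  have By : B y by have [h _] := UP (s a); exact: h.
  have eq_ind b b' : (if `[< K (s b) \/ K (s b') >] then end_ind i (s b') - end_ind i (s b) else 0) =
      end_ind i (s b') - end_ind i (s b).
    case: asboolP => // /not_orP[nb nb'].
    have ind b0 : ~ K (s b0) -> end_ind i (s b0) = end_ind i y.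
      move=> n0; have [_ /(_ n0 y (ys b0))[_ /(_ i By) e]] := UP (s b0).
      by rewrite /end_ind (asbool_equiv_eq e).
    by rewrite !ind// subrr.
  by rewrite /p0 /p1 /p2 !eq_ind; ring.
have nKs b : ~ K (s b) by move=> Kb; apply: nK; exists b.
rewrite !asboolF; first by rewrite subr0 addr0.
all: by case; exact: nKs.
Qed.

Lemma end_cochain_pull i : cochain_pull (set_val : K -> M) (end_cochain i) = 0.
Proof.
apply/funext => s; rewrite /cochain_pull /end_cochain /=.
have nA (u : K) : ~ A i (set_val u).
  by move=> /(ef_sub AP)[_]; apply; exact: set_mem (valP u).
by rewrite !end_ind0 ?subrr ?if_same//; exact: nA.
Qed.

Lemma end_cochains_indep (a : 'I_c -> G) :
  \sum_i a i *: end_cochain i \in @cech_coboundary M G 1 -> forall i, a i = 0.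
Proof.
rewrite unfold_in /= => /asboolP[U pU [g gP]] i0.
pose phi x := g (fun=> x).
have phiP x x' y : U x y -> U x' y -> \sum_i a i * end_cochain i (fun j : 'I_2 => if j == ord0 then x else x') = phi x' - phi x.
  move=> xy x'y; pose s (j : 'I_2) := if j == ord0 then x else x'.
  have sn : nerve U s by exists y => j _; rewrite /s; case: eqP.
  transitivity ((\sum_i a i *: end_cochain i) s).
    by rewrite (big_morph (fun f : cochain M G 1 => f s) (id1 := 0) (op1 := +%R)).
  rewrite gP// /cobound big_ord_recl big_ord1 /= expr0 expr1 mul1r mulN1r.
  by congr (_ - _); congr g; apply/funext => j; rewrite /s /= (ord1 j).
have nb x : nbhs x (U x) by have [oU Ux] := pU x; exact: open_nbhs_nbhs.
have offK x x' : ~ K x -> ~ K x' -> U x x' -> phi x = phi x'.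
  move=> nx nx' Uxx'; have [_ Ux'x'] := pU x'.
  have := phiP x x' x' Uxx' Ux'x'; rewrite big1 => [/esym/eqP|i _].
    by rewrite subr_eq0 => /eqP.
  by rewrite /end_cochain /= asboolF ?mulr0// => -[].
have toB x x' : K x -> U x x' -> \sum_i a i * end_ind i x' = phi x' - phi x.
  move=> Kx Uxx'; have [_ Ux'x'] := pU x'; rewrite -(phiP x x' x' Uxx' Ux'x').
  apply: eq_bigr => i _; rewrite /end_cochain /= asboolT; last by left.
  by rewrite [X in _ - X]end_ind0 ?subr0// => /(ef_sub AP)[_]; exact.
have nAK i x : K x -> ~ A i x by move=> Kx /(ef_sub AP)[_]; exact.
have [k0 Kk0] := ef_nonempty AP.
have phiK x : K x -> phi x = phi k0.
  apply: (@connected_induction _ _ K (fun x => phi x = phi k0) k0 (ef_connected AP) Kk0 erefl) => {}x Kx.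
  have /nbhs_ballP[d /= d0 dP] := nb x; exists d => // x' Kx' b.
  have := toB x x' Kx (dP _ b); rewrite big1 => [/esym/eqP|i _]; last first.
    by rewrite end_ind0 ?mulr0//; exact: nAK.
  by rewrite subr_eq0 => /eqP ->.
have VK : set_nbhs K (\bigcup_(x in K) U x).
  by move=> x Kx; apply: filterS (nb x) => y Uy; exists x.
have [x [b [D [[[y Ky Uyx] [y' Ky' Uyb] Ax] [Bb nKb nAb] [cD Dx Db DK]]]]] := ef_joined AP i0 VK.
have := toB y x Ky Uyx; rewrite (bigD1 i0)//= big1 => [|i ii0]; last first.
  by rewrite (end_ind_id _ Ax) (negPf ii0) mulr0.
rewrite (end_ind_id _ Ax) eqxx mulr1 addr0 => ->.
have := toB y' b Ky' Uyb; rewrite big1 => [|i _]; last by rewrite end_ind0 ?mulr0.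
rewrite (phiK y Ky) (phiK y' Ky') => ->; congr (_ - _).
apply: (@connected_induction _ _ D (fun z => phi z = phi b) b cD Db erefl) => // z Dz.
have /nbhs_ballP[d /= d0 dP] := nb z; exists d => // z' Dz' bz.
by rewrite (offK z z')//; [exact: DK | exact: DK | exact: dP].
Qed.

Lemma end_alphas_exist : exists alpha : 'I_c -> cech M G 1,
  lin_indep alpha /\ forall j, cech_restrict K (alpha j) = 0.
Proof.
exists (cech_class end_cochain_cocycle); split.
  exact: cech_class_indep end_cochains_indep.
by move=> j; apply: cech_restrict_class0; exact: end_cochain_pull.
Qed.

End Alphas.

(** * The ends of an isolated set *)

Section ForwardDynamics.
Variables (R : realType) (M : metricType R) (phi : M * R -> M).
Hypothesis flow : is_flow phi.
Local Notation "x @@ t" := (phi (x, t)) (at level 35).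

Let phi0 x : x @@ 0 = x. Proof. by have [_ + _] := flow; apply. Qed.
Let phiD x s t : (x @@ s) @@ t = x @@ (s + t). Proof. by have [_ _] := flow; apply. Qed.

Lemma flow_time_continuous x : continuous (fun t : R => x @@ t).
Proof.
move=> t; have [c _ _] := flow; apply: (@continuous_comp _ _ _ (fun t : R => (x, t)) phi); last exact: c.
exact: (@cvg_pair _ _ _ (nbhs t) (nbhs x) (nbhs t) _ _ _ (fun=> x) id (cvg_cst _) cvg_id).
Qed.

Lemma flow_space_continuous t : continuous (fun x : M => x @@ t).
Proof.
move=> x; have [c _ _] := flow; apply: (@continuous_comp _ _ _ (fun x : M => (x, t)) phi); last exact: c.
exact: (@cvg_pair _ _ _ (nbhs x) (nbhs x) (nbhs t) _ _ _ id (fun=> t) cvg_id (cvg_cst _)).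
Qed.

Lemma translate_connected A t : connected A -> connected (translate phi A t).
Proof.
move=> cA; apply: (@connected_continuous_connected _ _ A (fun x => x @@ t)) => //.
by apply: continuous_subspaceT => x; exact: flow_space_continuous.
Qed.

Lemma translate_comp A D E s t : translate phi A s `<=` D -> translate phi D t `<=` E ->
  translate phi A (s + t) `<=` E.
Proof.
move=> AD DE _ [x Ax <-]; rewrite -phiD; apply: DE; exists (x @@ s) => //.
by apply: AD; exists x.
Qed.

Variable K : set M.
Hypothesis Kinv : invariant_set phi K.

Lemma flow_notK x t : ~ K x -> ~ K (x @@ t).
Proof.
by move=> nK Kt; apply: nK; rewrite -(phi0 x) -(addrN t) -phiD; exact: Kinv.
Qed.

Section OneNbhd.
Variable N : set M.
Hypothesis NP : isolating_nbhd phi K N.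
Local Notation Pos := (Nplus phi N).
Local Notation Neg := (Nminus phi N).
Local Notation comp := (connected_component (N `\` K)).

Lemma NplusP x : Pos x <-> forall t, 0 <= t -> N (x @@ t).
Proof.
split=> [[Nx h] t t0|h]; first by apply: h; exists t => //=; rewrite in_itv/= andbT.
split; first by rewrite -(phi0 x); exact: h.
by move=> y [t /=]; rewrite in_itv/= andbT => t0 <-; exact: h.
Qed.

Lemma NminusP x : Neg x <-> forall t, t <= 0 -> N (x @@ t).
Proof.
split=> [[Nx h] t t0|h]; first by apply: h; exists t => //=; rewrite in_itv/=.
split; first by rewrite -(phi0 x); exact: h.
by move=> y [t /=]; rewrite in_itv/= => t0 <-; exact: h.
Qed.

Lemma isolating_closed : closed N.
Proof. by have [cN _ _ _] := NP; apply: (compact_closed _ cN); exact: metric_hausdorff. Qed.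

Lemma Nplus_sub x : Pos x -> N x. Proof. by case. Qed.

Lemma Nplus_flow x t : 0 <= t -> Pos x -> Pos (x @@ t).
Proof.
move=> t0 /NplusP h; apply/NplusP => s s0; rewrite phiD; apply: h.
by rewrite addr_ge0.
Qed.

Lemma Nplus_closed : closed Pos.
Proof.
have -> : Pos = \bigcap_(t in [set t : R | 0 <= t]) ((fun x => x @@ t) @^-1` N).
  apply/seteqP; split=> x; first by move=> /NplusP h t; exact: h.
  by move=> h; apply/NplusP => t; exact: h.
apply: closed_bigI => t _; apply: closed_comp => [x _|]; last exact: isolating_closed.
exact: flow_space_continuous.
Qed.

Lemma Nminus_closed : closed Neg.
Proof.
have -> : Neg = \bigcap_(t in [set t : R | t <= 0]) ((fun x => x @@ t) @^-1` N).
  apply/seteqP; split=> x; first by move=> /NminusP h t; exact: h.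
  by move=> h; apply/NminusP => t; exact: h.
apply: closed_bigI => t _; apply: closed_comp => [x _|]; last exact: isolating_closed.
exact: flow_space_continuous.
Qed.

Lemma full_orbit x : (forall t, N (x @@ t)) -> K x.
Proof.
move=> h; have [_ _ _ mx] := NP.
apply: (mx [set y | exists t, y = x @@ t]).
- by move=> y t [s ->]; exists (s + t); rewrite phiD.
- by move=> y [t ->].
- by exists 0; rewrite phi0.
Qed.

Lemma Nplus_Nminus x : Pos x -> Neg x -> K x.
Proof.
move=> /NplusP hp /NminusP hn; apply: full_orbit => t.
by have [/hp|/ltW/hn] := leP 0 t.
Qed.

(** A point of [Nplus] outside [V] cannot be flowed back inside [Nplus] for ever: its full orbit
    would lie in [N] and the point in [K]. Compactness bounds the backward time, and a point flowed
    forward for longer than the bound is in [V]. *)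
Lemma uniform_attraction V : set_nbhs K V -> exists2 T, 0 <= T &
  forall x t, Pos x -> T <= t -> V (x @@ t).
Proof.
move=> KV; have [cN _ _ _] := NP.
have cA : compact (Pos `&` ~` interior V).
  apply: subclosed_compact cN _; last by move=> x [/Nplus_sub].
  apply: closedI; first exact: Nplus_closed.
  exact/open_closedC/open_interior.
(* The backward time is [d^-1], so that it grows as [d] decreases. *)
have [|y [Py nVy]|d d0 dP] := compact_unif (P := fun d y => ~ Pos (y @@ (- d^-1))) cA.
- move=> d d' y d'0 dd h h'; apply: h.
  have -> : y @@ (- d^-1) = (y @@ (- d'^-1)) @@ (d'^-1 - d^-1) by rewrite phiD addrA addNr add0r.
  by apply: Nplus_flow h'; rewrite subr_ge0 lef_pV2// posrE (lt_le_trans d'0).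
- have [t t0 nPt] : exists2 t, 0 <= t & ~ Pos (y @@ (- t)).
    apply: contrapT => h; apply: nVy; apply: KV; apply: full_orbit => t.
    have [t0|/ltW t0] := leP 0 t; first by move/NplusP: Py; exact.
    apply/Nplus_sub; apply: contrapT => nP; apply: h; exists (- t); first by rewrite oppr_ge0.
    by rewrite opprK.
  have t10 : 0 < (t + 1)^-1 by rewrite invr_gt0; lra.
  have nP1 : ~ Pos (y @@ (- (t + 1))).
    move=> h; apply: nPt; have -> : - t = - (t + 1) + 1 by ring.
    by rewrite -phiD; apply: Nplus_flow h.
  have [d1 d10 d1P] : exists2 d, 0 < d & forall z, ball y d z -> ~ Pos (z @@ (- (t + 1))).
    apply: (@closed_radius _ _ ((fun z => z @@ (- (t + 1))) @^-1` Pos)) => //.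
    apply: closed_comp => [x _|]; last exact: Nplus_closed.
    exact: flow_space_continuous.
  exists (Num.min d1 (t + 1)^-1) => [|z _ bz h]; first by rewrite lt_min d10.
  apply: (d1P z); first by apply: le_ball bz; rewrite ge_min lexx.
  set q := (Num.min _ _)^-1 in h.
  have -> : z @@ (- (t + 1)) = (z @@ (- q)) @@ (q - (t + 1)) by rewrite phiD addrA addNr add0r.
  apply: Nplus_flow h; rewrite subr_ge0 /q -[leLHS]invrK lef_pV2 ?posrE//.
    by rewrite ge_min lexx orbT.
  by rewrite lt_min d10.
exists d^-1; first by rewrite invr_ge0 ltW.
move=> x t Px dt; have t0 : 0 <= t by apply: le_trans dt; rewrite invr_ge0 ltW.
apply: contrapT => nV; apply: (dP (x @@ t)).
  by split; [exact: Nplus_flow | move=> /interior_subset].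
by rewrite phiD; apply: Nplus_flow => //; rewrite subr_ge0.
Qed.

Lemma Nplus_component_flow x t : Pos x -> ~ K x -> 0 <= t -> comp x (x @@ t).
Proof.
move=> Px nK t0; exists [set x @@ s | s in `[0, t]%classic]; last first.
  by exists t => //=; rewrite in_itv/= lexx t0.
split.
- by exists 0 => //=; rewrite in_itv/= lexx t0.
- move=> z [s /=]; rewrite in_itv/= => /andP[s0 _] <-; split; last exact: flow_notK.
  by apply/Nplus_sub; exact: Nplus_flow.
- apply: (@connected_continuous_connected _ _ _ (fun s => x @@ s)); first exact: segment_connected.
  by apply: continuous_subspaceT => s; exact: flow_time_continuous.
Qed.

Hypothesis Nsplit : N = Pos `|` Neg.

Let NsplitP z : N z -> Pos z \/ Neg z.
Proof. by move=> Nz; have : (Pos `|` Neg) z by rewrite -Nsplit. Qed.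

(** [Nplus] and [Nminus] are closed, cover [N] and meet only inside [K]; so a connected subset of
    [N \ K] lies in one of them. *)
Lemma component_Nplus x : Pos x -> ~ K x -> comp x `<=` Pos.
Proof.
move=> Px nK; have [|||h|h] := @connected_subset _ (Pos `\` K) (Neg `\` K) (comp x).
- split; apply/seteqP; split=> // z [h1 h2].
    have Pz : Pos z by rewrite ((closure_id _).1 Nplus_closed); apply: closureS h1 => ? [].
    by have [Nz nKz] := h2; apply: nKz; exact: Nplus_Nminus.
  have Nz : Neg z by rewrite ((closure_id _).1 Nminus_closed); apply: closureS h2 => ? [].
  by have [Pz nKz] := h1; apply: nKz; exact: Nplus_Nminus.
- by move=> z /connected_component_sub[/NsplitP[]]; [left|right].
- exact: component_connected.
- by move=> z /h[].
have xNK : (N `\` K) x by split=> //; exact: Nplus_sub.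
have [Nx _] := h _ (connected_component_refl xNK).
by case: nK; exact: Nplus_Nminus.
Qed.

Lemma component_Nminus x : Neg x -> ~ K x -> comp x `<=` Neg.
Proof.
move=> Nx nK z xz; have [Nz nKz] := connected_component_sub xz.
have [Pz|//] := NsplitP Nz.
case: nK; apply: Nplus_Nminus Nx.
exact: component_Nplus Pz nKz _ (connected_component_sym xz).
Qed.

(** Once [x] and its translate both lie in [Nplus], one of them is on the forward orbit of the
    other, and this orbit stays in one component. *)
Lemma related_component_eq x y t : Pos x -> ~ K x -> (N `\` K) y ->
  translate phi (comp x) t `<=` comp y -> comp x = comp y.
Proof.
move=> Px nKx [Ny nKy] xy; have xNK : (N `\` K) x by split=> //; exact: Nplus_sub.
have xt : comp y (x @@ t) by apply: xy; exists x => //; exact: connected_component_refl.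
have nKxt : ~ K (x @@ t) by exact: flow_notK.
have Pxt : Pos (x @@ t).
  have [Py|Negy] := NsplitP Ny; first exact: component_Nplus Py nKy _ xt.
  (* If the target were in [Nminus], flowing [x] forward by [s] first would yield a point of both
     [Nplus] and [Nminus] off [K]; the choice makes [s] and [s + t] nonnegative. *)
  pose s := Num.max 0 (- t).
  have s0 : 0 <= s by rewrite le_max lexx.
  have st0 : 0 <= s + t by rewrite -lerBlDr sub0r le_max lexx orbT.
  have h : comp y (x @@ (s + t)).
    rewrite -phiD; apply: xy; exists (x @@ s) => //; exact: Nplus_component_flow.
  apply: contrapT => _; apply: (@flow_notK x (s + t) nKx); apply: Nplus_Nminus; first exact: Nplus_flow.
  exact: component_Nminus Negy nKy _ h.
rewrite (same_connected_component xt); have [t0|/ltW t0] := leP 0 t.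
  exact: same_connected_component (Nplus_component_flow Px nKx t0).
have h := @Nplus_component_flow (x @@ t) (- t) Pxt nKxt.
rewrite phiD addrN phi0 oppr_ge0 in h.
by rewrite (same_connected_component (h t0)).
Qed.

Lemma Nplus_component_near x V : Pos x -> ~ K x -> set_nbhs K V -> exists2 y, comp x y & V y.
Proof.
move=> Px nK /uniform_attraction[T T0 TP]; exists (x @@ T); last exact: TP.
exact: Nplus_component_flow.
Qed.

Lemma Nplus_stable x : Pos x -> stable_set phi K x.
Proof.
move=> Px; have [cN _ _ _] := NP; split.
  pose F := (fun t : R => x @@ t) @ +oo.
  have PF : ProperFilter F by exact: fmap_proper_filter.
  have FN : F N.
    rewrite /F /fmap /=; near=> t; move/NplusP: Px; apply; near: t.
    by apply: nbhs_pinfty_ge; exact: num_real.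
  have [p [_ pF]] := cN F PF FN; exists p => t /= t0 U pU.
  apply: pF => //; rewrite /F /fmap /=; near=> s; exists s => //=.
  rewrite in_itv/= andbT; near: s.
  by apply: nbhs_pinfty_ge; exact: num_real.
move=> z zo; apply: contrapT => nKz.
have cK : closed K.
  have [_ KN _ _] := NP.
  have -> : K = Pos `&` Neg.
    apply/seteqP; split=> [y Ky|y []]; last exact: Nplus_Nminus.
    have KsubN w : K w -> N w by move=> /KN/nbhs_singleton.
    by split; [apply/NplusP | apply/NminusP] => t _; apply/KsubN/Kinv.
  by apply: closedI; [exact: Nplus_closed | exact: Nminus_closed].
have [d d0 dP] := closed_radius cK nKz.
have d20 : 0 < d / 2 by rewrite divr_gt0.
have KV : set_nbhs K (~` ball z (d / 2)).
  move=> y Ky; apply/nbhs_ballP; exists (d / 2) => // w b bz; apply: (dP y) => //.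
  by rewrite [d]splitr; apply: ball_triangle bz (ball_sym b).
have [T T0 TP] := uniform_attraction KV.
have T1 : 0 < T + 1 by lra.
have [w [[t /= + <-] bw]] := zo (T + 1) T1 _ (nbhsx_ballx z (d / 2) d20).
rewrite in_itv/= andbT => Tt; apply: (TP x t) bw => //.
by lra.
Unshelve. all: by end_near. Qed.

End OneNbhd.

(** By uniform attraction a single time carries all of [Nplus] of one neighborhood into the other,
    so whole components are translated into components, in both directions. *)
Lemma component_transfer N N' x' : isolating_nbhd phi K N -> N = Nplus phi N `|` Nminus phi N ->
  isolating_nbhd phi K N' -> N' = Nplus phi N' `|` Nminus phi N' ->
  Nplus phi N' x' -> ~ K x' -> exists2 y, (N `\` K) y &
    end_related phi (connected_component (N' `\` K) x') (connected_component (N `\` K) y) /\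
    end_related phi (connected_component (N `\` K) y) (connected_component (N' `\` K) x').
Proof.
move=> NP Ns NP' Ns' Px' nKx'.
have [_ KN _ _] := NP; have [_ KN' _ _] := NP'.
have [T T0 TP] := uniform_attraction NP' KN; have [T' T'0 TP'] := uniform_attraction NP KN'.
have move_comp (N1 N2 : set M) x t : isolating_nbhd phi K N1 -> N1 = Nplus phi N1 `|` Nminus phi N1 ->
    Nplus phi N1 x -> ~ K x -> (forall z, Nplus phi N1 z -> N2 (phi (z, t))) ->
    translate phi (connected_component (N1 `\` K) x) t `<=` connected_component (N2 `\` K) (phi (x, t)).
  move=> P1 S1 Px nK h; have xNK : (N1 `\` K) x by split=> //; exact: Nplus_sub Px.
  apply: connected_component_max.
  - by exists x => //; exact: connected_component_refl.
  - move=> w [z xz <-]; split; first by apply: h; exact: component_Nplus P1 S1 _ Px nK _ xz.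
    by apply: flow_notK; have [] := connected_component_sub xz.
  - by apply: translate_connected; exact: component_connected.
have Py : Nplus phi N (phi (x', T)).
  by apply/NplusP => t t0; rewrite phiD; apply: TP => //; rewrite lerDl.
have nKy : ~ K (phi (x', T)) by exact: flow_notK.
exists (phi (x', T)); first by split=> //; exact: Nplus_sub Py.
split.
  by exists T; apply: move_comp => // z Pz; exact: TP.
exists T'; have -> : connected_component (N' `\` K) x' = connected_component (N' `\` K) (phi (phi (x', T), T')).
  rewrite phiD; apply: same_connected_component; apply: Nplus_component_flow => //.
  by rewrite addr_ge0.
by apply: move_comp => // z Pz; exact: TP'.
Qed.

End ForwardDynamics.

(** The base [rr i] depends only on the fiber of [i], so there are at most [m] bases and at least
    [c] other elements. *)
Lemma fiber_bases k m c (J : 'I_k -> 'I_m) : k = (m + c)%N ->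
  exists s b : 'I_c -> 'I_k, [/\ injective s, forall i, J (s i) = J (b i) &
    forall i i', b i <> s i'].
Proof.
move=> kE; pose rr i := odflt i [pick i' | J i' == J i].
have rrJ i : J (rr i) = J i.
  by rewrite /rr; case: pickP => [i' /eqP //|/(_ i)]; rewrite eqxx.
have rr_eq i j : J i = J j -> rr i = rr j.
  by move=> ij; rewrite /rr ij; case: pickP => // /(_ j); rewrite eqxx.
pose S := [set rr i | i : 'I_k]%SET.
have cS : (#|S| <= m)%N.
  rewrite -(@card_in_imset _ _ J S).
    by rewrite -[leqRHS]card_ord; exact: max_card.
  move=> _ _ /imsetP[i _ ->] /imsetP[j _ ->]; rewrite !rrJ; exact: rr_eq.
have cC : (c <= #|(~: S)%SET|)%N.
  by have := cardsC S; rewrite card_ord; move: cS; lia.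
pose s i := enum_val (widen_ord cC i).
exists s, (fun i => rr (s i)); split=> [i j /enum_val_inj/(congr1 val)/= ij|i|i i' e].
- exact: val_inj.
- by rewrite rrJ.
- have := enum_valP (widen_ord cC i'); rewrite -/(s i') -e inE => /negP; apply.
  by apply/imsetP; exists (s i).
Qed.

(** * Time reversal *)

Section ReverseFlow.
Variables (R : realType) (M : metricType R) (phi : M * R -> M).

(** Reversal exchanges [Nplus] with [Nminus] and stable with unstable sets, so the results on
    forward orbits also cover the components in [Nminus]. *)
Definition rev_flow (p : M * R) : M := phi (p.1, - p.2).

Lemma rev_flowP : is_flow phi -> is_flow rev_flow.
Proof.
move=> [c p0 pD]; split; rewrite /rev_flow /=.
- move=> p; apply: (@continuous_comp _ _ _ (fun p : M * R => (p.1, - p.2)) phi); last exact: c.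
  apply: (@cvg_pair _ _ _ (nbhs p) (nbhs p.1) (nbhs (- p.2)) _ _ _ fst (fun p => - p.2)).
    exact: cvg_fst.
  by apply: cvgN; exact: cvg_snd.
- by move=> x; rewrite oppr0.
- by move=> x s t; rewrite pD opprD.
Qed.

Lemma orbit_arc_rev x (I J : set R) : (forall t, I t <-> J (- t)) ->
  orbit_arc rev_flow x I = orbit_arc phi x J.
Proof.
move=> IJ; apply/seteqP; split=> y [t h <-]; first by exists (- t) => //; exact/IJ.
by exists (- t); [apply/IJ; rewrite opprK | rewrite /rev_flow /= opprK].
Qed.

Lemma Nplus_rev N : Nplus rev_flow N = Nminus phi N.
Proof.
have e x : orbit_arc rev_flow x `[0, +oo[ = orbit_arc phi x `]-oo, 0].
  by apply: orbit_arc_rev => t; rewrite /= !in_itv/= andbT oppr_le0.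
by apply/seteqP; split=> x [Nx h]; split=> //; move: h; rewrite e.
Qed.

Lemma Nminus_rev N : Nminus rev_flow N = Nplus phi N.
Proof.
have e x : orbit_arc rev_flow x `]-oo, 0] = orbit_arc phi x `[0, +oo[.
  by apply: orbit_arc_rev => t; rewrite /= !in_itv/= andbT oppr_ge0.
by apply/seteqP; split=> x [Nx h]; split=> //; move: h; rewrite e.
Qed.

Lemma stable_rev K : stable_set rev_flow K = unstable_set phi K.
Proof.
suff e x : omega_lim rev_flow x = alpha_lim phi x.
  by apply/seteqP; split=> x; rewrite /stable_set /unstable_set /= e.
apply: eq_bigcapr => t _; congr closure; apply: orbit_arc_rev => s.
by rewrite /= !in_itv/= andbT lerN2.
Qed.

Lemma invariant_rev A : invariant_set rev_flow A <-> invariant_set phi A.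
Proof.
split=> h x t Ax; last exact: (h x (- t)).
by have := h x (- t) Ax; rewrite /rev_flow /= opprK.
Qed.

Lemma isolating_rev K N : isolating_nbhd phi K N -> isolating_nbhd rev_flow K N.
Proof.
by move=> [cN KN iK mK]; split=> //; [exact/invariant_rev | move=> A /invariant_rev; exact: mK].
Qed.

Lemma end_related_rev A D : end_related rev_flow A D <-> end_related phi A D.
Proof.
split=> -[t h]; exists (- t) => y [x Ax <-]; apply: h; exists x => //.
by rewrite /rev_flow /= opprK.
Qed.

End ReverseFlow.

Section Ends.
Variables (R : realType) (M : metricType R) (phi : M * R -> M).
Hypothesis flow : is_flow phi.
Variable K : set M.
Hypotheses (Kiso : isolated_invariant phi K).
Local Notation comp N := (connected_component (N `\` K)).
Let rphi := rev_flow phi.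
Let rflow : is_flow rphi := rev_flowP flow.
Let Kinv : invariant_set phi K. Proof. by have [] := Kiso. Qed.
Let Krinv : invariant_set rphi K. Proof. exact/invariant_rev. Qed.

Definition split_nbhd N : Prop := isolating_nbhd phi K N /\ N = Nplus phi N `|` Nminus phi N.

Lemma nonsaddle_split N : nonsaddle_block phi K N -> split_nbhd N.
Proof. by move=> [[]]. Qed.

Lemma split_rev N : split_nbhd N ->
  isolating_nbhd rphi K N /\ N = Nplus rphi N `|` Nminus rphi N.
Proof.
by move=> [iN sN]; split; [exact: isolating_rev | rewrite Nplus_rev Nminus_rev setUC].
Qed.

Lemma split_cases N x : split_nbhd N -> (N `\` K) x ->
  ~ K x /\ (Nplus phi N x \/ Nplus rphi N x).
Proof.
move=> [_ sN] [Nx nK]; split=> //; rewrite Nplus_rev.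
by have : (Nplus phi N `|` Nminus phi N) x by rewrite -sN.
Qed.

Lemma related_comp_eq N x y : split_nbhd N -> (N `\` K) x -> (N `\` K) y ->
  end_related phi (comp N x) (comp N y) -> comp N x = comp N y.
Proof.
move=> sN xN yN xy; have [iN eN] := sN; have [irN erN] := split_rev sN.
have [nKx [Px|Px]] := split_cases sN xN.
  by have [t h] := xy; exact: (related_component_eq flow Kinv iN eN Px nKx yN h).
have [t h] := (end_related_rev phi _ _).2 xy.
exact: (related_component_eq rflow Krinv irN erN Px nKx yN h).
Qed.

Lemma comp_transfer N N' x : split_nbhd N -> split_nbhd N' -> (N' `\` K) x ->
  exists2 y, (N `\` K) y & end_related phi (comp N' x) (comp N y) /\
    end_related phi (comp N y) (comp N' x).
Proof.
move=> sN sN' xN'; have [iN eN] := sN; have [irN erN] := split_rev sN.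
have [iN' eN'] := sN'; have [irN' erN'] := split_rev sN'.
have [nKx [Px|Px]] := split_cases sN' xN'.
  exact: component_transfer.
have [y yN [h1 h2]] := component_transfer rflow Krinv irN erN irN' erN' Px nKx.
by exists y => //; split; apply/end_related_rev.
Qed.

Lemma comp_near N x V : split_nbhd N -> (N `\` K) x -> set_nbhs K V ->
  exists2 y, comp N x y & V y.
Proof.
move=> sN xN; have [iN eN] := sN; have [irN erN] := split_rev sN.
by have [nKx [Px|Px]] := split_cases sN xN; [apply: Nplus_component_near Px nKx | apply: Nplus_component_near Px nKx].
Qed.

Lemma split_influence N : split_nbhd N -> N `\` K `<=` influence phi K `\` K.
Proof.
move=> sN x xN; have [iN eN] := sN; have [irN erN] := split_rev sN.
have [nKx [Px|Px]] := split_cases sN xN; split=> //.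
  by left; exact: Nplus_stable Px.
by right; rewrite -stable_rev; exact: Nplus_stable Px.
Qed.

Lemma split_closed N : split_nbhd N -> closed N.
Proof. by move=> [iN _]; exact: isolating_closed iN. Qed.

Lemma closed_K : closed K.
Proof. by have [cK _ _ _ _] := Kiso; apply: (compact_closed _ cK); exact: metric_hausdorff. Qed.

Lemma comp_closedU N x : closed N -> closed (K `|` comp N x).
Proof.
move=> cN y; rewrite closureU => -[/closed_K|cy]; first by left.
have [|nKy] := pselect (K y); first by left.
right; have Ny : N y.
  by apply: cN; apply: closureS cy => z /connected_component_sub[].
have [xN|nxN] := pselect ((N `\` K) x); last first.
  move: cy; rewrite connected_component_out// => /(_ setT filterT)[z [[]]].
(* The closure of the component within [N \ K] is connected, hence contained in the component. *)
have cc : connected (closure (comp N x) `&` (N `\` K)).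
  move=> U U0 [W oW UW] [F cF UF].
  have sub z : comp N x z -> (closure (comp N x) `&` (N `\` K)) z.
    by move=> xz; split; [exact: subset_closure | exact: connected_component_sub xz].
  have e : comp N x `&` U = comp N x.
    apply: (@component_connected _ (N `\` K) x).
    - have [u Uu] := U0; have [[cu _] Wu] : ((closure (comp N x) `&` (N `\` K)) `&` W) u by rewrite -UW.
      have [v [xv Wv]] := cu W (open_nbhs_nbhs (conj oW Wu)); exists v; split=> //.
      by rewrite UW; split=> //; exact: sub.
    - exists W => //; rewrite UW; apply/seteqP; split=> z; first by move=> [xz [_ Wz]].
      by move=> [xz Wz]; do ?split=> //; [exact: subset_closure | have [] := connected_component_sub xz | have [] := connected_component_sub xz].
    - exists F => //; rewrite UF; apply/seteqP; split=> z; first by move=> [xz [_ Fz]].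
      by move=> [xz Fz]; do ?split=> //; [exact: subset_closure | have [] := connected_component_sub xz | have [] := connected_component_sub xz].
  rewrite UF; apply/seteqP; split=> z; first by case.
  move=> zc; split=> //; have [cz _] := zc; apply: cF; apply: closureS cz => w xw.
  have : (comp N x `&` U) w by rewrite e.
  by rewrite UF => -[_ []].
have := connected_component_max _ _ cc; apply.
- by split; [apply: subset_closure; exact: connected_component_refl | exact: xN].
- by move=> z [].
- by split.
Qed.

Lemma end_family_exists c : connected K -> complexity_is phi K c ->
  exists B (A : 'I_c -> set M), end_family K B A.
Proof.
move=> cK [k [m [ck cm kE]]]; have [compK _ K0 _ _] := Kiso.
(* For [c = 0] there may be no K-end from which to take a block, and the empty family serves; for
   [c > 0] there is a K-end, and with it a block. *)
have [c0|cpos] := posnP c.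
  exists setT, (fun=> set0); subst c; split=> //; try by case.
  by move=> x _; exact: filterT.
have /card_set_bijP[f [fK f_inj f_surj]] := ck.
have /card_set_bijP[h [hC h_inj _]] := cm.
have [N Nb] : exists N, nonsaddle_block phi K N.
  have k0 : `I_k 0%N by rewrite /= kE addn_gt0 cpos orbT.
  by have [_ [C [N Nb _] _] _] := f_surj _ k0; exists N.
have sN := nonsaddle_split Nb.
have class_eq x y : (N `\` K) x -> (N `\` K) y ->
    end_related phi (comp N x) (comp N y) -> comp N x = comp N y.
  exact: related_comp_eq.
(* The enumerated ends are represented in arbitrary blocks; each one is moved to a component of the
   fixed block [N]. *)
have pex (i : 'I_k) : exists p, (N `\` K) p /\ K_ends phi K (end_class phi K (comp N p)) /\
    f (end_class phi K (comp N p)) = i.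
  have [E [C' [N' /[dup] N'b /nonsaddle_split sN' [x' xN' <-]] <-] fE] := f_surj i (ltn_ord i).
  have [y yN [[t1 r1] [t2 r2]]] := comp_transfer sN sN' xN'.
  have e : end_class phi K (comp N y) = end_class phi K (comp N' x').
    apply/seteqP; split=> D [DE [t r]]; split=> //.
      by exists (t1 + t); exact: translate_comp r1 r.
    by exists (t2 + t); exact: translate_comp r2 r.
  exists y; rewrite e; split=> //; split=> //.
  by exists (comp N' x') => //; exists N' => //; exists x'.
have [p pP] := choice pex.
have pN i : (N `\` K) (p i) by have [] := pP i.
have p_inj i j : comp N (p i) = comp N (p j) -> i = j.
  move=> e; have [_ [_ fi]] := pP i; have [_ [_ fj]] := pP j.
  by apply: ord_inj; rewrite -fi -fj e.
have pcov x : (N `\` K) x -> exists i, comp N x = comp N (p i).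
  move=> xN; have xr : end_reps phi K (comp N x) by exists N => //; exists x.
  have xE : K_ends phi K (end_class phi K (comp N x)) by exists (comp N x).
  pose i := Ordinal (fK _ xE); have [_ [pE fi]] := pP i.
  exists i; apply/esym/class_eq => //.
  suff : end_class phi K (comp N (p i)) (comp N x) by case.
  have -> : end_class phi K (comp N (p i)) = end_class phi K (comp N x).
    by apply: f_inj; rewrite ?inE// fi.
  split=> //; exists 0 => _ [z xz <-]; have [_ phi0 _] := flow.
  by rewrite phi0.
have hlt x : (influence phi K `\` K) x -> (h (connected_component (influence phi K `\` K) x) < m)%N.
  by move=> xI; apply: hC; exists x.
pose J i := Ordinal (hlt _ (split_influence sN (pN i))).
have [s [b [s_inj sb bs]]] := fiber_bases J kE.
have cN := split_closed sN.
pose A i := comp N (p (s i)).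
have pp i : comp N (p i) (p i) by exact: connected_component_refl.
have Ap i l : A i (p l) -> s i = l.
  by move=> il; apply: p_inj; exact: same_connected_component.
have Acomp i x : A i x -> comp N x = comp N (p (s i)).
  by move=> ix; apply/esym/same_connected_component.
have [iN _] := sN.
exists N, A; split=> //.
- by have [] := iN.
- by move=> i x /connected_component_sub[].
- move=> i j x /Acomp e1 /Acomp e2; apply/s_inj/p_inj.
  by rewrite -e1.
- by move=> i; exact: comp_closedU.
(* Finiteness of the number of ends enters here: the complement of [A i] in [N] is a finite union of
   closed sets. *)
- move=> i; have -> : N `\` A i = \bigcup_(l in [set l | l <> s i]) (K `|` comp N (p l)) `|` K.
    apply/seteqP; split=> x; last first.
      have KN y : K y -> N y by move=> Ky; have [_ KN _ _] := iN; exact: nbhs_singleton (KN y Ky).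
      have AnK y : A i y -> ~ K y by move=> /connected_component_sub[].
      move=> [[l /= ls [Kx|lx]]|Kx]; try by split; [exact: KN | move=> /AnK].
      have [Nx nKx] := connected_component_sub lx; split=> // /Acomp e; apply: ls.
      by apply: p_inj; rewrite -e; exact: same_connected_component.
    move=> [Nx nAx]; have [Kx|nKx] := pselect (K x); first by right.
    have [l e] := pcov x (conj Nx nKx); left; exists l => /=.
      by move=> ls; apply: nAx; rewrite /A -ls -e; exact: connected_component_refl.
    by right; rewrite -e; exact: connected_component_refl.
  apply: closedU; last exact: closed_K.
  apply: closed_bigcup; first exact: finite_finset.
  by move=> l _; exact: comp_closedU.
- move=> i V KV; have [x xc Vx] := comp_near sN (pN (s i)) KV.
  have [y yc Vy] := comp_near sN (pN (b i)) KV.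
  have [Ny nKy] := connected_component_sub yc.
  exists x, y, (connected_component (influence phi K `\` K) (p (s i))); split; split=> //.
  + move=> j /Acomp e; apply: (bs i j); apply: p_inj; rewrite -e.
    exact: same_connected_component.
  + exact: component_connected.
  + have := connected_component_max (pp (s i)) (subset_trans (@connected_component_sub _ _ _) (split_influence sN)) (@component_connected _ _ _).
    exact.
  + have eq_c : connected_component (influence phi K `\` K) (p (s i)) =
        connected_component (influence phi K `\` K) (p (b i)).
      apply: h_inj; last exact: (congr1 val (sb i)).
        by apply/mem_set; exists (p (s i)) => //; exact: (split_influence sN (pN _)).
      by apply/mem_set; exists (p (b i)) => //; exact: (split_influence sN (pN _)).
    rewrite eq_c.
    have := connected_component_max (pp (b i)) (subset_trans (@connected_component_sub _ _ _) (split_influence sN)) (@component_connected _ _ _).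
    exact.
  + by move=> z /connected_component_sub[].
Qed.

End Ends.

Lemma int_or_Z2_domain (G : comNzRingType) :
  G = (int : comNzRingType) \/ G = ('Z_2 : comNzRingType) ->
  forall a b : G, a * b = 0 -> a = 0 \/ b = 0.
Proof.
move=> [->|->] a b; first by move=> /eqP; rewrite mulf_eq0 => /orP[]/eqP; [left|right].
have [->|->] : a = 0 \/ a = 1.
  by case: a => [[|[|//]] h]; [left|right]; exact: val_inj.
- by left.
- by rewrite mul1r; right.
Qed.

(** A Euclidean neighborhood of dimension 0 is a single point, which is therefore open as well as
    closed. *)
Lemma locally_euclidean0 (R : realType) (M : metricType R) (x : M) :
  connected [set: M] -> locally_euclidean R M 0 -> [set: M] = [set x].
Proof.
move=> cM /(_ x)[U [V [f [g [[oU Ux] _ _ fU _]]]]].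
have UE : U = [set x].
  apply/seteqP; split=> [y Uy|y ->] //.
  have [_ <-] := fU _ Uy; have [_ <-] := fU _ Ux.
  by congr g; apply/rowP => -[].
apply/esym/cM; first by exists x.
- by exists U => //; rewrite UE setTI.
- exists [set x]; last by rewrite setTI.
  by apply: accessible_closed_set1; apply: hausdorff_accessible; exact: metric_hausdorff.
Qed.

Theorem theorem3p7 (R : realType) (G : comNzRingType)
    (hG : G = (int : comNzRingType) \/ G = ('Z_2 : comNzRingType))
    (M : metricType R)
    (M_connected : connected [set: M])
    (M_locally_compact : locally_compact [set: M])
    (M_ANR : metric_ANR M)
    (phi : M * R -> M) (phi_flow : is_flow phi)
    (K : set M)
    (K_connected : connected K)
    (K_isolated : isolated_invariant phi K)
    (K_nonsaddle : ~ saddle phi K)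
    (c : nat) (hc : complexity_is phi K c) :
  (exists alpha : 'I_c -> cech M G 1,
      lin_indep alpha /\ forall j, cech_restrict K (alpha j) = 0) /\
  (forall n : nat, closed_manifold M n -> orientable R M G n ->
     exists (beta : 'I_c -> cech M G n.-1) (gamma : 'I_c -> cech K G n.-1),
       [/\ lin_indep beta, lin_indep gamma &
           forall j, cech_restrict K (beta j) = gamma j]).
Proof.
have [B [A AP]] := end_family_exists phi_flow K_isolated K_connected hc.
split; first exact: end_alphas_exist AP.
case: K_isolated => _ _ [x Kx] /eqP KT _ [|n] Mn [mu muP].
  (* In dimension 0, where [n.-1] is truncated, [M] would be a point, which has no nonempty proper
     subset. *)
  have eT := locally_euclidean0 x M_connected Mn.2; case: KT.
  by apply/seteqP; split=> // y _; have -> : y = x by have : [set: M] y by []; rewrite eT.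
have [k [C [Ccov Cfund]]] := atlas_exists muP x Mn.
exact: (end_classes_exist (int_or_Z2_domain hG) muP Mn AP Ccov Cfund).
Qed.
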